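(* Let $\alpha$ and $\beta$ be positive real numbers with $\alpha+\beta=1$. Let $\chi$ be a real primitive Dirichlet character modulo $q$, $q>1$, and assume that $\theta(x,\chi)>0$ for any $x>0$. Then $$L^\ast(s,\chi)=2\sum_{m=0}^\infty\sum_{n=0}^\infty c_{\chi,\alpha}(m)\,c_{\chi,\beta}(n)\Bigl(\frac{n+\beta}{m+\alpha}\Bigr)^{\frac{s-\beta+\delta(\alpha-\beta)}{4}}K_{\frac{s-\beta+\delta(\alpha-\beta)}{2}}\Bigl(\frac{2\pi}{q}\sqrt{(m+\alpha)(n+\beta)}\Bigr)$$ for any $s\in\mathbb{C}$. In particular, taking $\alpha=\beta=1/2$, $$L^\ast(s,\chi)=2\sum_{m=0}^\infty\sum_{n=0}^\infty c_{\chi,1/2}(m)\,c_{\chi,1/2}(n)\Bigl(\frac{2n+1}{2m+1}\Bigr)^{\frac s4-\frac18}K_{\frac s2-\frac14}\Bigl(\frac{\pi}{q}\sqrt{(2m+1)(2n+1)}\Bigr).$$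
   Context: Set $\delta=0$ if $\chi(-1)=1$ and $\delta=1$ if $\chi(-1)=-1$. The theta series is $\theta(x,\chi)=\sum_{n\in\mathbb{Z}}n^\delta\chi(n)e^{-\pi n^2x/q}$ for $x>0$. The completed Dirichlet $L$-function is $$L^\ast(s,\chi)=q^{\frac{s+\delta}{2}}\pi^{-\frac{s+\delta}{2}}\Gamma\Bigl(\frac{s+\delta}{2}\Bigr)\sum_{n=1}^\infty\chi(n)n^{-s}\quad(\mathrm{Re}(s)>1),$$ continued to an entire function. When $\theta(x,\chi)>0$ for all $x>0$, put $\theta(x,\chi)^\alpha=\exp(\alpha\log\theta(x,\chi))$ for real $\alpha>0$, and define the numbers $c_{\chi,\alpha}(m)$ $(m=0,1,2,\dots)$ by the expansion $$\theta(x,\chi)^\alpha=2^\alpha e^{-\frac{\pi\alpha x}{q}}\Bigl(1+\sum_{n=2}^\infty n^\delta\chi(n)e^{-\frac{\pi(n^2-1)x}{q}}\Bigr)^\alpha=2^\alpha e^{-\frac{\pi\alpha x}{q}}\sum_{j=0}^\infty\binom{\alpha}{j}\Bigl(\sum_{n=2}^\infty n^\delta\chi(n)e^{-\frac{\pi(n^2-1)x}{q}}\Bigr)^j=2^\alpha\sum_{m=0}^\infty c_{\chi,\alpha}(m)e^{-\frac{\pi(m+\alpha)x}{q}}.$$ $K_\nu$ is the $K$-Bessel function, $K_\nu(x)=\frac12\int_0^\infty e^{-\frac{x}{2}(t+\frac1t)}t^{-\nu}\frac{dt}{t}$ for $x>0$, $\nu\in\mathbb{C}$.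
   Formalization: The expansions defining c_{χ,α}(m), c_{χ,β}(n) are assumed to converge and hold for all x>0; otherwise the claim fails, e.g. χ=(·/5), α=β=1/2, where 1+Σχ(n)w^{n²-1} has a zero near 0.88e^{2.26i}, so c(m) grows exponentially and the double series diverges. *)

(* Defs.v *)
(* Stdlib reals, with Coquelicot for complex numbers, series and integrals. *)
From Stdlib Require Import Reals ZArith.
From Coquelicot Require Import Coquelicot.

Local Open Scope R_scope.

Definition real_dirichlet_character (q : nat) (chi : Z -> R) : Prop :=
  (forall a b : Z, chi (a * b)%Z = chi a * chi b) /\
  (forall a : Z, chi (a + Z.of_nat q)%Z = chi a) /\
  (forall a : Z, chi a <> 0 <-> Z.gcd a (Z.of_nat q) = 1%Z).

(* A character modulo q is induced from a proper divisor d of q exactly when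
   it is 1 on all units modulo q that are congruent to 1 modulo d. *)
Definition primitive_character (q : nat) (chi : Z -> R) : Prop :=
  forall d : nat, (d < q)%nat -> Nat.divide d q ->
    exists a : Z,
      (Z.of_nat d | a - 1)%Z /\ Z.gcd a (Z.of_nat q) = 1%Z /\ chi a <> 1.

(* chi (-1) is 1 or -1 for a real character. *)
Definition delta (chi : Z -> R) : nat :=
  if Req_EM_T (chi (-1)%Z) 1 then 0%nat else 1%nat.

Definition SeriesZ (f : Z -> R) : R :=
  Series (fun n : nat => f (Z.of_nat n)) +
  Series (fun n : nat => f (- Z.of_nat (S n))%Z).

(* The convention 0 ^ 0 = 1 for the term n = 0 is harmless: chi 0 = 0 when
   q > 1. *)
Definition theta (q : nat) (chi : Z -> R) (x : R) : R :=
  SeriesZ (fun n : Z =>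
    IZR n ^ delta chi * chi n * exp (- (PI * IZR n ^ 2 * x / INR q))).

(* [c] is the sequence of coefficients of the expansion
     theta(x)^alpha
       = 2^alpha * sum_(m >= 0) c(m) * exp (- pi (m + alpha) x / q)   (x > 0).
   Such a sequence is unique, being the coefficient sequence of a power series
   in exp (- pi x / q).  [Rpower y alpha] is exp (alpha * ln y). *)
Definition theta_power_coeffs
    (q : nat) (chi : Z -> R) (alpha : R) (c : nat -> R) : Prop :=
  forall x : R, 0 < x ->
    let term (m : nat) := c m * exp (- (PI * (INR m + alpha) * x / INR q)) in
    ex_series term /\
    Rpower (theta q chi x) alpha = Rpower 2 alpha * Series term.

Definition Cexp (z : C) : C :=
  (exp (Re z) * cos (Im z), exp (Re z) * sin (Im z)).

(* x ^ s for x > 0, with the real logarithm. *)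
Definition RCpower (x : R) (s : C) : C := Cexp (s * RtoC (ln x))%C.

Definition Cex_series (a : nat -> C) : Prop :=
  @ex_series C_AbsRing C_NormedModule a.

Definition CSeries (a : nat -> C) : C :=
  (Series (fun n => Re (a n)), Series (fun n => Im (a n))).

Definition Cex_iterated_series (a : nat -> nat -> C) : Prop :=
  (forall m : nat, Cex_series (a m)) /\
  Cex_series (fun m : nat => CSeries (a m)).

Definition CSeries_iterated (a : nat -> nat -> C) : C :=
  CSeries (fun m : nat => CSeries (a m)).

Definition CRInt_0_infty (f : R -> C) : C :=
  @RInt_gen C_R_CompleteNormedModule f (at_right 0) (Rbar_locally p_infty).

(* Euler's integral, used below only in its half-plane Re s > 0. *)
Definition Gamma (s : C) : C :=
  CRInt_0_infty (fun t : R => (RtoC (exp (- t)) * RCpower t (s - 1))%C).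

Definition BesselK (nu : C) (x : R) : C :=
  (RtoC (1 / 2) *
   CRInt_0_infty (fun t : R =>
     (RtoC (exp (- (x / 2) * (t + 1 / t))) * RCpower t (- nu) * RtoC (1 / t))%C))%C.

Definition dirichlet_term (chi : Z -> R) (s : C) (k : nat) : C :=
  (RtoC (chi (Z.of_nat (S k))) * RCpower (INR (S k)) (- s))%C.

Definition entire (F : C -> C) : Prop :=
  forall s : C, @ex_derive C_AbsRing C_NormedModule F s.

(* [Lstar] is the entire function extending the completed L-function of chi
   from Re s > 1; by the identity theorem there is at most one. *)
Definition is_completed_L (q : nat) (chi : Z -> R) (Lstar : C -> C) : Prop :=
  entire Lstar /\
  forall s : C, 1 < Re s ->
    let w := ((s + RtoC (INR (delta chi))) / RtoC 2)%C in
    Cex_series (dirichlet_term chi s) /\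
    Lstar s =
      (RCpower (INR q) w * RCpower PI (- w) * Gamma w *
       CSeries (dirichlet_term chi s))%C.

(* Main.v *)
Require Import Defs.
From Stdlib Require Import Reals ZArith Lra Lia List Permutation.
From Coquelicot Require Import Coquelicot.

Local Open Scope R_scope.

(** Put L*(s) = 1/2 int_0^oo theta(x) x^(w-1) dx with w = (s + delta)/2.  Poisson summation and the
    separability of the Gauss sums of a primitive character give theta(1/x) = W x^(delta+1/2) theta(x),
    and positivity at x = 1 forces W = 1; so theta decays rapidly at 0 and at infinity, L* is entire,
    and integrating term by term for Re s > 1 gives the Dirichlet series.  Writing theta(x) as
    theta(x)^alpha theta(x)^beta and reflecting the second factor to theta(1/x)^beta, the two
    expansions turn the integral into a double series of integrals of
    exp(-ax - b/x) x^(mu-1), which are the K-Bessel functions.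

    Termwise integration needs the coefficients c(m) to grow slowly.  With z = exp(-pi x/q), the
    function f = sum c(m) z^m is g^alpha on (0,1), where g = theta/(2z) has coefficients O(m).
    Comparing coefficients in z f' g = alpha f z g' extends this equation to the unit disk, and on each
    ray it yields |f|^2 = (|g|^2)^alpha: both sides satisfy the same linear differential equation away
    from the zeros of g, and the constant does not jump at a zero because |f|^2 and |g|^2 have there
    finite, even order.  Hence |f| = O((1-|z|)^(-2)), and Cauchy's estimate bounds c(m). *)

(** * Series of functions *)

(* Equations produced by [is_RInt_ext] live in [R_NormedModule], which [ring] rejects. *)
Ltac req := cbv beta; match goal with |- @eq _ ?u ?v => change (@eq R u v) end.

(** The obstacle is cancellation among the coefficients: the size of [f] on (0,1) does not bound
    c(m) when the signs vary, so values off the real axis are needed. There [g] may vanish and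
    [g^alpha] has no branch, but [f] itself exists on the whole disk, because its expansion
    converges for every x > 0, and its modulus can still be compared with that of [g]. This
    comparison stays within real analysis: on the ray r e^(i phi) the real part, the imaginary part
    and the squared modulus are real power series in r. The exponent of the formula arises as
    follows. Reflecting theta(x)^beta produces x^(-beta (delta + 1/2)), and w - beta (delta + 1/2) =
    (s - beta + delta (alpha - beta)) / 2 because 1 - 2 beta = alpha - beta. As for the factor 2,
    the 1/2 in front of the integral cancels 2^alpha 2^beta = 2, and the integral of exp(-ax - b/x)
    x^(mu-1) is 2 (b/a)^(mu/2) K_mu(2 sqrt(ab)). *)

Lemma ex_series_dominated (a b : nat -> R) :
  (forall n, Rabs (a n) <= b n) -> ex_series b -> ex_series a.
Proof. intros H Hb. exact (ex_series_le (V := R_CompleteNormedModule) a b H Hb). Qed.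

Lemma sum_Sn_R (a : nat -> R) (n : nat) : sum_n a (S n) = sum_n a n + a (S n).
Proof. exact (sum_Sn a n). Qed.

Lemma sum_n_ge_0 (a : nat -> R) (n : nat) : (forall k, 0 <= a k) -> 0 <= sum_n a n.
Proof.
  intros H. induction n as [|n IH].
  - rewrite sum_O. apply H.
  - rewrite sum_Sn. unfold plus; simpl. specialize (H (S n)). lra.
Qed.

Lemma sum_n_le_Series (a : nat -> R) (n : nat) :
  (forall k, 0 <= a k) -> ex_series a -> sum_n a n <= Series a.
Proof.
  intros Ha [l Hl]. rewrite (is_series_unique _ _ Hl).
  apply (is_lim_seq_incr_compare (sum_n a)); [exact Hl|].
  intro k. rewrite sum_Sn. unfold plus; simpl. specialize (Ha (S k)). lra.
Qed.

Lemma ex_series_bounded (a : nat -> R) (K : R) :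
  (forall k, 0 <= a k) -> (forall n, sum_n a n <= K) -> ex_series a.
Proof.
  intros Ha HK.
  destruct (ex_finite_lim_seq_incr (sum_n a) K) as [l Hl]; [|exact HK|now exists l].
  intro k. rewrite sum_Sn. unfold plus; simpl. specialize (Ha (S k)). lra.
Qed.

Lemma Series_tail_le (f M : nat -> R) (N : nat) :
  (forall n, Rabs (f n) <= M n) -> ex_series M ->
  Rabs (Series f - sum_n f N) <= Series M - sum_n M N.
Proof.
  intros H HM.
  assert (Hf : ex_series f) by (apply (ex_series_dominated f M); auto).
  rewrite (Series_incr_n f (S N)), (Series_incr_n M (S N)); auto; try lia.
  simpl pred. rewrite <- !sum_n_Reals.
  match goal with |- Rabs (?a + ?b - ?a') <= ?c + ?d - ?c' =>
    replace (a + b - a') with b by ring; replace (c + d - c') with d by ring end.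
  apply Rle_trans with (Series (fun k => Rabs (f (S N + k)%nat))).
  - apply Series_Rabs. apply (ex_series_dominated _ (fun k => M (S N + k)%nat)).
    + intro n. rewrite Rabs_Rabsolu. apply H.
    + now apply (ex_series_incr_n M).
  - apply Series_le.
    + intro n. split; [apply Rabs_pos|apply H].
    + now apply (ex_series_incr_n M).
Qed.

Lemma Series_tail_small (M : nat -> R) (eps : R) :
  ex_series M -> 0 < eps ->
  exists N, forall n, (N <= n)%nat -> Series M - sum_n M n < eps.
Proof.
  intros [l Hl] He. rewrite (is_series_unique _ _ Hl).
  destruct (proj2 (is_lim_seq_spec (sum_n M) (Finite l)) Hl (mkposreal eps He)) as [N HN].
  exists N. intros n Hn. specialize (HN n Hn). simpl in HN.
  apply Rabs_def2 in HN. lra.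
Qed.

Lemma continuous_sum_n (f : nat -> R -> R) (N : nat) (x : R) :
  (forall n, continuous (f n) x) ->
  continuous (fun y => sum_n (fun n => f n y) N) x.
Proof.
  intros H. induction N as [|N IH].
  - apply (continuous_ext (f 0%nat)); auto. intro y. now rewrite sum_O.
  - apply (continuous_ext (fun y => plus (sum_n (fun n => f n y) N) (f (S N) y))).
    + intro y. now rewrite sum_Sn.
    + apply (continuous_plus (fun y => sum_n (fun n => f n y) N) (f (S N))); auto.
Qed.

Lemma continuous_R_intro (f : R -> R) (x : R) :
  (forall eps, 0 < eps -> exists d, 0 < d /\ forall y, Rabs (y - x) < d -> Rabs (f y - f x) < eps) ->
  continuous f x.
Proof.
  intros H. apply filterlim_locally. intros [eps He].
  destruct (H eps He) as [d [Hd H']]. exists (mkposreal d Hd). intros y Hy.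
  apply H'. exact Hy.
Qed.

Lemma continuous_R_elim (f : R -> R) (x eps : R) :
  continuous f x -> 0 < eps ->
  exists d, 0 < d /\ forall y, Rabs (y - x) < d -> Rabs (f y - f x) < eps.
Proof.
  intros H He. destruct (proj1 (filterlim_locally f (f x)) H (mkposreal eps He)) as [d Hd].
  exists d. split; [apply cond_pos|]. intros y Hy. apply (Hd y Hy).
Qed.

Lemma continuous_Series (f : nat -> R -> R) (M : nat -> R) (x d : R) :
  0 < d -> ex_series M ->
  (forall n y, Rabs (y - x) < d -> Rabs (f n y) <= M n) ->
  (forall n, continuous (f n) x) ->
  continuous (fun y => Series (fun n => f n y)) x.
Proof.
  intros Hd HM Hb Hc. apply continuous_R_intro. intros eps He.
  destruct (Series_tail_small M (eps / 3) HM) as [N HN]; [lra|].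
  specialize (HN N (le_n N)).
  destruct (continuous_R_elim (fun y => sum_n (fun n => f n y) N) x (eps / 3)) as [d' [Hd' H']].
  - now apply continuous_sum_n.
  - lra.
  - exists (Rmin d d'). split; [now apply Rmin_glb_lt|]. intros y Hy.
    assert (H1 : Rabs (y - x) < d) by (eapply Rlt_le_trans; [exact Hy|apply Rmin_l]).
    assert (H2 : Rabs (y - x) < d') by (eapply Rlt_le_trans; [exact Hy|apply Rmin_r]).
    specialize (H' y H2).
    pose proof (Series_tail_le (fun n => f n y) M N (fun n => Hb n y H1) HM) as T1.
    assert (H3 : Rabs (x - x) < d) by (rewrite Rminus_diag, Rabs_R0; lra).
    pose proof (Series_tail_le (fun n => f n x) M N (fun n => Hb n x H3) HM) as T2.
    revert T1 T2 H'. unfold Rabs. repeat destruct Rcase_abs; lra.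
Qed.

Lemma RInt_sum_n (f : nat -> R -> R) (a b : R) (N : nat) :
  (forall n, ex_RInt (f n) a b) ->
  is_RInt (fun t => sum_n (fun n => f n t) N) a b (sum_n (fun n => RInt (f n) a b) N).
Proof.
  intros H. induction N as [|N IH].
  - rewrite sum_O. apply (is_RInt_ext (f 0%nat)).
    + intros; now rewrite sum_O.
    + apply (RInt_correct (V := R_CompleteNormedModule)), H.
  - rewrite sum_Sn. apply (is_RInt_ext (fun t => plus (sum_n (fun n => f n t) N) (f (S N) t))).
    + intros; now rewrite sum_Sn.
    + apply (is_RInt_plus (V := R_NormedModule)); auto.
      apply (RInt_correct (V := R_CompleteNormedModule)), H.
Qed.

Lemma is_series_RInt_le (f : nat -> R -> R) (M : nat -> R) (a b : R) :
  a <= b -> ex_series M ->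
  (forall n t, a <= t <= b -> Rabs (f n t) <= M n) ->
  (forall n, ex_RInt (f n) a b) ->
  ex_RInt (fun t => Series (fun n => f n t)) a b ->
  is_series (fun n => RInt (f n) a b) (RInt (fun t => Series (fun n => f n t)) a b).
Proof.
  intros Hab HM Hb Hf HS.
  apply (proj1 (is_lim_seq_spec (sum_n (fun n => RInt (f n) a b))
                  (Finite (RInt (fun t => Series (fun n => f n t)) a b)))).
  intros [eps He]. simpl.
  destruct (Series_tail_small M (eps / (b - a + 1)) HM) as [N HN].
  { apply Rdiv_lt_0_compat; lra. }
  exists N. intros n Hn. specialize (HN n Hn).
  pose proof (RInt_sum_n f a b n Hf) as Hs.
  rewrite <- (is_RInt_unique _ _ _ _ Hs).
  assert (Hs' : ex_RInt (fun t => sum_n (fun n => f n t) n) a b) by (eexists; exact Hs).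
  match goal with |- Rabs (?u - ?v) < _ => change (u - v) with (minus u v) end.
  rewrite <- (RInt_minus (V := R_CompleteNormedModule) _ _ a b Hs' HS).
  eapply Rle_lt_trans.
  - apply (abs_RInt_le_const _ a b (Series M - sum_n M n)); auto.
    + now apply (ex_RInt_minus (V := R_CompleteNormedModule)).
    + intros t Ht. match goal with |- Rabs (minus ?u ?v) <= _ => change (Rabs (u - v) <= Series M - sum_n M n) end.
      rewrite Rabs_minus_sym. apply (Series_tail_le (fun n => f n t) M n); auto.
  - assert (0 < (b - a + 1)) by lra.
    apply Rle_lt_trans with ((b - a) * (eps / (b - a + 1))).
    + apply Rmult_le_compat_l; lra.
    + apply (Rmult_lt_reg_r (b - a + 1)); auto. field_simplify; lra.
Qed.

(** Both orientations of the interval are covered because [is_derive_Series] integrates from x to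
    points on either side of it. *)
Lemma is_series_RInt (f : nat -> R -> R) (M : nat -> R) (a b : R) :
  ex_series M ->
  (forall n t, Rmin a b <= t <= Rmax a b -> Rabs (f n t) <= M n) ->
  (forall n t, Rmin a b <= t <= Rmax a b -> continuous (f n) t) ->
  (forall t, Rmin a b <= t <= Rmax a b -> continuous (fun t => Series (fun n => f n t)) t) ->
  is_series (fun n => RInt (f n) a b) (RInt (fun t => Series (fun n => f n t)) a b).
Proof.
  intros HM Hb Hf HS. destruct (Rle_dec a b) as [Hab|Hab].
  - rewrite Rmin_left, Rmax_right in * by lra.
    apply (is_series_RInt_le f M a b); auto.
    + intro n. apply (ex_RInt_continuous (V := R_CompleteNormedModule)).
      rewrite Rmin_left, Rmax_right by lra. auto.
    + apply (ex_RInt_continuous (V := R_CompleteNormedModule)).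
      rewrite Rmin_left, Rmax_right by lra. auto.
  - rewrite Rmin_right, Rmax_left in * by lra.
    assert (E1 : forall n, ex_RInt (f n) b a).
    { intro n. apply (ex_RInt_continuous (V := R_CompleteNormedModule)).
      rewrite Rmin_left, Rmax_right by lra. auto. }
    assert (E2 : ex_RInt (fun t => Series (fun n => f n t)) b a).
    { apply (ex_RInt_continuous (V := R_CompleteNormedModule)).
      rewrite Rmin_left, Rmax_right by lra. auto. }
    rewrite <- (opp_RInt_swap (V := R_CompleteNormedModule) _ b a E2).
    apply (is_series_ext (fun n => opp (RInt (f n) b a))).
    + intro n. apply (opp_RInt_swap (V := R_CompleteNormedModule) _ b a (E1 n)).
    + apply (is_series_opp (V := R_NormedModule)). apply (is_series_RInt_le f M b a); auto. lra.
Qed.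

(** Integrating the series of derivatives termwise from x to y gives the difference of the two sums,
    so the sum is an antiderivative of a continuous function. *)
Lemma is_derive_Series (f f' : nat -> R -> R) (M : nat -> R) (x d : R) :
  0 < d -> ex_series M ->
  (forall n y, Rabs (y - x) < d -> is_derive (f n) y (f' n y)) ->
  (forall n y, Rabs (y - x) < d -> continuous (f' n) y) ->
  (forall n y, Rabs (y - x) < d -> Rabs (f' n y) <= M n) ->
  (forall y, Rabs (y - x) < d -> ex_series (fun n => f n y)) ->
  is_derive (fun y => Series (fun n => f n y)) x (Series (fun n => f' n x)).
Proof.
  intros Hd HM Hf Hc Hb Hs.
  assert (HS : forall y, Rabs (y - x) < d -> continuous (fun t => Series (fun n => f' n t)) y).
  { intros y Hy. apply (continuous_Series f' M y (d - Rabs (y - x))); auto.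
    - lra.
    - intros n z Hz. apply Hb. revert Hy Hz. unfold Rabs; repeat destruct Rcase_abs; lra. }
  assert (Hin : forall y t, Rabs (y - x) < d -> Rmin x y <= t <= Rmax x y -> Rabs (t - x) < d).
  { intros y t Hy. unfold Rmin, Rmax; destruct Rle_dec; revert Hy;
      unfold Rabs; repeat destruct Rcase_abs; lra. }
  assert (HI : forall y, Rabs (y - x) < d ->
     is_RInt (fun t => Series (fun n => f' n t)) x y
       (Series (fun n => f n y) - Series (fun n => f n x))).
  { intros y Hy.
    assert (Hx : Rabs (x - x) < d) by (rewrite Rminus_diag, Rabs_R0; lra).
    pose proof (is_series_RInt f' M x y HM
      (fun n t Ht => Hb n t (Hin y t Hy Ht)) (fun n t Ht => Hc n t (Hin y t Hy Ht))
      (fun t Ht => HS t (Hin y t Hy Ht))) as Hser.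
    assert (Hser' : is_series (fun n => f n y - f n x)
       (RInt (fun t => Series (fun n => f' n t)) x y)).
    { eapply is_series_ext; [|exact Hser]. intro n. simpl.
      apply is_RInt_unique. apply (is_RInt_derive (f n) (f' n)).
      - intros t Ht. apply Hf, (Hin y t Hy Ht).
      - intros t Ht. apply Hc, (Hin y t Hy Ht). }
    rewrite <- Series_minus; auto.
    rewrite (is_series_unique _ _ Hser').
    apply (RInt_correct (V := R_CompleteNormedModule)).
    apply (ex_RInt_continuous (V := R_CompleteNormedModule)).
    intros t Ht. apply HS, (Hin y t Hy Ht). }
  replace (Series (fun n => f' n x)) with (plus 0 (Series (fun n => f' n x)))
    by (unfold plus; simpl; ring).
  apply (is_derive_ext (fun y => plus (Series (fun n => f n x))
     (Series (fun n => f n y) - Series (fun n => f n x)))).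
  { intro t. unfold plus; simpl; ring. }
  apply (is_derive_plus (V := R_NormedModule)).
  - apply (is_derive_const (V := R_NormedModule)).
  - apply (is_derive_RInt (V := R_NormedModule) (fun t => Series (fun n => f' n t))
      (fun y => Series (fun n => f n y) - Series (fun n => f n x)) x).
    + exists (mkposreal d Hd). intros y Hy. apply HI. exact Hy.
    + apply HS. rewrite Rminus_diag, Rabs_R0; lra.
Qed.

Lemma is_RInt_Rplus (f g : R -> R) (a b u v : R) :
  is_RInt f a b u -> is_RInt g a b v -> is_RInt (fun t => f t + g t) a b (u + v).
Proof. exact (is_RInt_plus (V := R_NormedModule) f g a b u v). Qed.

Lemma is_RInt_Rminus (f g : R -> R) (a b u v : R) :
  is_RInt f a b u -> is_RInt g a b v -> is_RInt (fun t => f t - g t) a b (u - v).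
Proof. exact (is_RInt_minus (V := R_NormedModule) f g a b u v). Qed.

Lemma is_RInt_Rscal (f : R -> R) (k a b u : R) :
  is_RInt f a b u -> is_RInt (fun t => k * f t) a b (k * u).
Proof. exact (is_RInt_scal (V := R_NormedModule) f a b k u). Qed.

Lemma RInt_Chasles_R (f : R -> R) (a b c : R) :
  ex_RInt f a b -> ex_RInt f b c -> RInt f a c = RInt f a b + RInt f b c.
Proof. intros H1 H2. symmetry. exact (RInt_Chasles (V := R_CompleteNormedModule) f a b c H1 H2). Qed.

Lemma ex_series_Rscal (k : R) (a : nat -> R) : ex_series a -> ex_series (fun n => k * a n).
Proof. exact (ex_series_scal (V := R_NormedModule) k a). Qed.

Lemma ex_series_Rplus (a b : nat -> R) :
  ex_series a -> ex_series b -> ex_series (fun n => a n + b n).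
Proof. exact (ex_series_plus (V := R_NormedModule) a b). Qed.

(** * Improper integrals on the half line *)

Definition is_int (f : R -> R) (l : R) : Prop :=
  is_RInt_gen f (at_right 0) (Rbar_locally p_infty) l.

Definition cont0 (f : R -> R) : Prop := forall x, 0 < x -> continuous f x.

Lemma cont0_ex_RInt (f : R -> R) (a b : R) : cont0 f -> 0 < a -> a <= b -> ex_RInt f a b.
Proof.
  intros H Ha Hab. apply (ex_RInt_continuous (V := R_CompleteNormedModule)).
  rewrite Rmin_left, Rmax_right by lra. intros z Hz. apply H. lra.
Qed.

Lemma is_int_intro (f : R -> R) (l : R) :
  cont0 f ->
  (forall eps, 0 < eps -> exists d M, 0 < d /\
     forall a b, 0 < a < d -> M < b -> a < b -> Rabs (RInt f a b - l) < eps) ->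
  is_int f l.
Proof.
  intros Hc H P [eps HP]. destruct (H eps (cond_pos eps)) as [d [M [Hd HM]]].
  unfold filtermapi.
  (* The extra bounds by 1 force a < 1 < b, which provides the hypothesis a < b. *)
  apply Filter_prod with (fun a => 0 < a < Rmin d 1) (fun b => Rmax M 1 < b).
  - assert (0 < Rmin d 1) by (apply Rmin_glb_lt; lra).
    exists (mkposreal _ H0). intros y Hy Hy0. split; auto.
    apply Rabs_def2 in Hy. unfold minus, plus, opp in Hy; simpl in Hy. lra.
  - exists (Rmax M 1). auto.
  - intros a b Ha Hb. simpl.
    assert (a < d /\ a < 1) as [H1 H2].
    { split; (eapply Rlt_le_trans; [apply Ha|]); [apply Rmin_l|apply Rmin_r]. }
    assert (M < b /\ 1 < b) as [H3 H4].
    { split; (eapply Rle_lt_trans; [|apply Hb]); [apply Rmax_l|apply Rmax_r]. }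
    exists (RInt f a b). split.
    + apply (RInt_correct (V := R_CompleteNormedModule)). apply cont0_ex_RInt; auto; lra.
    + apply HP. apply HM; lra.
Qed.

Lemma is_int_elim (f : R -> R) (l eps : R) :
  is_int f l -> 0 < eps ->
  exists d M, 0 < d /\
    forall a b, 0 < a < d -> M < b -> Rabs (RInt f a b - l) < eps.
Proof.
  intros H He.
  assert (HP : locally l (fun y => Rabs (y - l) < eps)).
  { exists (mkposreal eps He). intros y Hy. exact Hy. }
  destruct (H _ HP) as [Q1 Q2 [d Hd] [M HM] HQ].
  exists d, M. split; [apply cond_pos|]. intros a b Ha Hb.
  destruct (HQ a b) as [y [Hy1 Hy2]].
  - apply Hd; [|apply Ha]. unfold ball; simpl. unfold AbsRing_ball; simpl.
    unfold abs, minus, plus, opp; simpl. rewrite Rabs_pos_eq; lra.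
  - apply HM; auto.
  - simpl in *. rewrite (is_RInt_unique _ _ _ _ Hy1). exact Hy2.
Qed.

Lemma is_int_ext (f g : R -> R) (l : R) :
  (forall x, 0 < x -> f x = g x) -> is_int f l -> is_int g l.
Proof.
  intros H.
  refine (@is_RInt_gen_ext R_NormedModule (at_right 0) (Rbar_locally p_infty) _ _ f g l _).
  apply Filter_prod with (fun a => 0 < a) (fun b => 0 < b).
  - exists (mkposreal 1 Rlt_0_1). auto.
  - exists 0. auto.
  - intros a b Ha Hb x Hx. simpl in *. apply H.
    eapply Rlt_trans; [|apply Hx]. now apply Rmin_glb_lt.
Qed.

Lemma is_int_unique (f : R -> R) (l1 l2 : R) : is_int f l1 -> is_int f l2 -> l1 = l2.
Proof.
  intros H1 H2.
  pose proof (is_RInt_gen_unique (V := R_CompleteNormedModule) f l1 H1) as E1.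
  pose proof (is_RInt_gen_unique (V := R_CompleteNormedModule) f l2 H2) as E2.
  now rewrite <- E1, <- E2.
Qed.

Lemma is_int_plus (f g : R -> R) (l1 l2 : R) :
  is_int f l1 -> is_int g l2 -> is_int (fun x => f x + g x) (l1 + l2).
Proof. intros H1 H2. exact (is_RInt_gen_plus (V := R_NormedModule) f g l1 l2 H1 H2). Qed.

Lemma is_int_minus (f g : R -> R) (l1 l2 : R) :
  is_int f l1 -> is_int g l2 -> is_int (fun x => f x - g x) (l1 - l2).
Proof. intros H1 H2. exact (is_RInt_gen_minus (V := R_NormedModule) f g l1 l2 H1 H2). Qed.

Lemma is_int_scal (f : R -> R) (k l : R) :
  is_int f l -> is_int (fun x => k * f x) (k * l).
Proof. intros H1. exact (is_RInt_gen_scal (V := R_NormedModule) f k l H1). Qed.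

(** For a nonnegative integrand the integrals over [a, b] increase with the interval, so their
    supremum is the limit. *)
Lemma is_int_bounded (f : R -> R) (K : R) :
  cont0 f -> (forall x, 0 < x -> 0 <= f x) ->
  (forall a b, 0 < a < b -> RInt f a b <= K) ->
  exists l, is_int f l.
Proof.
  intros Hc Hp HK.
  destruct (completeness (fun y => exists a b, 0 < a < b /\ y = RInt f a b)) as [l [Hub Hl]].
  - exists K. intros y [a [b [Hab ->]]]. now apply HK.
  - exists (RInt f 1 2), 1, 2. split; [lra|auto].
  - exists l. apply is_int_intro; auto. intros eps He.
    assert (exists a0 b0, 0 < a0 < b0 /\ l - eps < RInt f a0 b0) as [a0 [b0 [H0 H0']]].
    { apply Classical_Prop.NNPP. intro N.
      assert (l <= l - eps); [|lra]. apply Hl. intros y [a [b [Hab ->]]].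
      apply Rnot_lt_le. intro. apply N. exists a, b. auto. }
    exists a0, b0. split; [lra|]. intros a b Ha Hb Hab.
    assert (RInt f a b <= l) by (apply Hub; exists a, b; split; [lra|auto]).
    assert (RInt f a0 b0 <= RInt f a b).
    { rewrite (RInt_Chasles_R f a a0 b);
        try (apply cont0_ex_RInt; auto; lra).
      rewrite (RInt_Chasles_R f a0 b0 b);
        try (apply cont0_ex_RInt; auto; lra).
      unfold plus; simpl.
      assert (0 <= RInt f a a0) by (apply RInt_ge_0; [lra|apply cont0_ex_RInt; auto; lra|intros; apply Hp; lra]).
      assert (0 <= RInt f b0 b) by (apply RInt_ge_0; [lra|apply cont0_ex_RInt; auto; lra|intros; apply Hp; lra]).
      lra. }
    apply Rabs_def1; lra.
Qed.

Lemma RInt_le_is_int (f : R -> R) (l a b : R) :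
  cont0 f -> (forall x, 0 < x -> 0 <= f x) -> is_int f l -> 0 < a < b -> RInt f a b <= l.
Proof.
  intros Hc Hp Hl Hab. apply Rnot_lt_le. intro N.
  destruct (is_int_elim f l (RInt f a b - l) Hl) as [d [M [Hd HM]]]; [lra|].
  set (a' := Rmin a (d / 2)). set (b' := Rmax b (M + 1)).
  assert (0 < a') by (apply Rmin_glb_lt; lra).
  assert (a' <= a) by apply Rmin_l. assert (a' <= d / 2) by apply Rmin_r.
  assert (b <= b') by apply Rmax_l. assert (M + 1 <= b') by apply Rmax_r.
  assert (HH : Rabs (RInt f a' b' - l) < RInt f a b - l) by (apply HM; lra).
  assert (RInt f a b <= RInt f a' b').
  { rewrite (RInt_Chasles_R f a' a b');
      try (apply cont0_ex_RInt; auto; lra).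
    rewrite (RInt_Chasles_R f a b b');
      try (apply cont0_ex_RInt; auto; lra).
    unfold plus; simpl.
    assert (0 <= RInt f a' a) by (apply RInt_ge_0; [lra|apply cont0_ex_RInt; auto; lra|intros; apply Hp; lra]).
    assert (0 <= RInt f b b') by (apply RInt_ge_0; [lra|apply cont0_ex_RInt; auto; lra|intros; apply Hp; lra]).
    lra. }
  apply Rabs_def2 in HH. lra.
Qed.

Lemma is_int_norm (f D : R -> R) (v l : R) :
  (forall x, 0 < x -> Rabs (f x) <= D x) -> is_int f v -> is_int D l -> Rabs v <= l.
Proof.
  intros H Hf HD.
  apply (RInt_gen_norm (V := R_CompleteNormedModule) (Fa := at_right 0)
           (Fb := Rbar_locally p_infty) f D v l); auto.
  - apply Filter_prod with (fun a => a < 1) (fun b => 1 < b).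
    + exists (mkposreal 1 Rlt_0_1). intros y Hy _. apply Rabs_def2 in Hy.
      unfold minus, plus, opp in Hy; simpl in Hy. lra.
    + exists 1. auto.
    + intros; simpl; lra.
  - apply Filter_prod with (fun a => 0 < a) (fun b => True).
    + exists (mkposreal 1 Rlt_0_1). auto.
    + exists 1. auto.
    + intros a b Ha _ x Hx; simpl in *. apply H. lra.
Qed.

(** [f + D] lies between 0 and 2 [D], so the nonnegative case applies to it; subtracting [D] gives
    [f]. *)
Lemma is_int_dominated (f D : R -> R) (l : R) :
  cont0 f -> cont0 D -> (forall x, 0 < x -> Rabs (f x) <= D x) -> is_int D l ->
  exists v, is_int f v.
Proof.
  intros Hf HD H Hl.
  assert (Hp : forall x, 0 < x -> 0 <= D x).
  { intros x Hx. eapply Rle_trans; [apply Rabs_pos|apply H, Hx]. }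
  destruct (is_int_bounded (fun x => f x + D x) (2 * l)) as [w Hw].
  - intros x Hx. apply (continuous_plus f D); auto.
  - intros x Hx. specialize (H x Hx). revert H. unfold Rabs; destruct Rcase_abs; lra.
  - intros a b Hab. apply Rle_trans with (2 * RInt D a b).
    + change (2 * RInt D a b) with (scal 2 (RInt D a b)).
      rewrite <- (RInt_scal (V := R_CompleteNormedModule) D a b 2)
        by (apply cont0_ex_RInt; auto; lra).
      apply RInt_le; [lra| | |].
      * apply (ex_RInt_plus (V := R_NormedModule)); apply cont0_ex_RInt; auto; lra.
      * apply (ex_RInt_scal (V := R_NormedModule)); apply cont0_ex_RInt; auto; lra.
      * intros x Hx. unfold scal; simpl; unfold mult; simpl.
        assert (H' := H x ltac:(lra)). revert H'. unfold Rabs; destruct Rcase_abs; lra.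
    + apply Rmult_le_compat_l; [lra|]. now apply RInt_le_is_int.
  - exists (w - l). apply (is_int_ext (fun x => f x + D x - D x)); [intros; ring|].
    now apply is_int_minus.
Qed.

Lemma is_int_sum_n (f : nat -> R -> R) (v : nat -> R) (N : nat) :
  (forall n, is_int (f n) (v n)) ->
  is_int (fun t => sum_n (fun n => f n t) N) (sum_n v N).
Proof.
  intros H. induction N as [|N IH].
  - rewrite sum_O. apply (is_int_ext (f 0%nat)); auto. intros; now rewrite sum_O.
  - rewrite sum_Sn. apply (is_int_ext (fun t => sum_n (fun n => f n t) N + f (S N) t)).
    + intros; now rewrite sum_Sn.
    + now apply is_int_plus.
Qed.

(** Majorants are asked for on compact subintervals only: the expansions of theta have no uniform
    majorant near 0. *)
Definition local_Mtest (f : nat -> R -> R) : Prop :=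
  forall a b, 0 < a < b -> exists M, ex_series M /\
    forall n t, a <= t <= b -> Rabs (f n t) <= M n.

Lemma cont0_Series (f : nat -> R -> R) :
  (forall n, cont0 (f n)) -> local_Mtest f -> cont0 (fun t => Series (fun n => f n t)).
Proof.
  intros Hc HM x Hx. destruct (HM (x / 2) (2 * x)) as [M [H1 H2]]; [lra|].
  apply (continuous_Series f M x (x / 2)); auto; try lra.
  - intros n y Hy. apply H2. apply Rabs_def2 in Hy. lra.
  - intro n. now apply Hc.
Qed.

Lemma Rabs_triangle_3 (x y z w t e : R) :
  Rabs (x - y) < e / 3 -> Rabs (z - x) <= t -> Rabs (w - y) <= t -> t < e / 3 ->
  Rabs (z - w) < e.
Proof.
  intros H1 H2 H3 H4. apply Rabs_def2 in H1.
  apply Rabs_le_between in H2. apply Rabs_le_between in H3. apply Rabs_def1; lra.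
Qed.

(** The tail of [I] bounds the tails of both sides uniformly in the interval [a, b]; a finite sum of
    improper integrals handles the rest. *)
Lemma is_int_Series (f : nat -> R -> R) (I v : nat -> R) :
  (forall n, cont0 (f n)) -> local_Mtest f -> ex_series I ->
  (forall n a b, 0 < a < b -> RInt (fun t => Rabs (f n t)) a b <= I n) ->
  (forall n, is_int (f n) (v n)) ->
  ex_series v /\ is_int (fun t => Series (fun n => f n t)) (Series v).
Proof.
  intros Hc HM HI Hb Hv.
  assert (Hc' : forall n a b, 0 < a < b -> Rabs (RInt (f n) a b) <= I n).
  { intros n a b Hab. eapply Rle_trans; [|apply Hb, Hab].
    apply abs_RInt_le; [lra|]. apply cont0_ex_RInt; auto; lra. }
  assert (Hvn : forall n, Rabs (v n) <= I n).
  { intro n. apply Rnot_lt_le. intro N.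
    destruct (is_int_elim (f n) (v n) (Rabs (v n) - I n) (Hv n)) as [d [M [Hd H]]]; [lra|].
    set (a := Rmin (d / 2) 1). set (b := Rmax (M + 1) 2).
    assert (0 < a) by (apply Rmin_glb_lt; lra).
    assert (a <= d / 2) by apply Rmin_l. assert (a <= 1) by apply Rmin_r.
    assert (M + 1 <= b) by apply Rmax_l. assert (2 <= b) by apply Rmax_r.
    specialize (H a b ltac:(lra) ltac:(lra)). specialize (Hc' n a b ltac:(lra)).
    pose proof (Rabs_triang_inv (v n) (RInt (f n) a b)) as T.
    rewrite Rabs_minus_sym in T. lra. }
  assert (Hev : ex_series v) by (apply (ex_series_dominated v I); auto).
  split; auto. apply is_int_intro; [now apply cont0_Series|].
  intros eps He. destruct (Series_tail_small I (eps / 3) HI) as [N HN]; [lra|].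
  specialize (HN N (le_n N)).
  destruct (is_int_elim _ _ (eps / 3) (is_int_sum_n f v N Hv)) as [d [M [Hd H]]]; [lra|].
  exists d, M. split; auto. intros a b Ha Hb' Hab. specialize (H a b Ha Hb').
  assert (Hf : forall n, ex_RInt (f n) a b) by (intro n; apply cont0_ex_RInt; auto; lra).
  rewrite (is_RInt_unique _ _ _ _ (RInt_sum_n f a b N Hf)) in H.
  destruct (HM a b) as [B [HB1 HB2]]; [lra|].
  assert (Hser : is_series (fun n => RInt (f n) a b) (RInt (fun t => Series (fun n => f n t)) a b)).
  { apply (is_series_RInt_le f B); auto; try lra.
    apply cont0_ex_RInt; try lra. now apply cont0_Series. }
  rewrite <- (is_series_unique _ _ Hser).
  pose proof (Series_tail_le (fun n => RInt (f n) a b) I N (fun n => Hc' n a b ltac:(lra)) HI) as T1.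
  pose proof (Series_tail_le v I N Hvn HI) as T2.
  exact (Rabs_triangle_3 _ _ _ _ _ _ H T1 T2 HN).
Qed.

Lemma cont0_Rabs (f : R -> R) : cont0 f -> cont0 (fun t => Rabs (f t)).
Proof.
  intros H x Hx. apply (continuous_comp f Rabs); [auto|]. apply continuous_Rabs.
Qed.

(** A bound on the partial sums of absolute values makes the integrals of the |f_n| summable, with
    sum at most [l]; these integrals serve as the [I] of [is_int_Series]. *)
Lemma is_int_Series_dominated (f : nat -> R -> R) (v : nat -> R) (D : R -> R) (l : R) :
  (forall n, cont0 (f n)) -> local_Mtest f -> cont0 D -> is_int D l ->
  (forall n t, 0 < t -> sum_n (fun k => Rabs (f k t)) n <= D t) ->
  (forall n, is_int (f n) (v n)) ->
  ex_series v /\ is_int (fun t => Series (fun n => f n t)) (Series v).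
Proof.
  intros Hc HM HD Hl Hs Hv.
  assert (H1 : forall n t, 0 < t -> Rabs (f n t) <= D t).
  { intros n t Ht. eapply Rle_trans; [|apply (Hs n t Ht)].
    destruct n as [|n]; [rewrite sum_O; lra|]. rewrite sum_Sn. unfold plus; simpl.
    pose proof (sum_n_ge_0 (fun k => Rabs (f k t)) n (fun k => Rabs_pos _)). lra. }
  assert (H2 : forall n, exists I, is_int (fun t => Rabs (f n t)) I).
  { intro n. apply (is_int_dominated _ D l); auto.
    - now apply cont0_Rabs.
    - intros x Hx. rewrite Rabs_Rabsolu. auto. }
  pose (I := fun n => RInt_gen (fun t => Rabs (f n t)) (at_right 0) (Rbar_locally p_infty)).
  assert (HI : forall n, is_int (fun t => Rabs (f n t)) (I n)).
  { intro n. refine (@RInt_gen_correct R_CompleteNormedModule (at_right 0) (Rbar_locally p_infty) _ _ (fun t => Rabs (f n t)) _).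
    destruct (H2 n) as [i Hi]. now exists i. }
  apply (is_int_Series f I v); auto.
  - apply (ex_series_bounded I l).
    + intro k. eapply Rle_trans; [apply Rabs_pos|].
      apply (is_int_norm (f k) (fun t => Rabs (f k t)) (v k)); auto. intros; lra.
    + intro n. eapply Rle_trans; [apply Rle_abs|].
      apply (is_int_norm (fun t => sum_n (fun k => Rabs (f k t)) n) D); auto.
      * intros x Hx. rewrite Rabs_pos_eq; [auto|]. apply sum_n_ge_0. intro; apply Rabs_pos.
      * now apply is_int_sum_n.
  - intros n a b Hab. apply RInt_le_is_int; auto.
    + now apply cont0_Rabs.
    + intros; apply Rabs_pos.
Qed.

Lemma is_int_comp_scale (f : R -> R) (k l : R) :
  0 < k -> cont0 f -> is_int f l -> is_int (fun t => k * f (k * t)) l.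
Proof.
  intros Hk Hc Hl.
  assert (Hg : forall t, is_derive (fun t => k * t) t k).
  { intro t. auto_derive; auto. ring. }
  apply is_int_intro.
  - intros x Hx. apply (continuous_scal_r k (fun t => f (k * t))).
    apply (continuous_comp (fun t => k * t) f).
    + apply (ex_derive_continuous (V := R_NormedModule)). now exists k.
    + apply Hc. nra.
  - intros eps He. destruct (is_int_elim f l eps Hl He) as [d [M [Hd H]]].
    exists (d / k), (M / k). split; [now apply Rdiv_lt_0_compat|].
    intros a b Ha Hb Hab.
    assert (a * k < d) by (apply Rmult_lt_reg_r with (/ k); [now apply Rinv_0_lt_compat|];
      unfold Rdiv in Ha; rewrite Rmult_assoc, Rinv_r; lra).
    assert (M < b * k) by (apply Rmult_lt_reg_r with (/ k); [now apply Rinv_0_lt_compat|];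
      unfold Rdiv in Hb; rewrite Rmult_assoc, Rinv_r; lra).
    rewrite (RInt_ext _ (fun y => scal k (f (k * y)))) by reflexivity.
    rewrite (RInt_comp (V := R_CompleteNormedModule) f (fun t => k * t) (fun _ => k)).
    + apply H; nra.
    + intros x Hx. rewrite Rmin_left, Rmax_right in Hx by lra. apply Hc. nra.
    + intros x Hx. split; auto. apply continuous_const.
Qed.

Lemma is_int_comp_inv (f : R -> R) (k l : R) :
  0 < k -> cont0 f -> is_int f l -> is_int (fun t => k / t ^ 2 * f (k / t)) l.
Proof.
  intros Hk Hc Hl.
  assert (Hg : forall t, 0 < t -> is_derive (fun t => k / t) t (- (k / t ^ 2))).
  { intros t Ht. auto_derive; [lra|]. field. lra. }
  assert (Hc1 : cont0 (fun t => k / t ^ 2)).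
  { intros x Hx. apply (ex_derive_continuous (V := R_NormedModule)). auto_derive. nra. }
  assert (Hc2 : cont0 (fun t => f (k / t))).
  { intros x Hx. apply (continuous_comp (fun t => k / t) f).
    - apply (ex_derive_continuous (V := R_NormedModule)). eexists. now apply Hg.
    - apply Hc. now apply Rdiv_lt_0_compat. }
  apply is_int_intro.
  - intros x Hx. apply (continuous_mult (fun t => k / t ^ 2) (fun t => f (k / t))); auto.
  - intros eps He. destruct (is_int_elim f l eps Hl He) as [d [M [Hd H]]].
    assert (HM1 : 0 < Rabs M + 1) by (pose proof (Rabs_pos M); lra).
    (* The map t -> k / t exchanges the ends 0 and infinity, hence the thresholds. [Rabs M + 1]
       stands in for [M], which may fail to be positive. *)
    exists (k / (Rabs M + 1)), (k / d). split; [now apply Rdiv_lt_0_compat|].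
    intros a b Ha Hb Hab.
    assert (0 < k / d) by now apply Rdiv_lt_0_compat.
    assert (E : RInt (fun t => k / t ^ 2 * f (k / t)) a b = RInt f (k / b) (k / a)).
    { rewrite <- (opp_RInt_swap (V := R_CompleteNormedModule) f (k / a) (k / b)).
      2:{ apply (ex_RInt_swap (V := R_NormedModule)). apply cont0_ex_RInt; auto.
          - apply Rdiv_lt_0_compat; lra.
          - apply Rmult_le_compat_l; [lra|]. apply Rinv_le_contravar; lra. }
      rewrite <- (RInt_comp (V := R_CompleteNormedModule) f (fun t => k / t) (fun t => - (k / t ^ 2)) a b).
      - rewrite <- (RInt_opp (V := R_CompleteNormedModule)).
        + apply RInt_ext. intros x Hx. unfold scal, opp; simpl; unfold mult; simpl. ring.
        + apply cont0_ex_RInt; try lra. intros x Hx.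
          apply (continuous_mult (fun t => - (k / t ^ 2)) (fun t => f (k / t))); auto.
          apply (continuous_opp (V := R_NormedModule)). auto.
      - intros x Hx. rewrite Rmin_left, Rmax_right in Hx by lra. apply Hc.
        apply Rdiv_lt_0_compat; lra.
      - intros x Hx. rewrite Rmin_left, Rmax_right in Hx by lra. split; [apply Hg; lra|].
        apply (continuous_opp (V := R_NormedModule)). apply Hc1. lra. }
    rewrite E. apply H.
    + assert (0 < / b) by (apply Rinv_0_lt_compat; lra).
      split; [apply Rdiv_lt_0_compat; lra|].
      apply Rmult_lt_reg_r with b; [lra|]. unfold Rdiv. rewrite Rmult_assoc, Rinv_l by lra.
      apply Rmult_lt_reg_r with (/ d); [now apply Rinv_0_lt_compat|].
      replace (d * b * / d) with b by (field; lra). unfold Rdiv in Hb. lra.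
    + apply Rle_lt_trans with (Rabs M); [apply Rle_abs|].
      apply Rlt_le_trans with (Rabs M + 1); [lra|].
      apply Rmult_le_reg_r with a; [lra|]. unfold Rdiv. rewrite Rmult_assoc, Rinv_l by lra.
      destruct Ha as [Ha1 Ha2]. apply Rlt_le in Ha2.
      apply (Rmult_le_compat_l (Rabs M + 1)) in Ha2; [|lra].
      replace ((Rabs M + 1) * (k / (Rabs M + 1))) with k in Ha2 by (field; lra). lra.
Qed.

(* [dom e] is the derivative of (x / (1 + x)) ^ e / e, hence integrable on (0, oo) for e > 0, of size
   x ^ (e - 1) at 0 and x ^ (-2) at infinity. *)
Definition dom (e x : R) : R := Rpower (x / (1 + x)) (e - 1) / (1 + x) ^ 2.

Lemma cont0_dom (e : R) : cont0 (dom e).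
Proof.
  intros x Hx. apply (ex_derive_continuous (V := R_NormedModule)).
  unfold dom, Rpower.
  assert (0 < x / (1 + x)) by (apply Rdiv_lt_0_compat; lra).
  auto_derive. repeat split; auto; try lra; nra.
Qed.

Lemma dom_pos (e x : R) : 0 < x -> 0 < dom e x.
Proof.
  intros Hx. unfold dom, Rpower. apply Rdiv_lt_0_compat; [apply exp_pos|nra].
Qed.

Lemma is_int_dom (e : R) : 0 < e -> exists l, is_int (dom e) l.
Proof.
  intros He. apply (is_int_bounded (dom e) (/ e)).
  - apply cont0_dom.
  - intros x Hx. left. now apply dom_pos.
  - intros a b Hab.
    assert (H : is_RInt (dom e) a b (/ e * Rpower (b / (1 + b)) e - / e * Rpower (a / (1 + a)) e)).
    { apply (is_RInt_derive (fun x => / e * Rpower (x / (1 + x)) e)).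
      - intros x Hx. rewrite Rmin_left, Rmax_right in Hx by lra.
        assert (0 < x / (1 + x)) by (apply Rdiv_lt_0_compat; lra).
        unfold dom, Rpower. auto_derive; [repeat split; auto; lra|].
        replace ((e - 1) * ln (x / (1 + x))) with (e * ln (x / (1 + x)) + - ln (x / (1 + x))) by ring.
        rewrite exp_plus, exp_Ropp, exp_ln by auto. unfold Rdiv. field. repeat split; lra.
      - intros x Hx. rewrite Rmin_left, Rmax_right in Hx by lra. apply cont0_dom. lra. }
    rewrite (is_RInt_unique _ _ _ _ H).
    assert (0 < Rpower (a / (1 + a)) e) by (unfold Rpower; apply exp_pos).
    assert (Rpower (b / (1 + b)) e <= 1).
    { assert (0 < b / (1 + b)) by (apply Rdiv_lt_0_compat; lra).
      assert (b / (1 + b) < 1) by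
        (replace (b / (1 + b)) with (1 - / (1 + b)) by (field; lra);
         assert (0 < / (1 + b)) by (apply Rinv_0_lt_compat; lra); lra).
      assert (ln (b / (1 + b)) < 0) by (rewrite <- ln_1; now apply ln_increasing).
      left. apply Rlt_le_trans with (exp 0); [|rewrite exp_0; lra].
      unfold Rpower. apply exp_increasing. nra. }
    assert (0 < / e) by now apply Rinv_0_lt_compat. nra.
Qed.

Lemma is_int_dom_le (f : R -> R) (e K : R) :
  0 < e -> cont0 f -> (forall x, 0 < x -> Rabs (f x) <= K * dom e x) -> exists v, is_int f v.
Proof.
  intros He Hc H. destruct (is_int_dom e He) as [l Hl].
  apply (is_int_dominated f (fun x => K * dom e x) (K * l)); auto.
  - intros x Hx. apply (continuous_scal_r K (dom e)). now apply cont0_dom.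
  - now apply is_int_scal.
Qed.

(** * Fourier uniqueness and the Gaussian *)

Lemma continuous_of_derive (f : R -> R) (x l : R) : is_derive f x l -> continuous f x.
Proof. intros H. apply (ex_derive_continuous (V := R_NormedModule)). now exists l. Qed.

(** By cos^2 = (1 + cos 2)/2 and the product formula, each factor cos(pi t)^2 only mixes a frequency
    with its two neighbours. *)
Lemma fourier_kernel_orthogonal (Psi : R -> R) :
  (forall k : nat, is_RInt (fun t => Psi t * cos (2 * PI * INR k * t)) 0 (1 / 2) 0) ->
  forall N k : nat,
    is_RInt (fun t => Psi t * cos (PI * t) ^ (2 * N) * cos (2 * PI * INR k * t)) 0 (1 / 2) 0.
Proof.
  intros H. induction N as [|N IH]; intro k.
  - apply (is_RInt_ext (fun t => Psi t * cos (2 * PI * INR k * t))); [|apply H].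
    intros x _. simpl. ring.
  (* [k'] is |k - 1|: the cosine is even, so frequency -1 counts as 1. *)
  - set (k' := match k with O => 1%nat | S j => j end).
    replace 0 with (1 / 2 * 0 + (1 / 4 * 0 + 1 / 4 * 0)) at 2 by ring.
    eapply is_RInt_ext; [|exact (is_RInt_Rplus _ _ _ _ _ _ (is_RInt_Rscal _ (1 / 2) _ _ _ (IH k))
      (is_RInt_Rplus _ _ _ _ _ _ (is_RInt_Rscal _ (1 / 4) _ _ _ (IH (S k)))
        (is_RInt_Rscal _ (1 / 4) _ _ _ (IH k'))))].
    intros t _. req.
    replace (2 * S N)%nat with (2 + 2 * N)%nat by lia. rewrite pow_add.
    assert (E : cos (PI * t) ^ 2 = (1 + cos (2 * PI * t)) / 2).
    { replace (2 * PI * t) with (2 * (PI * t)) by ring. rewrite cos_2a_cos. field. }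
    rewrite E.
    assert (E1 : cos (2 * PI * INR (S k) * t) + cos (2 * PI * INR k' * t)
                 = 2 * (cos (2 * PI * t) * cos (2 * PI * INR k * t))).
    { rewrite S_INR. replace (2 * PI * (INR k + 1) * t) with (2 * PI * INR k * t + 2 * PI * t) by ring.
      assert (E2 : cos (2 * PI * INR k' * t) = cos (2 * PI * INR k * t - 2 * PI * t)).
      { destruct k as [|j]; unfold k'.
        - simpl INR. rewrite <- cos_neg. f_equal. ring.
        - rewrite S_INR. f_equal. ring. }
      rewrite E2, cos_plus, cos_minus. ring. }
    transitivity (Psi t * cos (PI * t) ^ (2 * N) * (1 / 2 * cos (2 * PI * INR k * t)
      + 1 / 4 * (cos (2 * PI * INR (S k) * t) + cos (2 * PI * INR k' * t)))).
    + ring.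
    + rewrite E1. field.
Qed.

(* Test [Psi] against cos (pi t) ^ (2 N), whose mass concentrates at 0 as N grows. *)
Lemma fourier_uniqueness_pos (Psi : R -> R) :
  (forall t, continuous Psi t) ->
  (forall k : nat, is_RInt (fun t => Psi t * cos (2 * PI * INR k * t)) 0 (1 / 2) 0) ->
  ~ 0 < Psi 0.
Proof.
  intros Hc H Hp.
  destruct (continuous_R_elim Psi 0 (Psi 0 / 2) (Hc 0)) as [d [Hd Hd']]; [lra|].
  set (eta := Rmin (d / 2) (1 / 4)).
  assert (He : 0 < eta) by (apply Rmin_glb_lt; lra).
  assert (He1 : eta <= d / 2) by apply Rmin_l. assert (He2 : eta <= 1 / 4) by apply Rmin_r.
  destruct (continuity_ab_maj (fun t => Rabs (Psi t)) 0 (1 / 2)) as [xm [Hxm _]]; [lra| |].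
  { intros c _. apply continuity_pt_filterlim. apply (continuous_comp Psi Rabs); auto.
    apply continuous_Rabs. }
  set (M := Rabs (Psi xm)) in *.
  (* The kernel is at least A^N on [0, eta/2] and at most B^N on [eta, 1/2], with B < A. *)
  set (A := cos (PI * (eta / 2)) ^ 2). set (B := cos (PI * eta) ^ 2).
  pose proof PI_RGT_0 as Hpi.
  assert (HcB : 0 <= cos (PI * eta)) by (apply cos_ge_0; nra).
  assert (HcA : cos (PI * eta) < cos (PI * (eta / 2))) by (apply cos_decreasing_1; nra).
  assert (HAB : 0 <= B < A) by (unfold A, B; nra).
  assert (Hcont : forall N t, continuous (fun t => Psi t * cos (PI * t) ^ (2 * N)) t).
  { intros N t. apply (continuous_mult Psi (fun t => cos (PI * t) ^ (2 * N))); auto.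
    apply (ex_derive_continuous (V := R_NormedModule)). auto_derive; auto. }
  assert (Hex : forall N a b, ex_RInt (fun t => Psi t * cos (PI * t) ^ (2 * N)) a b).
  { intros. apply (ex_RInt_continuous (V := R_CompleteNormedModule)). intros; apply Hcont. }
  (* The vanishing integral is split at eta/2 and eta. The first piece is bounded below through Psi
     >= Psi(0)/2, the middle one is nonnegative, and the last is at least -M B^N / 2. For large N
     this contradicts (B/A)^N -> 0. *)
  assert (Hmain : forall N, eta * Psi 0 / 4 * A ^ N <= M / 2 * B ^ N).
  { intro N. pose proof (fourier_kernel_orthogonal Psi H N 0) as H0.
    assert (H1 : RInt (fun t => Psi t * cos (PI * t) ^ (2 * N)) 0 (1 / 2) = 0).
    { apply is_RInt_unique. eapply is_RInt_ext; [|exact H0]. intros x _. req. change (INR 0) with 0.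
      rewrite Rmult_0_r, Rmult_0_l, cos_0. ring. }
    rewrite (RInt_Chasles_R _ 0 (eta / 2) (1 / 2)) in H1 by apply Hex.
    rewrite (RInt_Chasles_R _ (eta / 2) eta (1 / 2)) in H1 by apply Hex.
    assert (Hlow : forall t, 0 <= t <= eta -> Psi 0 / 2 <= Psi t).
    { intros t Ht. assert (Rabs (Psi t - Psi 0) < Psi 0 / 2).
      { apply Hd'. rewrite Rminus_0_r, Rabs_pos_eq; lra. }
      apply Rabs_def2 in H2. lra. }
    assert (I1 : eta / 2 * (Psi 0 / 2 * A ^ N) <=
                 RInt (fun t => Psi t * cos (PI * t) ^ (2 * N)) 0 (eta / 2)).
    { replace (eta / 2 * (Psi 0 / 2 * A ^ N)) with (RInt (fun _ => Psi 0 / 2 * A ^ N) 0 (eta / 2)).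
      2:{ rewrite RInt_const. unfold scal; simpl; unfold mult; simpl. ring. }
      apply RInt_le; [lra|apply ex_RInt_const|apply Hex|].
      intros t Ht. apply Rmult_le_compat; try lra.
      - apply pow_le. lra.
      - apply Hlow; lra.
      - unfold A. rewrite <- pow_mult. apply pow_incr. split; [lra|].
        apply cos_decr_1; nra. }
    assert (I2 : 0 <= RInt (fun t => Psi t * cos (PI * t) ^ (2 * N)) (eta / 2) eta).
    { apply RInt_ge_0; [lra|apply Hex|]. intros t Ht. apply Rmult_le_pos.
      - specialize (Hlow t ltac:(lra)). lra.
      - rewrite pow_mult. apply pow_le, pow2_ge_0. }
    assert (I3 : (1 / 2 - eta) * (- (M * B ^ N)) <=
                 RInt (fun t => Psi t * cos (PI * t) ^ (2 * N)) eta (1 / 2)).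
    { replace ((1 / 2 - eta) * (- (M * B ^ N))) with (RInt (fun _ => - (M * B ^ N)) eta (1 / 2)).
      2:{ rewrite RInt_const. unfold scal; simpl; unfold mult; simpl. ring. }
      apply RInt_le; [lra|apply ex_RInt_const|apply Hex|].
      intros t Ht.
      assert (Hm : Rabs (Psi t) <= M) by (apply Hxm; lra).
      assert (Hq : 0 <= cos (PI * t) ^ (2 * N) <= B ^ N).
      { unfold B. rewrite <- pow_mult. split.
        - apply pow_le. apply cos_ge_0; nra.
        - apply pow_incr. split; [apply cos_ge_0; nra|]. apply cos_decr_1; nra. }
      assert (Rabs (Psi t * cos (PI * t) ^ (2 * N)) <= M * B ^ N).
      { rewrite Rabs_mult. apply Rmult_le_compat; try apply Rabs_pos; auto.
        rewrite Rabs_pos_eq; lra. }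
      apply Rabs_le_between in H2. lra. }
    assert (0 <= M * B ^ N).
    { apply Rmult_le_pos; [apply Rabs_pos|apply pow_le; lra]. }
    assert (0 <= eta * (M * B ^ N)) by (apply Rmult_le_pos; lra). lra. }
  assert (HA : 0 < A) by lra.
  assert (HM0 : 0 <= M) by apply Rabs_pos.
  destruct (pow_lt_1_zero (B / A)) with (y := eta * Psi 0 / 4 / (M / 2 + 1)) as [N HN].
  - rewrite Rabs_pos_eq.
    + apply Rmult_lt_reg_r with A; auto. unfold Rdiv. rewrite Rmult_assoc, Rinv_l; lra.
    + apply Rmult_le_pos; [lra|]. left. now apply Rinv_0_lt_compat.
  - apply Rdiv_lt_0_compat; [nra|lra].
  - specialize (HN N (le_n N)). specialize (Hmain N).
    assert (HAN : 0 < A ^ N) by now apply pow_lt.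
    rewrite Rabs_pos_eq in HN.
    2:{ apply pow_le. apply Rmult_le_pos; [lra|]. left. now apply Rinv_0_lt_compat. }
    unfold Rdiv in HN at 1. rewrite Rpow_mult_distr, pow_inv in HN.
    apply (Rmult_lt_compat_r (A ^ N)) in HN; auto.
    rewrite Rmult_assoc, Rinv_l in HN by lra.
    apply (Rmult_lt_compat_r (M / 2 + 1)) in HN; [|lra].
    replace (eta * Psi 0 / 4 / (M / 2 + 1) * A ^ N * (M / 2 + 1)) with (eta * Psi 0 / 4 * A ^ N) in HN
      by (field; lra).
    assert (0 <= B ^ N) by (apply pow_le; lra). lra.
Qed.

Lemma fourier_uniqueness (Psi : R -> R) :
  (forall t, continuous Psi t) ->
  (forall k : nat, is_RInt (fun t => Psi t * cos (2 * PI * INR k * t)) 0 (1 / 2) 0) ->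
  Psi 0 = 0.
Proof.
  intros Hc H. apply Rle_antisym.
  - apply Rnot_lt_le. now apply fourier_uniqueness_pos.
  - apply Rnot_lt_le. intro N.
    apply (fourier_uniqueness_pos (fun t => - Psi t)); [| |lra].
    + intro t. apply (continuous_opp (V := R_NormedModule)). auto.
    + intro k. replace 0 with (-1 * 0) at 2 by ring.
      eapply is_RInt_ext; [|exact (is_RInt_Rscal _ (-1) _ _ _ (H k))].
      intros x _. req. ring.
Qed.

Lemma Rabs_sin_le (x : R) : Rabs (sin x) <= Rabs x.
Proof.
  destruct (MVT_gen sin 0 x cos) as [c [_ Hc]].
  - intros y _. apply is_derive_sin.
  - intros y _. apply continuity_sin.
  - rewrite sin_0, !Rminus_0_r in Hc. rewrite Hc, Rabs_mult.
    pose proof (COS_bound c). assert (Rabs (cos c) <= 1) by (apply Rabs_le; lra).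
    pose proof (Rabs_pos x). nra.
Qed.

Lemma one_minus_cos (x : R) : 1 - cos x = 2 * sin (x / 2) ^ 2.
Proof. replace x with (2 * (x / 2)) at 1 by field. rewrite cos_2a_sin. ring. Qed.

Lemma one_minus_cos_le_sqr (x : R) : Rabs (1 - cos x) <= x ^ 2 / 2.
Proof.
  rewrite one_minus_cos, Rabs_mult, <- RPow_abs, (Rabs_pos_eq 2) by lra.
  pose proof (Rabs_sin_le (x / 2)). pose proof (Rabs_pos (sin (x / 2))).
  apply Rle_trans with (2 * Rabs (x / 2) ^ 2).
  - apply Rmult_le_compat_l; [lra|]. now apply pow_incr.
  - rewrite pow2_abs. right. field.
Qed.

Lemma one_minus_cos_le_abs (x : R) : Rabs (1 - cos x) <= Rabs x.
Proof.
  rewrite one_minus_cos, Rabs_mult, <- RPow_abs, (Rabs_pos_eq 2) by lra.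
  pose proof (Rabs_sin_le (x / 2)). pose proof (Rabs_pos (sin (x / 2))).
  assert (Rabs (sin (x / 2)) <= 1) by (pose proof (SIN_bound (x / 2)); apply Rabs_le; lra).
  replace (Rabs x) with (2 * Rabs (x / 2)).
  - nra.
  - unfold Rdiv. rewrite Rabs_mult, (Rabs_pos_eq (/ 2)); lra.
Qed.

Lemma sin_minus_id_le (x : R) : Rabs (sin x - x) <= x ^ 2.
Proof.
  destruct (MVT_gen (fun x => sin x - x) 0 x (fun x => cos x - 1)) as [c [Hc1 Hc]].
  - intros y _. auto_derive; auto. ring.
  - intros y _. apply continuity_pt_filterlim.
    apply (ex_derive_continuous (V := R_NormedModule) (fun x => sin x - x)). auto_derive; auto.
  - rewrite sin_0, !Rminus_0_r in Hc. rewrite Hc, Rabs_mult.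
    rewrite Rabs_minus_sym. pose proof (one_minus_cos_le_abs c).
    assert (Rabs c <= Rabs x).
    { revert Hc1. unfold Rmin, Rmax. destruct Rle_dec; unfold Rabs; repeat destruct Rcase_abs; lra. }
    rewrite <- (pow2_abs x). pose proof (Rabs_pos x). nra.
Qed.

(** Being uniform in u, this bound can be integrated against the Gaussian in
    [is_derive_gauss_cos]. *)
Lemma cos_remainder (u v : R) : Rabs (cos (u + v) - cos u + v * sin u) <= 2 * v ^ 2.
Proof.
  replace (cos (u + v) - cos u + v * sin u)
    with (- (cos u * (1 - cos v)) - sin u * (sin v - v)) by (rewrite cos_plus; ring).
  eapply Rle_trans; [apply Rabs_triang|]. rewrite !Rabs_Ropp, !Rabs_mult.
  assert (Rabs (cos u) <= 1) by (pose proof (COS_bound u); apply Rabs_le; lra).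
  assert (Rabs (sin u) <= 1) by (pose proof (SIN_bound u); apply Rabs_le; lra).
  pose proof (one_minus_cos_le_sqr v). pose proof (sin_minus_id_le v).
  pose proof (Rabs_pos (cos u)). pose proof (Rabs_pos (sin u)).
  pose proof (Rabs_pos (1 - cos v)). pose proof (Rabs_pos (sin v - v)).
  pose proof (pow2_ge_0 v). nra.
Qed.

(** A quadratic remainder is what a pointwise second-order bound on the integrand leaves after
    integration, so this criterion serves for differentiating under the integral sign. *)
Lemma is_derive_quadratic (f : R -> R) (x l K : R) :
  (forall h, Rabs (f (x + h) - f x - h * l) <= K * h ^ 2) -> is_derive f x l.
Proof.
  intros H. apply is_derive_Reals. intros eps He.
  assert (HK : 0 < Rabs K + 1) by (pose proof (Rabs_pos K); lra).
  exists (mkposreal (eps / (Rabs K + 1)) (Rdiv_lt_0_compat _ _ He HK)).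
  intros h Hh Hd. simpl in Hd. specialize (H h).
  replace ((f (x + h) - f x) / h - l) with ((f (x + h) - f x - h * l) / h) by (field; auto).
  unfold Rdiv. rewrite Rabs_mult, Rabs_inv.
  assert (Hp : 0 < Rabs h) by now apply Rabs_pos_lt.
  apply Rmult_lt_reg_r with (Rabs h); auto. rewrite Rmult_assoc, Rinv_l, Rmult_1_r by lra.
  eapply Rle_lt_trans; [exact H|].
  assert (Rabs h * (Rabs K + 1) < eps).
  { apply Rmult_lt_reg_r with (/ (Rabs K + 1)); [now apply Rinv_0_lt_compat|].
    rewrite Rmult_assoc, Rinv_r by lra. lra. }
  rewrite <- (pow2_abs h).
  apply Rle_lt_trans with (Rabs h * (Rabs h * Rabs K)).
  - pose proof (Rle_abs K). simpl. nra.
  - rewrite (Rmult_comm eps). apply Rmult_lt_compat_l; auto. nra.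
Qed.

(** For n > 0, raise c x / n <= exp(c x / n) to the n-th power; this gives the constant (n/c)^n. *)
Lemma pow_le_exp (n : nat) (c : R) :
  0 < c -> exists K, 0 < K /\ forall x, 0 <= x -> x ^ n <= K * exp (c * x).
Proof.
  intros Hc. destruct n as [|n].
  - exists 1. split; [lra|]. intros x Hx. simpl.
    pose proof (exp_ineq1_le (c * x)). nra.
  - set (m := INR (S n)). assert (Hm : 0 < m) by (apply lt_0_INR; lia).
    exists ((m / c) ^ S n). split; [apply pow_lt, Rdiv_lt_0_compat; auto|].
    intros x Hx.
    assert (E : exp (c * x) = exp (c * x / m) ^ S n).
    { rewrite <- Rpower_pow by apply exp_pos. unfold Rpower. rewrite ln_exp.
      f_equal. fold m. field. lra. }
    rewrite E, <- Rpow_mult_distr. apply pow_incr. split; auto.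
    pose proof (exp_ineq1_le (c * x / m)).
    apply Rle_trans with (m / c * (c * x / m)).
    + right. field. lra.
    + apply Rmult_le_compat_l; [left; now apply Rdiv_lt_0_compat|lra].
Qed.

(** * The cosine transform of the Gaussian *)

Definition gauss (kappa t : R) : R := exp (- (kappa * t ^ 2)).

Lemma gauss_pos (kappa t : R) : 0 < gauss kappa t.
Proof. apply exp_pos. Qed.

Lemma gauss_dominated (kappa : R) :
  0 < kappa -> exists K, 0 < K /\ forall t, 0 < t -> (1 + t) ^ 2 * gauss kappa t <= K * dom 1 t.
Proof.
  intros Hk. destruct (pow_le_exp 2 kappa Hk) as [C [HC H]].
  exists (4 * C * exp kappa). split; [pose proof (exp_pos kappa); nra|].
  intros t Ht. unfold dom. replace (1 - 1) with 0 by ring.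
  unfold Rpower; rewrite Rmult_0_l, exp_0.
  unfold Rdiv; rewrite Rmult_1_l.
  assert (Hg := gauss_pos kappa t).
  apply Rmult_le_reg_r with ((1 + t) ^ 2); [nra|].
  rewrite (Rmult_assoc _ (/ _)), Rinv_l, Rmult_1_r by nra.
  specialize (H (1 + t ^ 2) ltac:(nra)).
  assert (E : exp (kappa * (1 + t ^ 2)) * gauss kappa t = exp kappa).
  { unfold gauss. rewrite <- exp_plus. f_equal. ring. }
  apply (Rmult_le_compat_r (gauss kappa t)) in H; [|lra].
  rewrite Rmult_assoc, E in H.
  apply Rle_trans with (4 * ((1 + t ^ 2) ^ 2 * gauss kappa t)); [|lra].
  replace ((1 + t) ^ 2 * gauss kappa t * (1 + t) ^ 2) with ((1 + t) ^ 4 * gauss kappa t) by ring.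
  rewrite <- Rmult_assoc. apply Rmult_le_compat_r; [lra|].
  assert ((1 + t) ^ 2 <= 2 * (1 + t ^ 2)) by (pose proof (pow2_ge_0 (t - 1)); lra).
  replace ((1 + t) ^ 4) with (((1 + t) ^ 2) ^ 2) by ring.
  replace (4 * (1 + t ^ 2) ^ 2) with ((2 * (1 + t ^ 2)) ^ 2) by ring.
  apply pow_incr. split; [apply pow2_ge_0|assumption].
Qed.

Lemma ex_int_gauss (kappa : R) (f : R -> R) :
  0 < kappa -> cont0 f -> (forall t, 0 < t -> Rabs (f t) <= (1 + t) ^ 2) ->
  exists v, is_int (fun t => gauss kappa t * f t) v.
Proof.
  intros Hk Hf Hb. destruct (gauss_dominated kappa Hk) as [K [HK H]].
  apply (is_int_dom_le _ 1 K); [lra| |].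
  - intros x Hx. apply (continuous_mult (gauss kappa) f); auto.
    apply (ex_derive_continuous (V := R_NormedModule)). unfold gauss. auto_derive; auto.
  - intros x Hx. specialize (H x Hx). specialize (Hb x Hx).
    pose proof (gauss_pos kappa x).
    rewrite Rabs_mult, (Rabs_pos_eq (gauss kappa x)) by lra. nra.
Qed.

Definition gauss_cos (kappa xi : R) : R :=
  RInt_gen (fun t => gauss kappa t * cos (2 * PI * xi * t)) (at_right 0) (Rbar_locally p_infty).

Lemma is_int_RInt_gen (f : R -> R) (v : R) :
  is_int f v -> is_int f (RInt_gen f (at_right 0) (Rbar_locally p_infty)).
Proof.
  intros H.
  exact (@RInt_gen_correct R_CompleteNormedModule (at_right 0) (Rbar_locally p_infty) _ _ f
           (ex_intro _ v H)).
Qed.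

Lemma is_int_gauss_cos (kappa xi : R) :
  0 < kappa -> is_int (fun t => gauss kappa t * cos (2 * PI * xi * t)) (gauss_cos kappa xi).
Proof.
  intros Hk. destruct (ex_int_gauss kappa (fun t => cos (2 * PI * xi * t)) Hk) as [v Hv].
  - intros x Hx. apply (ex_derive_continuous (V := R_NormedModule)). auto_derive; auto.
  - intros t Ht. pose proof (COS_bound (2 * PI * xi * t)). apply Rabs_le. nra.
  - exact (is_int_RInt_gen _ _ Hv).
Qed.

Lemma is_int_derive (F f : R -> R) (la lb : R) :
  cont0 f -> (forall x, 0 < x -> is_derive F x (f x)) ->
  (forall eps, 0 < eps -> exists d, 0 < d /\ forall a, 0 < a < d -> Rabs (F a - la) < eps) ->
  (forall eps, 0 < eps -> exists M, forall b, M < b -> Rabs (F b - lb) < eps) ->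
  is_int f (lb - la).
Proof.
  intros Hf HF Ha Hb. apply is_int_intro; auto. intros eps He.
  destruct (Ha (eps / 2)) as [d [Hd H1]]; [lra|]. destruct (Hb (eps / 2)) as [M H2]; [lra|].
  exists d, M. split; auto. intros a b Hda HMb Hab.
  assert (H : is_RInt f a b (F b - F a)).
  { apply (is_RInt_derive F f); intros x Hx; rewrite Rmin_left, Rmax_right in Hx by lra;
      [apply HF|apply Hf]; lra. }
  rewrite (is_RInt_unique _ _ _ _ H).
  specialize (H1 a Hda). specialize (H2 b HMb). apply Rabs_def2 in H1. apply Rabs_def2 in H2.
  apply Rabs_def1; lra.
Qed.

(** Integration by parts: [F] is the boundary term and vanishes at both ends. This integral is, up
    to a factor -2 pi, the derivative of [gauss_cos] in xi, so it yields a differential equation for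
    [gauss_cos]. *)
Lemma is_int_gauss_id_sin (kappa xi : R) :
  0 < kappa ->
  is_int (fun t => gauss kappa t * (t * sin (2 * PI * xi * t))) (PI * xi / kappa * gauss_cos kappa xi).
Proof.
  intros Hk.
  pose (F := fun t => - / (2 * kappa) * (gauss kappa t * sin (2 * PI * xi * t))).
  pose (f := fun t => gauss kappa t * (t * sin (2 * PI * xi * t))
                      - PI * xi / kappa * (gauss kappa t * cos (2 * PI * xi * t))).
  assert (Hf : forall x, continuous f x).
  { intro x. apply (ex_derive_continuous (V := R_NormedModule)). unfold f, gauss. auto_derive; auto. }
  assert (HF : forall x, is_derive F x (f x)).
  { intro x. unfold F, f, gauss. auto_derive; auto. 
    replace (kappa * (x * (x * 1))) with (kappa * x ^ 2) by ring. field. lra. }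
  assert (I : is_int f (0 - 0)).
  { apply (is_int_derive F f 0 0); auto.
    - intros x _. apply Hf.
    - intros eps He. destruct (continuous_R_elim F 0 eps) as [d [Hd H]]; auto.
      + eapply continuous_of_derive, HF.
      + exists d. split; auto. intros a Ha. specialize (H a).
        assert (E : F 0 = 0) by (unfold F; rewrite Rmult_0_r, sin_0; ring).
        rewrite E in H. apply H. rewrite Rminus_0_r, Rabs_pos_eq; lra.
    (* For b >= 1 the Gaussian is at most 1 / (kappa b), so |F b| <= 1 / (2 kappa^2 b). *)
    - intros eps He. exists (1 / (2 * kappa ^ 2 * eps) + 1). intros b Hb.
      assert (H0 : 0 < 1 / (2 * kappa ^ 2 * eps)) by
        (apply Rdiv_lt_0_compat; [lra|];
         apply Rmult_lt_0_compat; auto; apply Rmult_lt_0_compat; [lra|now apply pow_lt]).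
      rewrite Rminus_0_r. unfold F. rewrite Rabs_mult, Rabs_Ropp, Rabs_mult.
      rewrite (Rabs_pos_eq (/ _)) by (left; apply Rinv_0_lt_compat; lra).
      rewrite (Rabs_pos_eq (gauss _ _)) by (left; apply gauss_pos).
      assert (Rabs (sin (2 * PI * xi * b)) <= 1) by
        (pose proof (SIN_bound (2 * PI * xi * b)); apply Rabs_le; lra).
      pose proof (gauss_pos kappa b).
      apply Rle_lt_trans with (/ (2 * kappa) * gauss kappa b).
      + apply Rmult_le_compat_l; [left; apply Rinv_0_lt_compat; lra|]. nra.
      + assert (Hg : gauss kappa b * (kappa * b) <= 1).
        { apply Rle_trans with (gauss kappa b * exp (kappa * b ^ 2)).
          - apply Rmult_le_compat_l; [lra|].
            pose proof (exp_ineq1_le (kappa * b ^ 2)).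
            assert (b <= b ^ 2) by nra. nra.
          - unfold gauss. rewrite <- exp_plus. right.
            replace (- (kappa * b ^ 2) + kappa * b ^ 2) with 0 by ring. apply exp_0. }
        apply Rmult_lt_reg_r with (kappa * b * (2 * kappa)); [nra|].
        replace (/ (2 * kappa) * gauss kappa b * (kappa * b * (2 * kappa)))
          with (gauss kappa b * (kappa * b)) by (field; lra).
        eapply Rle_lt_trans; [exact Hg|].
        apply Rle_lt_trans with (eps * (kappa * (1 / (2 * kappa ^ 2 * eps)) * (2 * kappa))).
        2:{ apply Rmult_lt_compat_l; auto. apply Rmult_lt_compat_r; [lra|].
            apply Rmult_lt_compat_l; lra. }
        right. field. split; lra. }
  pose proof (is_int_plus _ _ _ _ I (is_int_scal _ (PI * xi / kappa) _ (is_int_gauss_cos kappa xi Hk))) as J.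
  simpl in J. replace (0 - 0 + PI * xi / kappa * gauss_cos kappa xi)
    with (PI * xi / kappa * gauss_cos kappa xi) in J by ring.
  eapply is_int_ext; [|exact J]. intros x _. unfold f. ring.
Qed.

Lemma is_derive_gauss_cos (kappa xi : R) :
  0 < kappa ->
  is_derive (gauss_cos kappa) xi (- (2 * PI ^ 2 * xi / kappa) * gauss_cos kappa xi).
Proof.
  intros Hk.
  destruct (ex_int_gauss kappa (fun t => t ^ 2) Hk) as [Q HQ].
  { intros x _. apply (ex_derive_continuous (V := R_NormedModule)). auto_derive; auto. }
  { intros t Ht. rewrite Rabs_pos_eq by apply pow2_ge_0. nra. }
  (* [cos_remainder] with v = 2 pi h t gives 2 v^2 = 8 pi^2 h^2 t^2, and [Q] is the integral of t^2
     against the Gaussian. *)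
  apply (is_derive_quadratic _ _ _ (8 * PI ^ 2 * Q)). intro h.
  pose proof (is_int_minus _ _ _ _ (is_int_gauss_cos kappa (xi + h) Hk) (is_int_gauss_cos kappa xi Hk)) as J1.
  pose proof (is_int_scal _ (2 * PI * h) _ (is_int_gauss_id_sin kappa xi Hk)) as J2.
  pose proof (is_int_plus _ _ _ _ J1 J2) as J.
  pose proof (is_int_scal _ (8 * PI ^ 2 * h ^ 2) _ HQ) as J3.
  replace (gauss_cos kappa (xi + h) - gauss_cos kappa xi -
     h * (- (2 * PI ^ 2 * xi / kappa) * gauss_cos kappa xi))
    with (gauss_cos kappa (xi + h) - gauss_cos kappa xi +
      2 * PI * h * (PI * xi / kappa * gauss_cos kappa xi)) by (field; lra).
  replace (8 * PI ^ 2 * Q * h ^ 2) with (8 * PI ^ 2 * h ^ 2 * Q) by ring.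
  refine (is_int_norm _ _ _ _ _ J J3). intros t Ht. cbv beta.
  pose proof (cos_remainder (2 * PI * xi * t) (2 * PI * h * t)) as C.
  pose proof (gauss_pos kappa t) as G.
  replace (gauss kappa t * cos (2 * PI * (xi + h) * t) - gauss kappa t * cos (2 * PI * xi * t) +
     2 * PI * h * (gauss kappa t * (t * sin (2 * PI * xi * t))))
    with (gauss kappa t * (cos (2 * PI * xi * t + 2 * PI * h * t) - cos (2 * PI * xi * t)
            + 2 * PI * h * t * sin (2 * PI * xi * t))).
  2:{ replace (2 * PI * (xi + h) * t) with (2 * PI * xi * t + 2 * PI * h * t) by ring. ring. }
  rewrite Rabs_mult, (Rabs_pos_eq (gauss kappa t)) by lra.
  apply Rle_trans with (gauss kappa t * (2 * (2 * PI * h * t) ^ 2)).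
  - apply Rmult_le_compat_l; lra.
  - right. ring.
Qed.

(** By the differential equation, [gauss_cos kappa xi] times exp(pi^2 xi^2 / kappa) has derivative
    zero. *)
Lemma gauss_cos_eq (kappa xi : R) :
  0 < kappa -> 0 <= xi ->
  gauss_cos kappa xi = gauss_cos kappa 0 * exp (- (PI ^ 2 * xi ^ 2 / kappa)).
Proof.
  intros Hk Hx. destruct (Req_dec xi 0) as [->|Nx].
  { replace (- (PI ^ 2 * 0 ^ 2 / kappa)) with 0 by (field; lra). rewrite exp_0. ring. }
  set (f := fun x => gauss_cos kappa x * exp (PI ^ 2 * x ^ 2 / kappa)).
  assert (E : f 0 = f xi).
  { apply (eq_is_derive f).
    - intros t _. unfold f.
      pose proof (is_derive_gauss_cos kappa t Hk) as D.
      assert (D2 : is_derive (fun x => exp (PI ^ 2 * x ^ 2 / kappa)) t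
                    (2 * PI ^ 2 * t / kappa * exp (PI ^ 2 * t ^ 2 / kappa))).
      { auto_derive; auto.
        change (PI * (PI * 1) * (t * (t * 1)) * / kappa) with (PI ^ 2 * t ^ 2 / kappa).
        field. lra. }
      pose proof (is_derive_mult _ _ _ _ _ D D2 Rmult_comm) as D3.
      replace (@zero R_NormedModule) with
        (plus (mult (- (2 * PI ^ 2 * t / kappa) * gauss_cos kappa t) (exp (PI ^ 2 * t ^ 2 / kappa)))
              (mult (gauss_cos kappa t) (2 * PI ^ 2 * t / kappa * exp (PI ^ 2 * t ^ 2 / kappa)))); auto.
      unfold plus, mult, zero; simpl. field. lra.
    - lra. }
  unfold f in E. replace (PI ^ 2 * 0 ^ 2 / kappa) with 0 in E by (field; lra).
  rewrite exp_0, Rmult_1_r in E. rewrite E, Rmult_assoc, <- exp_plus.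
  replace (PI ^ 2 * xi ^ 2 / kappa + - (PI ^ 2 * xi ^ 2 / kappa)) with 0 by ring.
  rewrite exp_0. ring.
Qed.

(** This isolates the dependence on kappa; the factor [gauss_cos 1 0] passes into the constant W of
    [theta_reflection], which is determined by evaluation at x = 1. *)
Lemma gauss_cos_0_scale (kappa : R) :
  0 < kappa -> gauss_cos kappa 0 = gauss_cos 1 0 / sqrt kappa.
Proof.
  intros Hk. assert (Hs : 0 < sqrt kappa) by now apply sqrt_lt_R0.
  pose proof (is_int_gauss_cos 1 0 Rlt_0_1) as H1.
  apply (is_int_comp_scale _ (sqrt kappa)) in H1; auto.
  2:{ intros x _. apply (ex_derive_continuous (V := R_NormedModule)). unfold gauss. auto_derive; auto. }
  pose proof (is_int_scal _ (/ sqrt kappa) _ H1) as H2.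
  replace (gauss_cos 1 0 / sqrt kappa) with (/ sqrt kappa * gauss_cos 1 0) by (field; lra).
  refine (is_int_unique _ _ _ (is_int_gauss_cos kappa 0 Hk) _).
  eapply is_int_ext; [|exact H2]. intros x Hx. cbv beta.
  replace (2 * PI * 0 * (sqrt kappa * x)) with (2 * PI * 0 * x) by ring.
  unfold gauss. replace (1 * (sqrt kappa * x) ^ 2) with (kappa * x ^ 2).
  - field. lra.
  - rewrite Rpow_mult_distr, pow2_sqrt by lra. ring.
Qed.

Lemma is_int_lim_from_0 (f : R -> R) (l eps : R) :
  (forall x, continuous f x) -> is_int f l -> 0 < eps ->
  exists M, forall b, M < b -> Rabs (RInt f 0 b - l) < eps.
Proof.
  intros Hc Hl He.
  assert (Hex : forall a b, ex_RInt f a b).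
  { intros. apply (ex_RInt_continuous (V := R_CompleteNormedModule)). auto. }
  assert (HD : is_derive (fun a => RInt f 0 a) 0 (f 0)).
  { apply (is_derive_RInt f (fun a => RInt f 0 a) 0); auto.
    exists (mkposreal 1 Rlt_0_1). intros y _. apply (RInt_correct (V := R_CompleteNormedModule)). auto. }
  destruct (continuous_R_elim _ 0 (eps / 2) (continuous_of_derive _ _ _ HD)) as [d1 [Hd1 H1]]; [lra|].
  destruct (is_int_elim f l (eps / 2) Hl) as [d [M [Hd H]]]; [lra|].
  exists M. intros b Hb. set (a := Rmin d d1 / 2).
  assert (0 < Rmin d d1) by now apply Rmin_glb_lt.
  pose proof (Rmin_l d d1). pose proof (Rmin_r d d1).
  specialize (H a b ltac:(unfold a; lra) Hb).
  specialize (H1 a). rewrite RInt_point in H1.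
  assert (H5 : Rabs (RInt f 0 a - 0) < eps / 2).
  { apply H1. rewrite Rminus_0_r, Rabs_pos_eq; unfold a; lra. }
  rewrite (RInt_Chasles_R f 0 a b) by auto.
  apply Rabs_def2 in H. apply Rabs_def2 in H5. apply Rabs_def1; lra.
Qed.

(* Increments of [K] over long intervals compute the Fourier transform, without integrals over
   the whole line. *)
Lemma gauss_phase_antiderivative (kappa a : R) (k : nat) :
  0 < kappa ->
  exists K : R -> R,
    (forall x, is_derive K x (gauss kappa x * cos (2 * PI * INR k * (x - a)))) /\
    (forall eps, 0 < eps -> exists M, forall u v, M < u -> M < v ->
       Rabs (K v - K (- u) - 2 * cos (2 * PI * INR k * a) * gauss_cos kappa (INR k)) < eps).
Proof.
  intros Hk. set (w := 2 * PI * INR k).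
  set (fc := fun s => gauss kappa s * cos (w * s)). set (fs := fun s => gauss kappa s * sin (w * s)).
  set (Cc := RInt fc 0 : R -> R). set (Ss := RInt fs 0 : R -> R).
  assert (Hfc : forall x, continuous fc x).
  { intro x. apply (ex_derive_continuous (V := R_NormedModule)). unfold fc, gauss. auto_derive; auto. }
  assert (Hfs : forall x, continuous fs x).
  { intro x. apply (ex_derive_continuous (V := R_NormedModule)). unfold fs, gauss. auto_derive; auto. }
  assert (HD : forall f : R -> R, (forall x, continuous f x) -> forall x, is_derive (RInt f 0 : R -> R) x (f x)).
  { intros f Hf x. apply (is_derive_RInt f (RInt f 0) 0); auto.
    exists (mkposreal 1 Rlt_0_1). intros y _. apply (RInt_correct (V := R_CompleteNormedModule)).
    apply (ex_RInt_continuous (V := R_CompleteNormedModule)). auto. }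
  pose proof (HD fc Hfc) as HC. pose proof (HD fs Hfs) as HS. fold Cc in HC. fold Ss in HS.
  assert (Hneg : forall (F f : R -> R) (x : R), is_derive F (- x) (f (- x)) -> is_derive (fun x => F (- x)) x (- f (- x))).
  { intros F f x H.
    pose proof (is_derive_comp F (fun x => - x) x (f (- x)) (-1) H) as HH.
    replace (- f (- x)) with (scal (-1) (f (- x))) by (unfold scal; simpl; unfold mult; simpl; ring).
    apply HH. auto_derive; auto. }
  (* The cosine part [Cc] is odd and the sine part [Ss] is even, so in K(v) - K(-u) the cosine parts
     add up to twice the half-line integral while the sine parts cancel in the limit. *)
  assert (Codd : forall x, 0 < x -> Cc (- x) = - Cc x).
  { intros x Hx. assert (E : Cc 0 + Cc (- 0) = Cc x + Cc (- x)).
    { apply (eq_is_derive (fun x => Cc x + Cc (- x))); [|lra]. intros t _.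
      replace (@zero R_NormedModule) with (plus (fc t) (- fc (- t))).
      - apply (is_derive_plus (V := R_NormedModule) Cc (fun x => Cc (- x))); auto.
      - unfold plus, zero, fc, gauss; simpl. replace (w * - t) with (- (w * t)) by ring.
        rewrite cos_neg. replace (- t * (- t * 1)) with (t * (t * 1)) by ring. ring. }
    rewrite Ropp_0 in E. unfold Cc at 1 2 in E. rewrite RInt_point in E. unfold zero in E; simpl in E. lra. }
  assert (Seven : forall x, 0 < x -> Ss (- x) = Ss x).
  { intros x Hx. assert (E : Ss 0 - Ss (- 0) = Ss x - Ss (- x)).
    { apply (eq_is_derive (fun x => Ss x - Ss (- x))); [|lra]. intros t _.
      replace (@zero R_NormedModule) with (minus (fs t) (- fs (- t))).
      - apply (is_derive_minus (V := R_NormedModule) Ss (fun x => Ss (- x))); auto.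
      - unfold minus, plus, opp, zero, fs, gauss; simpl. replace (w * - t) with (- (w * t)) by ring.
        rewrite sin_neg. replace (- t * (- t * 1)) with (t * (t * 1)) by ring. ring. }
    rewrite Ropp_0 in E. unfold Ss at 1 2 in E. rewrite RInt_point in E. unfold zero in E; simpl in E. lra. }
  assert (IC : is_int fc (gauss_cos kappa (INR k))) by (apply is_int_gauss_cos; auto).
  destruct (ex_int_gauss kappa (fun t => sin (w * t)) Hk) as [sv IS].
  { intros x Hx. apply (ex_derive_continuous (V := R_NormedModule)). auto_derive; auto. }
  { intros t Ht. pose proof (SIN_bound (w * t)). apply Rabs_le. nra. }
  fold fs in IS.
  exists (fun x => cos (w * a) * Cc x + sin (w * a) * Ss x). split.
  - intro x. replace (gauss kappa x * cos (w * (x - a)))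
      with (plus (cos (w * a) * fc x) (sin (w * a) * fs x)).
    + apply (is_derive_plus (V := R_NormedModule));
      apply is_derive_scal; auto.
    + unfold plus; simpl. unfold fc, fs.
      replace (w * (x - a)) with (w * x - w * a) by ring. rewrite cos_minus. ring.
  - intros eps He.
    destruct (is_int_lim_from_0 fc _ (eps / 4) Hfc IC) as [M1 H1]; [lra|].
    destruct (is_int_lim_from_0 fs _ (eps / 4) Hfs IS) as [M2 H2]; [lra|].
    exists (Rmax 0 (Rmax M1 M2)). intros u v Hu Hv.
    pose proof (Rmax_l 0 (Rmax M1 M2)). pose proof (Rmax_r 0 (Rmax M1 M2)).
    pose proof (Rmax_l M1 M2). pose proof (Rmax_r M1 M2).
    rewrite Codd, Seven by lra.
    assert (A1 := H1 u ltac:(lra)). assert (A2 := H1 v ltac:(lra)).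
    assert (A3 := H2 u ltac:(lra)). assert (A4 := H2 v ltac:(lra)).
    fold Cc in A1, A2. fold Ss in A3, A4.
    match goal with |- Rabs ?X < _ => replace X with
      (cos (w * a) * (Cc v - gauss_cos kappa (INR k)) + cos (w * a) * (Cc u - gauss_cos kappa (INR k))
       + (sin (w * a) * (Ss v - sv) - sin (w * a) * (Ss u - sv))) by ring end.
    assert (Hb : forall p x, Rabs p <= 1 -> Rabs x < eps / 4 -> Rabs (p * x) < eps / 4).
    { intros p x Hp Hx. rewrite Rabs_mult. pose proof (Rabs_pos x). pose proof (Rabs_pos p). nra. }
    assert (Hcb : Rabs (cos (w * a)) <= 1) by (pose proof (COS_bound (w * a)); apply Rabs_le; lra).
    assert (Hsb : Rabs (sin (w * a)) <= 1) by (pose proof (SIN_bound (w * a)); apply Rabs_le; lra).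
    pose proof (Hb _ _ Hcb A1) as B1. pose proof (Hb _ _ Hcb A2) as B2.
    pose proof (Hb _ _ Hsb A3) as B3. pose proof (Hb _ _ Hsb A4) as B4.
    apply Rabs_def2 in B1. apply Rabs_def2 in B2. apply Rabs_def2 in B3. apply Rabs_def2 in B4.
    apply Rabs_def1; lra.
Qed.

(** * Poisson summation *)

Lemma exp_pow (x : R) (n : nat) : exp x ^ n = exp (INR n * x).
Proof. rewrite <- Rpower_pow by apply exp_pos. unfold Rpower. now rewrite ln_exp. Qed.

Lemma exp_le (x y : R) : x <= y -> exp x <= exp y.
Proof. intros [H| ->]; [left; now apply exp_increasing|lra]. Qed.

Lemma ex_series_exp_neg (c K : R) : 0 < c -> ex_series (fun n => K * exp (- c) ^ n).
Proof.
  intros Hc. apply ex_series_Rscal. apply ex_series_geom.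
  pose proof (exp_pos (- c)). rewrite Rabs_pos_eq by lra.
  rewrite <- exp_0. apply exp_increasing. lra.
Qed.

(** One geometric majorant for the translates by m and by -m-1, uniform in |a| <= A: expanding (m +
    2a)^2 >= 0 gives (m + a)^2 >= m^2/2 - a^2, and m <= m^2. *)
Lemma gauss_shift_bound (kappa A a : R) (m : nat) :
  0 < kappa -> Rabs a <= A ->
  gauss kappa (INR m + a) <= exp (kappa * A ^ 2) * exp (- (kappa / 2)) ^ m /\
  gauss kappa (a - INR m - 1) <= exp (kappa * A ^ 2) * exp (- (kappa / 2)) ^ m.
Proof.
  intros Hk Ha. rewrite exp_pow, <- exp_plus. unfold gauss.
  assert (H1 : a ^ 2 <= A ^ 2).
  { rewrite <- (pow2_abs a). apply pow_incr. split; [apply Rabs_pos|auto]. }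
  assert (H2 : INR m <= INR m ^ 2).
  { destruct m as [|m]; [simpl; lra|]. rewrite S_INR. pose proof (pos_INR m). nra. }
  pose proof (pos_INR m).
  split; apply exp_le.
  - assert (INR m / 2 - A ^ 2 <= (INR m + a) ^ 2) by (pose proof (pow2_ge_0 (INR m + 2 * a)); nra).
    nra.
  - assert (INR m / 2 - A ^ 2 <= (a - INR m - 1) ^ 2)
      by (pose proof (pow2_ge_0 (INR m + 1 - 2 * a)); nra).
    nra.
Qed.

Lemma gauss_INR_bound (kappa : R) (n : nat) :
  0 < kappa -> gauss kappa (INR n) <= 1 * exp (- (kappa / 2)) ^ n.
Proof.
  intros Hk. assert (H : Rabs 0 <= 0) by (rewrite Rabs_R0; lra).
  pose proof (proj1 (gauss_shift_bound kappa 0 0 n Hk H)) as B.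
  replace (kappa * 0 ^ 2) with 0 in B by ring. rewrite exp_0 in B.
  replace (INR n + 0) with (INR n) in B by ring. lra.
Qed.

Lemma cos_Z_period (z : Z) (x : R) : cos (2 * PI * IZR z + x) = cos x.
Proof.
  destruct (Z_le_gt_dec 0 z) as [Hz|Hz].
  - rewrite <- (cos_period x (Z.to_nat z)). f_equal. rewrite INR_IZR_INZ, Z2Nat.id by lia. ring.
  - rewrite <- (cos_period (2 * PI * IZR z + x) (Z.to_nat (- z))). f_equal.
    rewrite INR_IZR_INZ, Z2Nat.id by lia. rewrite opp_IZR. ring.
Qed.

Lemma is_series_single (a : nat -> R) (k : nat) :
  (forall n, n <> k -> a n = 0) -> is_series a (a k).
Proof.
  intros H.
  assert (H1 : forall n, (n < k)%nat -> sum_n a n = 0).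
  { induction n as [|n IH]; intro Hn.
    - rewrite sum_O. apply H. lia.
    - rewrite sum_Sn, IH by lia. rewrite H by lia. unfold plus; simpl. ring. }
  assert (H2 : forall n, sum_n a (k + n) = a k).
  { induction n as [|n IH].
    - rewrite Nat.add_0_r. destruct k as [|k]; [now rewrite sum_O|].
      rewrite sum_Sn, H1 by lia. unfold plus; simpl. ring.
    - rewrite Nat.add_succ_r, sum_Sn, IH. rewrite (H (S (k + n))) by lia. unfold plus; simpl. ring. }
  apply (proj2 (is_lim_seq_incr_n (sum_n a) k (Finite (a k)))). apply (is_lim_seq_ext (fun _ => a k)).
  - intro n. now rewrite Nat.add_comm, H2.
  - apply is_lim_seq_const.
Qed.

Lemma is_RInt_cos_half (z : Z) :
  is_RInt (fun t => cos (2 * PI * IZR z * t)) 0 (1 / 2) (if Z.eq_dec z 0 then 1 / 2 else 0).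
Proof.
  destruct (Z.eq_dec z 0) as [->|Hz].
  - replace (1 / 2) with (1 / 2 * 1 - 0 * 1) at 2 by ring.
    apply (is_RInt_derive (fun t => t * 1)).
    + intros x _. auto_derive; auto. rewrite Rmult_0_r, Rmult_0_l, cos_0. ring.
    + intros x _. apply (ex_derive_continuous (V := R_NormedModule)). auto_derive; auto.
  - assert (Hz' : IZR z <> 0) by now apply not_0_IZR. pose proof PI_neq0 as Hpi.
    pose (F := fun t => / (2 * PI * IZR z) * sin (2 * PI * IZR z * t)).
    replace 0 with (F (1 / 2) - F 0) at 2.
    + apply (is_RInt_derive F).
      * intros x _. unfold F. auto_derive; auto. field. split; auto.
      * intros x _. apply (ex_derive_continuous (V := R_NormedModule)). auto_derive; auto.
    + unfold F. rewrite Rmult_0_r, sin_0.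
      replace (2 * PI * IZR z * (1 / 2)) with (IZR z * PI) by field.
      rewrite (sin_eq_0_1 (IZR z * PI)); [ring|now exists z].
Qed.

(** The weight of n when a sum over all integers, even in n, is folded onto n >= 0. *)
Definition cos_weight (n : nat) : R := match n with O => 1 | _ => 2 end.

Lemma is_RInt_cos_cos_half (n k : nat) :
  is_RInt (fun t => cos_weight n * (2 * (cos (2 * PI * INR n * t) * cos (2 * PI * INR k * t)))) 0 (1 / 2)
    (if Nat.eq_dec n k then 1 else 0).
Proof.
  pose proof (is_RInt_Rscal _ (cos_weight n) _ _ _ (is_RInt_Rplus _ _ _ _ _ _
    (is_RInt_cos_half (Z.of_nat n - Z.of_nat k)) (is_RInt_cos_half (Z.of_nat n + Z.of_nat k)))) as H.
  match type of H with is_RInt _ _ _ ?v =>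
    assert (E : v = if Nat.eq_dec n k then 1 else 0); [|rewrite E in H] end.
  2:{ eapply is_RInt_ext; [|exact H]. intros x _. req.
    rewrite minus_IZR, plus_IZR, <- !INR_IZR_INZ.
    replace (2 * PI * (INR n - INR k) * x) with (2 * PI * INR n * x - 2 * PI * INR k * x) by ring.
    replace (2 * PI * (INR n + INR k) * x) with (2 * PI * INR n * x + 2 * PI * INR k * x) by ring.
    rewrite cos_plus, cos_minus. ring. }
  clear H. destruct (Nat.eq_dec n k) as [->|N].
  - destruct k as [|k]; unfold cos_weight;
      repeat match goal with |- context [Z.eq_dec ?u ?v] => destruct (Z.eq_dec u v) end; try lia; field.
  - repeat match goal with |- context [Z.eq_dec ?u ?v] => destruct (Z.eq_dec u v) end; try lia; field.
Qed.

(** Pairing the integers m and -m-1 turns the sum over all translates of the Gaussian into a series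
    indexed by [nat]. *)
Definition gauss_pair (kappa : R) (m : nat) (a : R) : R :=
  gauss kappa (INR m + a) + gauss kappa (a - INR m - 1).

Definition dual_term (rho : R) (n : nat) (a : R) : R :=
  cos_weight n * gauss rho (INR n) * cos (2 * PI * INR n * a).

Lemma gauss_pair_bound (kappa A a : R) (m : nat) :
  0 < kappa -> Rabs a <= A ->
  Rabs (gauss_pair kappa m a) <= 2 * exp (kappa * A ^ 2) * exp (- (kappa / 2)) ^ m.
Proof.
  intros Hk Ha. destruct (gauss_shift_bound kappa A a m Hk Ha) as [H1 H2].
  unfold gauss_pair. pose proof (gauss_pos kappa (INR m + a)).
  pose proof (gauss_pos kappa (a - INR m - 1)). rewrite Rabs_pos_eq; lra.
Qed.

Lemma cos_weight_bound (n : nat) : 0 <= cos_weight n <= 2.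
Proof. destruct n; simpl; lra. Qed.

Lemma dual_term_bound (rho a : R) (n : nat) :
  0 < rho -> Rabs (dual_term rho n a) <= 2 * exp (- (rho / 2)) ^ n.
Proof.
  intros Hr. unfold dual_term. rewrite !Rabs_mult.
  pose proof (cos_weight_bound n). pose proof (gauss_pos rho (INR n)).
  pose proof (gauss_INR_bound rho n Hr).
  rewrite (Rabs_pos_eq (cos_weight n)), (Rabs_pos_eq (gauss rho _)) by lra.
  assert (Rabs (cos (2 * PI * INR n * a)) <= 1) by
    (pose proof (COS_bound (2 * PI * INR n * a)); apply Rabs_le; lra).
  pose proof (Rabs_pos (cos (2 * PI * INR n * a))). 
  apply Rle_trans with (2 * gauss rho (INR n) * 1); [|lra].
  apply Rmult_le_compat; try nra.
Qed.

Lemma continuous_gauss_pair (kappa : R) (m : nat) (a : R) : continuous (gauss_pair kappa m) a.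
Proof.
  apply (ex_derive_continuous (V := R_NormedModule)). unfold gauss_pair, gauss. auto_derive; auto.
Qed.

Lemma continuous_dual_term (rho : R) (n : nat) (a : R) : continuous (dual_term rho n) a.
Proof.
  apply (ex_derive_continuous (V := R_NormedModule)). unfold dual_term. auto_derive; auto.
Qed.

Lemma ex_series_gauss_pair (kappa a : R) : 0 < kappa -> ex_series (fun m => gauss_pair kappa m a).
Proof.
  intros Hk. eapply ex_series_dominated.
  - intro n. apply (gauss_pair_bound kappa (Rabs a) a n Hk (Rle_refl _)).
  - apply ex_series_exp_neg. lra.
Qed.

Lemma ex_series_dual_term (rho a : R) : 0 < rho -> ex_series (fun n => dual_term rho n a).
Proof.
  intros Hk. eapply ex_series_dominated.
  - intro n. now apply dual_term_bound.
  - apply ex_series_exp_neg. lra.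
Qed.

Lemma continuous_gauss_pair_Series (kappa a : R) :
  0 < kappa -> continuous (fun a => Series (fun m => gauss_pair kappa m a)) a.
Proof.
  intros Hk. apply (continuous_Series (gauss_pair kappa)
    (fun n => 2 * exp (kappa * (Rabs a + 1) ^ 2) * exp (- (kappa / 2)) ^ n) a 1).
  - lra.
  - apply ex_series_exp_neg. lra.
  - intros n y Hy. apply gauss_pair_bound; auto.
    pose proof (Rabs_triang_inv y a). lra.
  - intro n. apply continuous_gauss_pair.
Qed.

Lemma continuous_dual_Series (rho a : R) :
  0 < rho -> continuous (fun a => Series (fun n => dual_term rho n a)) a.
Proof.
  intros Hk. apply (continuous_Series (dual_term rho) (fun n => 2 * exp (- (rho / 2)) ^ n) a 1).
  - lra.
  - apply ex_series_exp_neg. lra.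
  - intros n y Hy. now apply dual_term_bound.
  - intro n. apply continuous_dual_term.
Qed.

(** Symmetrising about a makes the function of t even, so that cosines over half a period suffice,
    and its value at t = 0 is twice the value at a. Both sides of Poisson summation are integrated
    termwise through this lemma. *)
Lemma is_RInt_symmetric_Series (F : nat -> R -> R) (a : R) (M : nat -> R) (c : R -> R)
    (J : nat -> R) (l : R) :
  ex_series M -> (forall n t, Rabs (t - a) <= 1 -> Rabs (F n t) <= M n) ->
  (forall n t, continuous (F n) t) ->
  (forall t, continuous (fun t => Series (fun n => F n t)) t) ->
  (forall t, Rabs (c t) <= 1) -> (forall t, continuous c t) ->
  (forall n, is_RInt (fun t => (F n (a + t) + F n (a - t)) * c t) 0 (1 / 2) (J n)) ->
  is_series J l ->
  is_RInt (fun t => (Series (fun n => F n (a + t)) + Series (fun n => F n (a - t))) * c t) 0 (1 / 2) l.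
Proof.
  intros HM Hb HF HS Hc1 Hc HJ Hl.
  set (f := fun n t => (F n (a + t) + F n (a - t)) * c t).
  assert (Hcp : forall (G : R -> R) t, (forall x, continuous G x) -> continuous (fun t => (G (a + t) + G (a - t))) t).
  { intros G t HG. apply (continuous_plus (V := R_NormedModule) (fun t => G (a + t)) (fun t => G (a - t)));
      [apply (continuous_comp (fun t => a + t) G)|apply (continuous_comp (fun t => a - t) G)]; auto;
      apply (ex_derive_continuous (V := R_NormedModule)); auto_derive; auto. }
  assert (Hcf : forall n t, continuous (f n) t).
  { intros n t. apply (continuous_mult (K := R_AbsRing) (fun t => F n (a + t) + F n (a - t)) c); auto. }
  assert (E : forall t, 0 <= t <= 1 / 2 -> Series (fun n => f n t) =
     (Series (fun n => F n (a + t)) + Series (fun n => F n (a - t))) * c t).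
  { intros t Ht. unfold f. rewrite Series_scal_r, Series_plus; auto.
    - apply (ex_series_dominated _ M); auto. intro n. apply Hb.
      replace (a + t - a) with t by ring. rewrite Rabs_pos_eq; lra.
    - apply (ex_series_dominated _ M); auto. intro n. apply Hb.
      replace (a - t - a) with (- t) by ring. rewrite Rabs_Ropp, Rabs_pos_eq; lra. }
  assert (Hcs : ex_RInt (fun t => (Series (fun n => F n (a + t)) + Series (fun n => F n (a - t))) * c t) 0 (1 / 2)).
  { apply (ex_RInt_continuous (V := R_CompleteNormedModule)). intros t _.
    apply (continuous_mult (K := R_AbsRing)
      (fun t => Series (fun n => F n (a + t)) + Series (fun n => F n (a - t))) c); auto.
    apply (Hcp (fun t => Series (fun n => F n t)) t HS). }
  assert (Hex : ex_RInt (fun t => Series (fun n => f n t)) 0 (1 / 2)).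
  { eapply ex_RInt_ext; [|exact Hcs]. intros t Ht.
    rewrite Rmin_left, Rmax_right in Ht by lra. symmetry. apply E. lra. }
  assert (Hser : is_series (fun n => RInt (f n) 0 (1 / 2)) (RInt (fun t => Series (fun n => f n t)) 0 (1 / 2))).
  { apply (is_series_RInt_le f (fun n => 2 * M n)); auto; try lra.
    - now apply ex_series_Rscal.
    - intros n t Ht. unfold f. rewrite Rabs_mult.
      assert (B1 : Rabs (F n (a + t)) <= M n).
      { apply Hb. replace (a + t - a) with t by ring. rewrite Rabs_pos_eq; lra. }
      assert (B2 : Rabs (F n (a - t)) <= M n).
      { apply Hb. replace (a - t - a) with (- t) by ring. rewrite Rabs_Ropp, Rabs_pos_eq; lra. }
      pose proof (Rabs_triang (F n (a + t)) (F n (a - t))).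
      pose proof (Rabs_pos (F n (a + t) + F n (a - t))). specialize (Hc1 t).
      apply Rle_trans with (Rabs (F n (a + t) + F n (a - t)) * 1); [|lra].
      apply Rmult_le_compat_l; auto.
    - intro n. apply (ex_RInt_continuous (V := R_CompleteNormedModule)). auto. }
  assert (Hser' : is_series J (RInt (fun t => Series (fun n => f n t)) 0 (1 / 2))).
  { eapply is_series_ext; [|exact Hser]. intro n. apply is_RInt_unique, HJ. }
  rewrite <- (is_series_unique _ _ Hl), (is_series_unique _ _ Hser').
  apply (is_RInt_ext (fun t => Series (fun n => f n t))).
  - intros t Ht. rewrite Rmin_left, Rmax_right in Ht by lra. apply E. lra.
  - now apply (RInt_correct (V := R_CompleteNormedModule)).
Qed.

(** Unfolding: by periodicity of the cosine, the translate by z contributes an increment of [K] over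
    the unit interval centred at z + a, and these increments telescope to an increment over a long
    interval. *)
Lemma gauss_pair_fourier (kappa a : R) (k : nat) :
  0 < kappa ->
  is_RInt (fun t => (Series (fun m => gauss_pair kappa m (a + t)) +
                     Series (fun m => gauss_pair kappa m (a - t))) * cos (2 * PI * INR k * t))
    0 (1 / 2) (2 * cos (2 * PI * INR k * a) * gauss_cos kappa (INR k)).
Proof.
  intros Hk. destruct (gauss_phase_antiderivative kappa a k Hk) as [K [HK HKlim]].
  assert (Hz : forall z : Z, is_RInt (fun t =>
     (gauss kappa (IZR z + a + t) + gauss kappa (IZR z + a - t)) * cos (2 * PI * INR k * t)) 0 (1 / 2)
     (K (IZR z + a + 1 / 2) - K (IZR z + a - 1 / 2))).
  { intro z. pose (F := fun t => K (IZR z + a + t) - K (IZR z + a - t)).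
    replace (K (IZR z + a + 1 / 2) - K (IZR z + a - 1 / 2)) with (F (1 / 2) - F 0).
    2:{ unfold F. replace (IZR z + a + 0) with (IZR z + a - 0) by ring. ring. }
    apply (is_RInt_derive F).
    - intros x _. unfold F.
      replace ((gauss kappa (IZR z + a + x) + gauss kappa (IZR z + a - x)) * cos (2 * PI * INR k * x))
        with (minus (1 * (gauss kappa (IZR z + a + x) * cos (2 * PI * INR k * (IZR z + a + x - a))))
                    (-1 * (gauss kappa (IZR z + a - x) * cos (2 * PI * INR k * (IZR z + a - x - a))))).
      + apply (is_derive_minus (V := R_NormedModule) (fun t => K (IZR z + a + t)) (fun t => K (IZR z + a - t))).
        * apply (is_derive_comp K (fun t => IZR z + a + t)); [apply HK|]. auto_derive; auto.
        * apply (is_derive_comp K (fun t => IZR z + a - t)); [apply HK|]. auto_derive; auto; ring.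
      + unfold minus, plus, opp; simpl.
        replace (2 * PI * INR k * (IZR z + a + x - a))
          with (2 * PI * IZR (Z.of_nat k * z) + 2 * PI * INR k * x)
          by (rewrite mult_IZR, <- INR_IZR_INZ; ring).
        replace (2 * PI * INR k * (IZR z + a - x - a))
          with (2 * PI * IZR (Z.of_nat k * z) + - (2 * PI * INR k * x))
          by (rewrite mult_IZR, <- INR_IZR_INZ; ring).
        rewrite !cos_Z_period, cos_neg. ring.
    - intros x _. apply (ex_derive_continuous (V := R_NormedModule)). unfold gauss. auto_derive; auto. }
  set (f := fun m t => (gauss_pair kappa m (a + t) + gauss_pair kappa m (a - t)) * cos (2 * PI * INR k * t)).
  set (J := fun m => (K (INR m + a + 1 / 2) - K (INR m + a - 1 / 2)) +
                     (K (a - INR m - 1 / 2) - K (a - INR m - 3 / 2))).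
  assert (HJ : forall m, is_RInt (f m) 0 (1 / 2) (J m)).
  { intro m. pose proof (is_RInt_Rplus _ _ _ _ _ _ (Hz (Z.of_nat m)) (Hz (- Z.of_nat m - 1)%Z)) as H.
    rewrite minus_IZR, opp_IZR, <- INR_IZR_INZ in H. unfold J.
    replace (a - INR m - 1 / 2) with (- INR m - 1 + a + 1 / 2) by field.
    replace (a - INR m - 3 / 2) with (- INR m - 1 + a - 1 / 2) by field.
    eapply is_RInt_ext; [|exact H]. intros t _. req. unfold f, gauss_pair.
    replace (INR m + (a + t)) with (INR m + a + t) by ring.
    replace (INR m + (a - t)) with (INR m + a - t) by ring.
    replace (a + t - INR m - 1) with (- INR m - 1 + a + t) by ring.
    replace (a - t - INR m - 1) with (- INR m - 1 + a - t) by ring. ring. }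
  (* Each [J m] extends the interval covered by one unit at either end. *)
  assert (HsumJ : forall N, sum_n J N = K (a + INR N + 1 / 2) - K (- (INR N + 3 / 2 - a))).
  { induction N as [|N IH].
    - rewrite sum_O. unfold J. simpl INR. 
      replace (0 + a + 1 / 2) with (a + 0 + 1 / 2) by ring.
      replace (a - 0 - 1 / 2) with (0 + a - 1 / 2) by ring.
      replace (- (0 + 3 / 2 - a)) with (a - 0 - 3 / 2) by ring. req. ring.
    - rewrite sum_Sn_R, IH. unfold J. rewrite S_INR.
      replace (INR N + 1 + a + 1 / 2) with (a + (INR N + 1) + 1 / 2) by ring.
      replace (INR N + 1 + a - 1 / 2) with (a + INR N + 1 / 2) by field.
      replace (a - (INR N + 1) - 1 / 2) with (- (INR N + 3 / 2 - a)) by field.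
      replace (a - (INR N + 1) - 3 / 2) with (- (INR N + 1 + 3 / 2 - a)) by ring.
      req. ring. }
  assert (HserJ : is_series J (2 * cos (2 * PI * INR k * a) * gauss_cos kappa (INR k))).
  { apply (proj1 (is_lim_seq_spec (sum_n J) (Finite (2 * cos (2 * PI * INR k * a) * gauss_cos kappa (INR k))))).
    intros [eps He]. simpl. destruct (HKlim eps He) as [M HM].
    destruct (nfloor_ex (Rabs M + Rabs a)) as [N [_ HN]].
    { pose proof (Rabs_pos M). pose proof (Rabs_pos a). lra. }
    exists (S N). intros n Hn. rewrite HsumJ.
    apply le_INR in Hn. rewrite S_INR in Hn.
    pose proof (Rle_abs M). pose proof (Rle_abs a). pose proof (Rle_abs (- a)).
    rewrite Rabs_Ropp in H1. pose proof (Rabs_pos a). pose proof (Rabs_pos M).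
    apply HM; lra. }
  apply (is_RInt_symmetric_Series (gauss_pair kappa) a
    (fun n => 2 * exp (kappa * (Rabs a + 1) ^ 2) * exp (- (kappa / 2)) ^ n) _ J); auto.
  - apply ex_series_exp_neg. lra.
  - intros n t Ht. apply gauss_pair_bound; auto. pose proof (Rabs_triang_inv t a). lra.
  - intros; apply continuous_gauss_pair.
  - intros; now apply continuous_gauss_pair_Series.
  - intro t. apply Rabs_le. pose proof (COS_bound (2 * PI * INR k * t)). lra.
  - intro t. apply (ex_derive_continuous (V := R_NormedModule)). auto_derive; auto.
Qed.

Lemma dual_fourier (rho a : R) (k : nat) :
  0 < rho ->
  is_RInt (fun t => (Series (fun n => dual_term rho n (a + t)) +
                     Series (fun n => dual_term rho n (a - t))) * cos (2 * PI * INR k * t))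
    0 (1 / 2) (gauss rho (INR k) * cos (2 * PI * INR k * a)).
Proof.
  intros Hr.
  set (J := fun n => gauss rho (INR n) * cos (2 * PI * INR n * a) * (if Nat.eq_dec n k then 1 else 0)).
  apply (is_RInt_symmetric_Series (dual_term rho) a (fun n => 2 * exp (- (rho / 2)) ^ n) _ J).
  - apply ex_series_exp_neg. lra.
  - intros. now apply dual_term_bound.
  - intros; apply continuous_dual_term.
  - intros; now apply continuous_dual_Series.
  - intro t. apply Rabs_le. pose proof (COS_bound (2 * PI * INR k * t)). lra.
  - intro t. apply (ex_derive_continuous (V := R_NormedModule)). auto_derive; auto.
  - intro n. pose proof (is_RInt_Rscal _ (gauss rho (INR n) * cos (2 * PI * INR n * a)) _ _ _
      (is_RInt_cos_cos_half n k)) as H.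
    eapply is_RInt_ext; [|exact H]. intros t _. req. unfold dual_term.
    replace (2 * PI * INR n * (a + t)) with (2 * PI * INR n * a + 2 * PI * INR n * t) by ring.
    replace (2 * PI * INR n * (a - t)) with (2 * PI * INR n * a - 2 * PI * INR n * t) by ring.
    rewrite cos_plus, cos_minus. ring.
  - replace (gauss rho (INR k) * cos (2 * PI * INR k * a)) with (J k).
    + apply is_series_single. intros n Hn. unfold J. destruct (Nat.eq_dec n k); [lia|ring].
    + unfold J. destruct (Nat.eq_dec k k); [ring|lia].
Qed.

(** After symmetrisation about a both sides have the same cosine coefficients, which is
    [gauss_cos_eq] at integers. Uniqueness at t = 0 then gives the identity at a. *)
Lemma poisson_gauss (kappa a : R) :
  0 < kappa ->
  Series (fun m => gauss_pair kappa m a) =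
  2 * gauss_cos kappa 0 * Series (fun n => dual_term (PI ^ 2 / kappa) n a).
Proof.
  intros Hk. pose proof PI_RGT_0 as Hpi.
  assert (Hr : 0 < PI ^ 2 / kappa) by (apply Rdiv_lt_0_compat; auto; now apply pow_lt).
  set (P := fun a => Series (fun m => gauss_pair kappa m a)).
  set (F := fun a => Series (fun n => dual_term (PI ^ 2 / kappa) n a)).
  set (b := 2 * gauss_cos kappa 0).
  set (Psi := fun t => P (a + t) + P (a - t) - b * (F (a + t) + F (a - t))).
  assert (HP : forall t, continuous P t) by (intro; now apply continuous_gauss_pair_Series).
  assert (HF : forall t, continuous F t) by (intro; now apply continuous_dual_Series).
  assert (E : Psi 0 = 0).
  { apply fourier_uniqueness.
    - intro t.
      assert (C1 : continuous (fun t => a + t) t)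
        by (apply (ex_derive_continuous (V := R_NormedModule)); auto_derive; auto).
      assert (C2 : continuous (fun t => a - t) t)
        by (apply (ex_derive_continuous (V := R_NormedModule)); auto_derive; auto).
      apply (continuous_minus (V := R_NormedModule) (fun t => P (a + t) + P (a - t))
               (fun t => b * (F (a + t) + F (a - t)))).
      + apply (continuous_plus (V := R_NormedModule) (fun t => P (a + t)) (fun t => P (a - t)));
          [apply (continuous_comp (fun t => a + t) P)|apply (continuous_comp (fun t => a - t) P)]; auto.
      + apply (continuous_scal_r (V := R_NormedModule) b (fun t => F (a + t) + F (a - t))).
        apply (continuous_plus (V := R_NormedModule) (fun t => F (a + t)) (fun t => F (a - t)));
          [apply (continuous_comp (fun t => a + t) F)|apply (continuous_comp (fun t => a - t) F)]; auto.
    - intro k.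
      pose proof (is_RInt_Rminus _ _ _ _ _ _ (gauss_pair_fourier kappa a k Hk)
        (is_RInt_Rscal _ b _ _ _ (dual_fourier (PI ^ 2 / kappa) a k Hr))) as H.
      match type of H with is_RInt _ _ _ ?v => replace v with 0 in H end.
      + eapply is_RInt_ext; [|exact H]. intros t _. req. unfold Psi, P, F. ring.
      + rewrite (gauss_cos_eq kappa (INR k)) by (auto; apply pos_INR). unfold b, gauss.
        replace (PI ^ 2 / kappa * INR k ^ 2) with (PI ^ 2 * INR k ^ 2 / kappa) by (field; lra).
        ring. }
  unfold Psi in E. rewrite Rplus_0_r, Rminus_0_r in E. fold (P a). fold (F a). fold b. lra.
Qed.

(** * Poisson summation with a linear factor, for odd characters *)

Lemma id_gauss_le (kappa x : R) :
  0 < kappa -> Rabs x * gauss kappa x <= (1 + 2 / kappa) * gauss (kappa / 2) x.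
Proof.
  intros Hk. assert (E : gauss kappa x = gauss (kappa / 2) x * gauss (kappa / 2) x).
  { unfold gauss. rewrite <- exp_plus. f_equal. field. }
  rewrite E, <- Rmult_assoc. apply Rmult_le_compat_r; [left; apply gauss_pos|].
  assert (E2 : gauss (kappa / 2) x * exp (kappa / 2 * x ^ 2) = 1).
  { unfold gauss. rewrite <- exp_plus, Rplus_opp_l. apply exp_0. }
  pose proof (exp_ineq1_le (kappa / 2 * x ^ 2)) as H1.
  pose proof (gauss_pos (kappa / 2) x) as G.
  assert (H2 : Rabs x <= (1 + 2 / kappa) * (1 + kappa / 2 * x ^ 2)).
  { replace ((1 + 2 / kappa) * (1 + kappa / 2 * x ^ 2))
      with (1 + x ^ 2 + (2 / kappa + kappa / 2 * x ^ 2)) by (field; lra).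
    rewrite <- (pow2_abs x). pose proof (pow2_ge_0 (Rabs x)).
    assert (0 < 2 / kappa) by (apply Rdiv_lt_0_compat; lra).
    assert (0 <= kappa / 2 * Rabs x ^ 2) by (apply Rmult_le_pos; lra).
    pose proof (Rabs_pos x). nra. }
  assert (0 < 1 + 2 / kappa) by (assert (0 < 2 / kappa) by (apply Rdiv_lt_0_compat; lra); lra).
  apply Rle_trans with ((1 + 2 / kappa) * exp (kappa / 2 * x ^ 2) * gauss (kappa / 2) x).
  - apply Rmult_le_compat_r; [lra|]. eapply Rle_trans; [exact H2|]. apply Rmult_le_compat_l; lra.
  - rewrite Rmult_assoc, (Rmult_comm (exp _)), E2. lra.
Qed.

(** The derivative of [gauss_pair] in a, divided by -2 kappa; likewise [dual_term_odd] is that of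
    [dual_term] divided by -2 pi. *)
Definition gauss_pair_odd (kappa : R) (m : nat) (a : R) : R :=
  (INR m + a) * gauss kappa (INR m + a) + (a - INR m - 1) * gauss kappa (a - INR m - 1).

Definition dual_term_odd (rho : R) (n : nat) (a : R) : R :=
  cos_weight n * INR n * gauss rho (INR n) * sin (2 * PI * INR n * a).

Lemma gauss_pair_odd_bound (kappa A a : R) (m : nat) :
  0 < kappa -> Rabs a <= A ->
  Rabs (gauss_pair_odd kappa m a) <=
    (1 + 2 / kappa) * (2 * exp (kappa / 2 * A ^ 2)) * exp (- (kappa / 4)) ^ m.
Proof.
  intros Hk Ha. destruct (gauss_shift_bound (kappa / 2) A a m ltac:(lra) Ha) as [H1 H2].
  unfold gauss_pair_odd. eapply Rle_trans; [apply Rabs_triang|].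
  rewrite !Rabs_mult, !(Rabs_pos_eq (gauss _ _)) by (left; apply gauss_pos).
  pose proof (id_gauss_le kappa (INR m + a) Hk) as B1.
  pose proof (id_gauss_le kappa (a - INR m - 1) Hk) as B2.
  assert (0 < 2 / kappa) by (apply Rdiv_lt_0_compat; lra).
  replace (kappa / 2 / 2) with (kappa / 4) in * by field. nra.
Qed.

Lemma dual_term_odd_bound (rho a : R) (n : nat) :
  0 < rho -> Rabs (dual_term_odd rho n a) <= (2 * (1 + 2 / rho)) * exp (- (rho / 4)) ^ n.
Proof.
  intros Hr. unfold dual_term_odd.
  pose proof (cos_weight_bound n). pose proof (gauss_pos rho (INR n)).
  pose proof (id_gauss_le rho (INR n) Hr) as B.
  rewrite (Rabs_pos_eq (INR n)) in B by apply pos_INR. pose proof (pos_INR n).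
  pose proof (gauss_INR_bound (rho / 2) n ltac:(lra)) as B2.
  replace (rho / 2 / 2) with (rho / 4) in B2 by field.
  assert (0 < 2 / rho) by (apply Rdiv_lt_0_compat; lra).
  rewrite Rabs_mult. rewrite (Rabs_pos_eq (_ * gauss _ _)).
  2:{ repeat apply Rmult_le_pos; lra. }
  assert (Rabs (sin (2 * PI * INR n * a)) <= 1) by
    (pose proof (SIN_bound (2 * PI * INR n * a)); apply Rabs_le; lra).
  assert (0 <= INR n * gauss rho (INR n)) by (apply Rmult_le_pos; lra).
  apply Rle_trans with (cos_weight n * INR n * gauss rho (INR n) * 1).
  - apply Rmult_le_compat_l; auto. repeat apply Rmult_le_pos; lra.
  - rewrite Rmult_1_r, (Rmult_assoc (cos_weight n)).
    apply Rle_trans with (2 * (INR n * gauss rho (INR n))).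
    + apply Rmult_le_compat_r; lra.
    + rewrite (Rmult_assoc 2). apply Rmult_le_compat_l; [lra|]. nra.
Qed.

(** Differentiate [poisson_gauss] termwise in a and cancel -2 kappa. *)
Lemma poisson_gauss_odd (kappa a : R) :
  0 < kappa ->
  Series (fun m => gauss_pair_odd kappa m a) =
  2 * PI / kappa * gauss_cos kappa 0 * Series (fun n => dual_term_odd (PI ^ 2 / kappa) n a).
Proof.
  intros Hk. pose proof PI_RGT_0 as Hpi. set (rho := PI ^ 2 / kappa).
  assert (Hr : 0 < rho) by (apply Rdiv_lt_0_compat; auto; now apply pow_lt).
  assert (D1 : is_derive (fun a => Series (fun m => gauss_pair kappa m a)) a
                 (Series (fun m => - 2 * kappa * gauss_pair_odd kappa m a))).
  { apply (is_derive_Series (gauss_pair kappa) (fun m a => - 2 * kappa * gauss_pair_odd kappa m a)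
      (fun m => 2 * kappa * ((1 + 2 / kappa) * (2 * exp (kappa / 2 * (Rabs a + 1) ^ 2))) * exp (- (kappa / 4)) ^ m)
      a 1); try lra.
    - apply ex_series_exp_neg. lra.
    - intros n y _. unfold gauss_pair, gauss_pair_odd, gauss. auto_derive; auto.
      replace ((INR n + y) * ((INR n + y) * 1)) with ((INR n + y) ^ 2) by ring.
      replace ((y + - INR n + - (1)) * ((y + - INR n + - (1)) * 1)) with ((y - INR n - 1) ^ 2) by ring.
      ring.
    - intros n y _. apply (ex_derive_continuous (V := R_NormedModule)).
      unfold gauss_pair_odd, gauss. auto_derive; auto.
    - intros n y Hy.
      assert (Ha : Rabs y <= Rabs a + 1) by (pose proof (Rabs_triang_inv y a); lra).
      pose proof (gauss_pair_odd_bound kappa _ y n Hk Ha) as B.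
      rewrite Rabs_mult, Rabs_mult, (Rabs_pos_eq kappa), Rabs_left by lra. replace (- (-2)) with 2 by ring.
      rewrite !Rmult_assoc in *. apply Rmult_le_compat_l; [lra|]. apply Rmult_le_compat_l; lra.
    - intros y _. now apply ex_series_gauss_pair. }
  assert (D2 : is_derive (fun a => Series (fun n => dual_term rho n a)) a
                 (Series (fun n => - 2 * PI * dual_term_odd rho n a))).
  { apply (is_derive_Series (dual_term rho) (fun n a => - 2 * PI * dual_term_odd rho n a)
      (fun n => 2 * PI * (2 * (1 + 2 / rho)) * exp (- (rho / 4)) ^ n) a 1); try lra.
    - apply ex_series_exp_neg. lra.
    - intros n y _. unfold dual_term, dual_term_odd. auto_derive; auto. ring.
    - intros n y _. apply (ex_derive_continuous (V := R_NormedModule)).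
      unfold dual_term_odd. auto_derive; auto.
    - intros n y _. pose proof (dual_term_odd_bound rho y n Hr) as B.
      rewrite Rabs_mult, Rabs_mult, (Rabs_pos_eq PI), Rabs_left by lra. replace (- (-2)) with 2 by ring.
      rewrite !Rmult_assoc in *. apply Rmult_le_compat_l; [lra|]. apply Rmult_le_compat_l; lra.
    - intros y _. now apply ex_series_dual_term. }
  assert (D3 : is_derive (fun a => Series (fun m => gauss_pair kappa m a)) a
     (2 * gauss_cos kappa 0 * Series (fun n => - 2 * PI * dual_term_odd rho n a))).
  { apply (is_derive_ext (fun a => 2 * gauss_cos kappa 0 * Series (fun n => dual_term rho n a))).
    - intro t. symmetry. now apply poisson_gauss.
    - now apply is_derive_scal. }
  pose proof (is_derive_unique _ _ _ D1) as E1. rewrite (is_derive_unique _ _ _ D3) in E1.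
  rewrite !Series_scal_l in E1.
  apply (Rmult_eq_reg_l (- 2 * kappa)); [|lra]. rewrite <- E1. field. lra.
Qed.

(** * Real Dirichlet characters and Gauss sums *)

Fixpoint rsum (n : nat) (f : nat -> R) : R :=
  match n with O => 0 | S k => rsum k f + f k end.

Lemma rsum_sum_n (n : nat) (f : nat -> R) : rsum (S n) f = sum_n f n.
Proof.
  induction n as [|n IH]; [rewrite sum_O; simpl; ring|]. now rewrite sum_Sn_R, <- IH.
Qed.

Lemma rsum_ext (n : nat) (f g : nat -> R) :
  (forall k, (k < n)%nat -> f k = g k) -> rsum n f = rsum n g.
Proof.
  induction n as [|n IH]; intros H; auto. simpl. rewrite IH, H; auto.
Qed.

Lemma rsum_plus (n : nat) (f g : nat -> R) :
  rsum n (fun k => f k + g k) = rsum n f + rsum n g.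
Proof. induction n as [|n IH]; simpl; [ring|]. rewrite IH. ring. Qed.

Lemma rsum_scal (n : nat) (c : R) (f : nat -> R) :
  rsum n (fun k => c * f k) = c * rsum n f.
Proof. induction n as [|n IH]; simpl; [ring|]. rewrite IH. ring. Qed.

Lemma rsum_shift (n : nat) (f : nat -> R) : rsum (S n) f = f 0%nat + rsum n (fun k => f (S k)).
Proof. induction n as [|n IH]; [simpl; ring|]. simpl in *. rewrite IH. ring. Qed.

Lemma rsum_rev (n : nat) (f : nat -> R) : rsum n f = rsum n (fun k => f (n - 1 - k)%nat).
Proof.
  induction n as [|n IH]; auto. rewrite (rsum_shift n (fun k => f (S n - 1 - k)%nat)).
  simpl rsum at 1. replace (S n - 1 - 0)%nat with n by lia. rewrite IH.
  rewrite (rsum_ext n (fun k => f (S n - 1 - S k)%nat) (fun k => f (n - 1 - k)%nat)).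
  - ring.
  - intros k _. f_equal. lia.
Qed.

Lemma rsum_app (m n : nat) (f : nat -> R) :
  rsum (m + n) f = rsum m f + rsum n (fun k => f (m + k)%nat).
Proof.
  induction n as [|n IH]; [rewrite Nat.add_0_r; simpl; ring|].
  rewrite Nat.add_succ_r. simpl. rewrite IH. ring.
Qed.

Lemma rsum_blocks (q N : nat) (f : nat -> R) :
  rsum (q * N) f = rsum q (fun a => rsum N (fun m => f (q * m + a)%nat)).
Proof.
  induction N as [|N IH].
  - rewrite Nat.mul_0_r. simpl. induction q as [|q IHq]; simpl; auto. rewrite <- IHq. ring.
  - rewrite Nat.mul_succ_r, rsum_app, IH. simpl. now rewrite rsum_plus.
Qed.

Lemma rsum_fold (n : nat) (f : nat -> R) : rsum n f = fold_right Rplus 0 (map f (seq 0 n)).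
Proof.
  assert (H : forall k m f, fold_right Rplus 0 (map f (seq k m)) = rsum m (fun i => f (k + i)%nat)).
  { intros k m. revert k. induction m as [|m IH]; intros k g; auto.
    rewrite (rsum_shift m). simpl. rewrite IH, Nat.add_0_r. f_equal.
    apply rsum_ext. intros i _. f_equal. lia. }
  now rewrite H.
Qed.

Lemma fold_right_Rplus_Permutation (l l' : list R) :
  Permutation l l' -> fold_right Rplus 0 l = fold_right Rplus 0 l'.
Proof. induction 1; simpl; lra. Qed.

Lemma rsum_Series (n : nat) (f : nat -> nat -> R) :
  (forall k, (k < n)%nat -> ex_series (f k)) ->
  ex_series (fun m => rsum n (fun k => f k m)) /\
  Series (fun m => rsum n (fun k => f k m)) = rsum n (fun k => Series (f k)).
Proof.
  induction n as [|n IH]; intros H.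
  - simpl. split.
    + exists 0. apply (is_series_single (fun _ => 0) 0). auto.
    + apply is_series_unique. apply (is_series_single (fun _ => 0) 0). auto.
  - destruct IH as [H1 H2]; [intros; apply H; lia|]. simpl. split.
    + apply (ex_series_Rplus (fun m => rsum n (fun k => f k m)) (f n)); auto.
    + rewrite Series_plus; auto. now rewrite H2.
Qed.

Lemma rsum_ge_term (n k : nat) (f : nat -> R) :
  (forall k, 0 <= f k) -> (k < n)%nat -> f k <= rsum n f.
Proof.
  intros Hf. induction n as [|n IH]; intro Hk; [lia|]. simpl.
  assert (0 <= rsum n f) by (clear IH Hk; induction n as [|n IH]; simpl; [lra|]; specialize (Hf n); lra).
  destruct (Nat.eq_dec k n) as [->|Nk]; [lra|]. specialize (IH ltac:(lia)). specialize (Hf n). lra.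
Qed.

(** Partial sums whose length is a multiple of q split exactly into equally long partial sums over
    the residue classes; they form a subsequence of all partial sums. *)
Lemma Series_residues (q : nat) (g : nat -> R) :
  (0 < q)%nat -> ex_series (fun n => Rabs (g n)) ->
  (forall a, (a < q)%nat -> ex_series (fun m => g (q * m + a)%nat)) /\
  Series g = rsum q (fun a => Series (fun m => g (q * m + a)%nat)).
Proof.
  intros Hq Hg.
  assert (Hsub : forall a, (a < q)%nat -> ex_series (fun m => g (q * m + a)%nat)).
  { intros a Ha. apply (ex_series_dominated _ (fun m => Rabs (g (q * m + a)%nat))); [intro; lra|].
    apply (ex_series_bounded _ (Series (fun n => Rabs (g n)))).
    - intro; apply Rabs_pos.
    - intro N. rewrite <- rsum_sum_n.
      apply Rle_trans with (rsum (q * S N) (fun n => Rabs (g n))).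
      + rewrite rsum_blocks.
        apply (rsum_ge_term q a (fun a => rsum (S N) (fun m => Rabs (g (q * m + a)%nat)))); auto.
        intro k. rewrite rsum_sum_n. apply sum_n_ge_0. intro; apply Rabs_pos.
      + destruct (q * S N)%nat as [|k] eqn:E; [lia|]. rewrite rsum_sum_n.
        apply sum_n_le_Series; auto. intro; apply Rabs_pos. }
  split; auto.
  destruct (rsum_Series q (fun a m => g (q * m + a)%nat) Hsub) as [H1 H2].
  rewrite <- H2. symmetry. apply is_series_unique.
  assert (Hgs : is_series g (Series g)) by (apply Series_correct, ex_series_Rabs; auto).
  refine (is_lim_seq_ext (fun N => sum_n g (q * S N - 1)) _ (Finite (Series g)) _ _).
  - intro N. rewrite <- rsum_sum_n. replace (S (q * S N - 1)) with (q * S N)%nat by lia.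
    rewrite rsum_blocks. rewrite <- rsum_sum_n. clear.
    induction (S N) as [|n IH]; simpl.
    + induction q as [|q IH]; simpl; auto. rewrite IH. ring.
    + rewrite rsum_plus, IH. reflexivity.
  - apply (is_lim_seq_subseq (sum_n g) (Series g) (fun N => (q * S N - 1)%nat)); auto.
    apply eventually_subseq. intro n. nia.
Qed.

(** * Values of a real character *)

Lemma chi_1 (q : nat) (chi : Z -> R) : real_dirichlet_character q chi -> chi 1%Z = 1.
Proof.
  intros [Hm [_ Hz]]. assert (H : chi 1%Z <> 0).
  { apply Hz. apply Z.gcd_1_l. }
  pose proof (Hm 1%Z 1%Z) as E. change (1 * 1)%Z with 1%Z in E.
  apply (Rmult_eq_reg_l (chi 1%Z)); auto. lra.
Qed.

Lemma chi_period (q : nat) (chi : Z -> R) (a k : Z) :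
  real_dirichlet_character q chi -> chi (a + k * Z.of_nat q)%Z = chi a.
Proof.
  intros [_ [Hp _]].
  assert (H : forall n a, chi (a + Z.of_nat n * Z.of_nat q)%Z = chi a).
  { induction n as [|n IH]; intro b.
    - f_equal. lia.
    - replace (b + Z.of_nat (S n) * Z.of_nat q)%Z
        with (b + Z.of_nat n * Z.of_nat q + Z.of_nat q)%Z by lia.
      now rewrite Hp, IH. }
  destruct (Z_le_gt_dec 0 k).
  - rewrite <- (Z2Nat.id k) by lia. apply H.
  - rewrite <- (H (Z.to_nat (- k)) (a + k * Z.of_nat q)%Z). f_equal. rewrite Z2Nat.id by lia. ring.
Qed.

Lemma chi_mod (q : nat) (chi : Z -> R) (a : Z) :
  (0 < q)%nat -> real_dirichlet_character q chi -> chi (a mod Z.of_nat q)%Z = chi a.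
Proof.
  intros Hq H. rewrite <- (chi_period q chi (a mod Z.of_nat q) (a / Z.of_nat q) H).
  f_equal. rewrite (Z.div_mod a (Z.of_nat q)) at 3 by lia. ring.
Qed.

(* The maximum of |chi| is attained, at b say, and |chi (b * b)| = |chi b| ^ 2 forces it to be
   at most 1. *)
Lemma chi_bound (q : nat) (chi : Z -> R) (a : Z) :
  (0 < q)%nat -> real_dirichlet_character q chi -> Rabs (chi a) <= 1.
Proof.
  intros Hq H.
  assert (Hmax : forall n, (0 < n)%nat -> exists b, forall k, (k < n)%nat ->
            Rabs (chi (Z.of_nat k)) <= Rabs (chi b)).
  { induction n as [|n IH]; [lia|]. intros _. destruct n as [|n].
    - exists 0%Z. intros k Hk. replace k with 0%nat by lia. simpl. lra.
    - destruct IH as [b Hb]; [lia|].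
      destruct (Rle_dec (Rabs (chi b)) (Rabs (chi (Z.of_nat (S n))))) as [L|L].
      + exists (Z.of_nat (S n)). intros k Hk. destruct (Nat.eq_dec k (S n)) as [->|N]; [lra|].
        specialize (Hb k ltac:(lia)). lra.
      + exists b. intros k Hk. destruct (Nat.eq_dec k (S n)) as [->|N]; [lra|].
        apply Hb. lia. }
  destruct (Hmax q Hq) as [b Hb].
  assert (Hb' : forall c, Rabs (chi c) <= Rabs (chi b)).
  { intro c. rewrite <- (chi_mod q chi c Hq H).
    pose proof (Z.mod_pos_bound c (Z.of_nat q) ltac:(lia)).
    rewrite <- (Z2Nat.id (c mod Z.of_nat q)) by lia. apply Hb. lia. }
  specialize (Hb' a) as H1. specialize (Hb' (b * b)%Z). rewrite (proj1 H), Rabs_mult in Hb'.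
  pose proof (Rabs_pos (chi b)). nra.
Qed.

Lemma unit_inverse (q : nat) (a : Z) :
  Z.gcd a (Z.of_nat q) = 1%Z -> exists b k : Z, (a * b = 1 + k * Z.of_nat q)%Z.
Proof.
  intros H. destruct (Z.gcd_bezout a (Z.of_nat q) 1 H) as [u [v E]].
  exists u, (- v)%Z. lia.
Qed.

(** The values at a and at its inverse modulo q have product 1 and moduli at most 1, so |chi a| = 1,
    and chi is real. *)
Lemma chi_unit_sqr (q : nat) (chi : Z -> R) (a : Z) :
  (0 < q)%nat -> real_dirichlet_character q chi -> Z.gcd a (Z.of_nat q) = 1%Z -> chi a * chi a = 1.
Proof.
  intros Hq H Ha. destruct (unit_inverse q a Ha) as [b [k E]].
  pose proof (proj1 H a b) as M. rewrite E, (chi_period q chi 1 k H), (chi_1 q chi H) in M.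
  pose proof (chi_bound q chi a Hq H). pose proof (chi_bound q chi b Hq H).
  assert (M' : Rabs (chi a) * Rabs (chi b) = 1) by (rewrite <- Rabs_mult, <- M; apply Rabs_R1).
  pose proof (Rabs_pos (chi a)). pose proof (Rabs_pos (chi b)).
  assert (Rabs (chi a) = 1) by nra.
  assert (E2 : chi a ^ 2 = 1) by (rewrite <- pow2_abs, H4; ring). lra.
Qed.

Lemma chi_0 (q : nat) (chi : Z -> R) :
  (1 < q)%nat -> real_dirichlet_character q chi -> chi 0%Z = 0.
Proof.
  intros Hq [_ [_ Hz]]. destruct (Req_dec (chi 0%Z) 0) as [E|N]; auto.
  apply Hz in N. rewrite Z.gcd_0_l in N. lia.
Qed.

Lemma chi_opp (q : nat) (chi : Z -> R) (n : Z) :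
  (1 < q)%nat -> real_dirichlet_character q chi ->
  (delta chi <= 1)%nat /\ chi (- n)%Z = (-1) ^ delta chi * chi n.
Proof.
  intros Hq H.
  assert (E : chi (- n)%Z = chi (-1)%Z * chi n) by (rewrite <- (proj1 H); f_equal; lia).
  rewrite E. unfold delta. destruct (Req_EM_T (chi (-1)%Z) 1) as [->|N].
  - split; [lia|]. simpl. ring.
  - split; [lia|].
    assert (Hu : chi (-1)%Z * chi (-1)%Z = 1).
    { apply (chi_unit_sqr q); auto; [lia|]. change (-1)%Z with (Z.opp 1).
      rewrite Z.gcd_opp_l. apply Z.gcd_1_l. }
    assert (E2 : (chi (-1)%Z - 1) * (chi (-1)%Z + 1) = 0) by lra.
    apply Rmult_integral in E2. destruct E2 as [E2|E2]; [lra|].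
    replace (chi (-1)%Z) with (-1) by lra. simpl. ring.
Qed.

Lemma rsum_mul_unit (q : nat) (F : Z -> R) (a : Z) :
  (0 < q)%nat -> (forall b k : Z, F (b + k * Z.of_nat q)%Z = F b) -> Z.gcd a (Z.of_nat q) = 1%Z ->
  rsum q (fun b => F (a * Z.of_nat b)%Z) = rsum q (fun b => F (Z.of_nat b)).
Proof.
  intros Hq HF Ha. set (Q := Z.of_nat q) in *.
  assert (HFm : forall z, F (z mod Q)%Z = F z).
  { intro z. rewrite <- (HF (z mod Q)%Z (z / Q)%Z). f_equal.
    rewrite (Z.div_mod z Q) at 3 by lia. ring. }
  set (g := fun b : nat => Z.to_nat ((a * Z.of_nat b) mod Q)%Z).
  assert (Hg : forall b, Z.of_nat (g b) = ((a * Z.of_nat b) mod Q)%Z).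
  { intro b. unfold g. apply Z2Nat.id. apply Z.mod_pos_bound. lia. }
  rewrite (rsum_ext q _ (fun b => F (Z.of_nat (g b)))).
  2:{ intros b _. now rewrite Hg, HFm. }
  rewrite !rsum_fold. rewrite <- (map_map g (fun b => F (Z.of_nat b))).
  apply fold_right_Rplus_Permutation. apply Permutation_map.
  apply NoDup_Permutation_bis.
  - apply NoDup_map_inv with (f := fun x => x). rewrite map_id.
    apply FinFun.Injective_map_NoDup_in; [|apply seq_NoDup].
    intros x y Hx Hy E. apply in_seq in Hx, Hy.
    assert (E2 : ((a * Z.of_nat x) mod Q = (a * Z.of_nat y) mod Q)%Z) by (rewrite <- !Hg; congruence).
    assert (D : (Q | a * (Z.of_nat x - Z.of_nat y))%Z).
    { apply Z.mod_divide; [lia|]. rewrite Z.mul_sub_distr_l, Zminus_mod, E2, Z.sub_diag. apply Z.mod_0_l. lia. }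
    apply Z.gauss in D; [|now rewrite Z.gcd_comm].
    destruct D as [k Hk]. assert (k = 0)%Z by nia. lia.
  - rewrite length_map. lia.
  - intros z Hz. apply in_map_iff in Hz. destruct Hz as [b [<- Hb]]. apply in_seq.
    pose proof (Z.mod_pos_bound (a * Z.of_nat b) Q ltac:(lia)). unfold g. lia.
Qed.

(** * Gauss sums *)

Definition trig (d : nat) (x : R) : R := match d with O => cos x | _ => sin x end.

Lemma trig_Z_period (d : nat) (z : Z) (x : R) : trig d (2 * PI * IZR z + x) = trig d x.
Proof.
  destruct d as [|d]; simpl; [apply cos_Z_period|].
  rewrite <- !cos_shift. rewrite <- (cos_Z_period (- z) (PI / 2 - x)). f_equal.
  rewrite opp_IZR. ring.
Qed.

Lemma trig_bound (d : nat) (x : R) : Rabs (trig d x) <= 1.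
Proof.
  destruct d; simpl; apply Rabs_le; [pose proof (COS_bound x)|pose proof (SIN_bound x)]; lra.
Qed.

(** For d = [delta chi] this is the usual Gauss sum with exponentials, up to the factor i^d: the
    other of the cosine and sine sums vanishes by parity. *)
Definition gauss_sum (q : nat) (chi : Z -> R) (d : nat) (n : Z) : R :=
  rsum q (fun b => chi (Z.of_nat b) * trig d (2 * PI * (IZR n * INR b / INR q))).

Lemma gauss_sum_mul_unit (q : nat) (chi : Z -> R) (d : nat) (n a : Z) :
  (0 < q)%nat -> real_dirichlet_character q chi -> Z.gcd a (Z.of_nat q) = 1%Z ->
  gauss_sum q chi d n = chi a * gauss_sum q chi d (n * a).
Proof.
  intros Hq H Ha. unfold gauss_sum.
  assert (HQ : IZR (Z.of_nat q) <> 0) by (apply not_0_IZR; lia).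
  pose (F := fun b : Z => chi b * trig d (2 * PI * (IZR n * IZR b / INR q))).
  rewrite (rsum_ext q _ (fun b => F (Z.of_nat b))).
  2:{ intros b _. unfold F. now rewrite <- INR_IZR_INZ. }
  rewrite <- (rsum_mul_unit q F a); auto.
  - rewrite <- rsum_scal. apply rsum_ext. intros b _. unfold F.
    rewrite (proj1 H), !mult_IZR, <- INR_IZR_INZ.
    rewrite <- (Rmult_assoc (IZR n) (IZR a) (INR b)), Rmult_assoc. reflexivity.
  - intros b k. unfold F. rewrite (chi_period q chi b k H). f_equal.
    rewrite <- (trig_Z_period d (n * k) (2 * PI * (IZR n * IZR b / INR q))). f_equal.
    rewrite plus_IZR, !mult_IZR, INR_IZR_INZ. field. auto.
Qed.

(** For n prime to q, multiply the residues by n. Otherwise put g = gcd(n, q): primitivity gives a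
    unit a congruent to 1 modulo the proper divisor q/g with chi a <> 1. Then n a and n agree modulo
    q, so the sum at n equals chi a times itself and vanishes, as does chi n. *)
Lemma gauss_sum_separable (q : nat) (chi : Z -> R) (d : nat) (n : Z) :
  (1 < q)%nat -> real_dirichlet_character q chi -> primitive_character q chi ->
  gauss_sum q chi d n = chi n * gauss_sum q chi d 1.
Proof.
  intros Hq H Hprim. destruct (Z.eq_dec (Z.gcd n (Z.of_nat q)) 1) as [E|N].
  - rewrite (gauss_sum_mul_unit q chi d 1 n ltac:(lia) H E), Z.mul_1_l.
    rewrite <- Rmult_assoc, (chi_unit_sqr q chi n ltac:(lia) H E). ring.
  - assert (chi n = 0) as ->.
    { destruct (Req_dec (chi n) 0) as [|C]; auto. apply (proj2 (proj2 H)) in C. contradiction. }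
    set (g := Z.gcd n (Z.of_nat q)) in *.
    assert (Hg : (0 < g)%Z).
    { assert (g <> 0)%Z by (unfold g; intro C; apply Z.gcd_eq_0 in C; lia).
      pose proof (Z.gcd_nonneg n (Z.of_nat q)). unfold g in *. lia. }
    destruct (Z.gcd_divide_l n (Z.of_nat q)) as [n' Hn]. destruct (Z.gcd_divide_r n (Z.of_nat q)) as [d' Hd].
    fold g in Hn, Hd.
    assert (Hd' : (0 < d')%Z) by nia.
    destruct (Hprim (Z.to_nat d')) as [a [D [Ha Hna]]].
    + nia.
    + exists (Z.to_nat g). apply Nat2Z.inj. rewrite Nat2Z.inj_mul, !Z2Nat.id by lia. lia.
    + rewrite Z2Nat.id in D by lia. destruct D as [k Hk].
      pose proof (gauss_sum_mul_unit q chi d n a ltac:(lia) H Ha) as M.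
      assert (E : gauss_sum q chi d (n * a) = gauss_sum q chi d n).
      { unfold gauss_sum. apply rsum_ext. intros b _. f_equal.
        rewrite <- (trig_Z_period d (n' * k * Z.of_nat b) (2 * PI * (IZR n * INR b / INR q))). f_equal.
        assert (Ea : (n * a = n + n' * k * Z.of_nat q)%Z).
        { replace a with (k * d' + 1)%Z by lia. rewrite Hd.
          transitivity (n + n * k * d')%Z; [ring|]. rewrite Hn at 2. ring. }
        rewrite Ea, plus_IZR, !mult_IZR, <- !INR_IZR_INZ. field.
        apply not_0_INR. lia. }
      rewrite E in M.
      assert (gauss_sum q chi d n * (1 - chi a) = 0) by lra.
      apply Rmult_integral in H0. destruct H0 as [H0|H0]; [rewrite H0; ring|]. exfalso. apply Hna. lra.
Qed.

(** * The functional equation of theta *)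

Definition theta_term (q : nat) (chi : Z -> R) (n : nat) (x : R) : R :=
  INR n ^ delta chi * chi (Z.of_nat n) * gauss (PI * x / INR q) (INR n).

Lemma pow_delta_gauss_le (d : nat) (kappa : R) (n : nat) :
  (d <= 1)%nat -> 0 < kappa ->
  INR n ^ d * gauss kappa (INR n) <= (1 + 2 / kappa) * exp (- (kappa / 4)) ^ n.
Proof.
  intros Hd Hk. assert (H0 : 0 < 2 / kappa) by (apply Rdiv_lt_0_compat; lra).
  destruct d as [|[|d]]; [| |lia].
  - simpl pow at 1. pose proof (gauss_INR_bound kappa n Hk).
    assert (exp (- (kappa / 2)) ^ n <= exp (- (kappa / 4)) ^ n).
    { apply pow_incr. split; [left; apply exp_pos|]. apply exp_le. lra. }
    pose proof (pow_lt (exp (- (kappa / 4))) n (exp_pos _)). nra.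
  - pose proof (id_gauss_le kappa (INR n) Hk) as B.
    rewrite Rabs_pos_eq in B by apply pos_INR.
    pose proof (gauss_INR_bound (kappa / 2) n ltac:(lra)) as B2.
    replace (kappa / 2 / 2) with (kappa / 4) in B2 by field.
    rewrite pow_1. nra.
Qed.

Lemma theta_term_bound (q : nat) (chi : Z -> R) (n : nat) (x : R) :
  (1 < q)%nat -> real_dirichlet_character q chi ->
  Rabs (theta_term q chi n x) <= INR n ^ delta chi * gauss (PI * x / INR q) (INR n).
Proof.
  intros Hq H. unfold theta_term. pose proof (gauss_pos (PI * x / INR q) (INR n)).
  assert (0 <= INR n ^ delta chi) by (apply pow_le, pos_INR).
  rewrite !Rabs_mult, (Rabs_pos_eq (gauss _ _)), (Rabs_pos_eq (_ ^ _)) by lra.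
  pose proof (chi_bound q chi (Z.of_nat n) ltac:(lia) H).
  apply Rmult_le_compat_r; [lra|]. nra.
Qed.

Lemma theta_kappa_pos (q : nat) (x : R) : (1 < q)%nat -> 0 < x -> 0 < PI * x / INR q.
Proof.
  intros Hq Hx. pose proof PI_RGT_0. apply Rdiv_lt_0_compat; [nra|]. apply lt_0_INR. lia.
Qed.

Lemma ex_series_Rabs_theta_term (q : nat) (chi : Z -> R) (x : R) :
  (1 < q)%nat -> real_dirichlet_character q chi -> 0 < x ->
  ex_series (fun n => Rabs (theta_term q chi n x)).
Proof.
  intros Hq H Hx. pose proof (theta_kappa_pos q x Hq Hx) as Hk.
  eapply ex_series_dominated; [|apply (ex_series_exp_neg (PI * x / INR q / 4) (1 + 2 / (PI * x / INR q))); lra].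
  intro n. rewrite Rabs_Rabsolu. eapply Rle_trans; [now apply theta_term_bound|].
  apply pow_delta_gauss_le; auto. apply (chi_opp q chi 0); auto.
Qed.

Lemma theta_term_Z (q : nat) (chi : Z -> R) (z : Z) (x : R) :
  (1 < q)%nat ->
  IZR z ^ delta chi * chi z * exp (- (PI * IZR z ^ 2 * x / INR q)) =
  IZR z ^ delta chi * chi z * gauss (PI * x / INR q) (IZR z).
Proof.
  intros Hq. unfold gauss. do 3 f_equal. field. apply not_0_INR. lia.
Qed.

(** The signs of n^delta and chi(n) under n -> -n cancel, and the term at 0 vanishes since chi 0 =
    0. *)
Lemma theta_one_sided (q : nat) (chi : Z -> R) (x : R) :
  (1 < q)%nat -> real_dirichlet_character q chi -> 0 < x ->
  theta q chi x = 2 * Series (fun n => theta_term q chi n x).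
Proof.
  intros Hq H Hx. unfold theta, SeriesZ.
  pose proof (ex_series_Rabs _ (ex_series_Rabs_theta_term q chi x Hq H Hx)) as Hex.
  rewrite (Series_ext _ (fun n => theta_term q chi n x)).
  2:{ intro n. rewrite theta_term_Z, <- INR_IZR_INZ by auto. reflexivity. }
  rewrite (Series_ext (fun n => IZR (- Z.of_nat (S n)) ^ delta chi * _ * _) (fun n => theta_term q chi (S n) x)).
  - rewrite (Series_incr_1 (fun n => theta_term q chi n x)) by auto.
    replace (theta_term q chi 0 x) with 0; [ring|]. unfold theta_term.
    change (Z.of_nat 0) with 0%Z. rewrite (chi_0 q chi Hq H). ring.
  - intro n. rewrite theta_term_Z by auto. destruct (chi_opp q chi (Z.of_nat (S n)) Hq H) as [Hd E].
    rewrite E. unfold theta_term, gauss. rewrite opp_IZR, <- INR_IZR_INZ.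
    replace ((- INR (S n)) ^ 2) with (INR (S n) ^ 2) by ring.
    replace (- INR (S n)) with (-1 * INR (S n)) by ring. rewrite Rpow_mult_distr.
    assert (S2 : (-1) ^ delta chi * (-1) ^ delta chi = 1).
    { rewrite <- Rpow_mult_distr. replace (-1 * -1) with 1 by ring. apply pow1. }
    transitivity ((-1) ^ delta chi * (-1) ^ delta chi * (INR (S n) ^ delta chi * chi (Z.of_nat (S n)) *
      exp (- (PI * x / INR q * INR (S n) ^ 2)))); [ring|]. rewrite S2. ring.
Qed.

Definition gauss_pair_d (d : nat) (kappa : R) (m : nat) (a : R) : R :=
  (INR m + a) ^ d * gauss kappa (INR m + a) + (a - INR m - 1) ^ d * gauss kappa (a - INR m - 1).

Definition dual_term_d (d : nat) (rho : R) (n : nat) (a : R) : R :=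
  cos_weight n * INR n ^ d * gauss rho (INR n) * trig d (2 * PI * INR n * a).

Lemma poisson_gauss_d (d : nat) (kappa a : R) :
  (d <= 1)%nat -> 0 < kappa ->
  Series (fun m => gauss_pair_d d kappa m a) =
  2 * (PI / kappa) ^ d * gauss_cos kappa 0 * Series (fun n => dual_term_d d (PI ^ 2 / kappa) n a).
Proof.
  intros Hd Hk. destruct d as [|[|d]]; [| |lia].
  - rewrite (Series_ext _ (fun m => gauss_pair kappa m a)) by (intro; unfold gauss_pair_d, gauss_pair; simpl; ring).
    rewrite (Series_ext (fun n => dual_term_d _ _ n a) (fun n => dual_term (PI ^ 2 / kappa) n a))
      by (intro; unfold dual_term_d, dual_term; simpl; ring).
    rewrite poisson_gauss by auto. simpl. ring.
  - rewrite (Series_ext _ (fun m => gauss_pair_odd kappa m a)) by (intro; unfold gauss_pair_d, gauss_pair_odd; simpl; ring).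
    rewrite (Series_ext (fun n => dual_term_d _ _ n a) (fun n => dual_term_odd (PI ^ 2 / kappa) n a))
      by (intro; unfold dual_term_d, dual_term_odd; simpl; ring).
    rewrite poisson_gauss_odd by auto. simpl. field. lra.
Qed.

Lemma dual_term_d_bound (d : nat) (rho a : R) (n : nat) :
  (d <= 1)%nat -> 0 < rho ->
  Rabs (dual_term_d d rho n a) <= 2 * (1 + 2 / rho) * exp (- (rho / 4)) ^ n.
Proof.
  intros Hd Hr. unfold dual_term_d. pose proof (trig_bound d (2 * PI * INR n * a)).
  pose proof (pow_delta_gauss_le d rho n Hd Hr). pose proof (cos_weight_bound n).
  assert (0 <= INR n ^ d * gauss rho (INR n)).
  { apply Rmult_le_pos; [apply pow_le, pos_INR|left; apply gauss_pos]. }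
  rewrite Rabs_mult, (Rmult_assoc (cos_weight n)).
  rewrite (Rabs_pos_eq (cos_weight n * _)) by (apply Rmult_le_pos; lra).
  apply Rle_trans with (cos_weight n * (INR n ^ d * gauss rho (INR n)) * 1).
  - apply Rmult_le_compat_l; auto. apply Rmult_le_pos; lra.
  - rewrite Rmult_1_r, (Rmult_assoc 2). apply Rmult_le_compat; lra.
Qed.

Lemma theta_residues (q : nat) (chi : Z -> R) (x : R) :
  (1 < q)%nat -> real_dirichlet_character q chi -> 0 < x ->
  theta q chi x = rsum q (fun a => chi (Z.of_nat a) * INR q ^ delta chi *
    Series (fun m => gauss_pair_d (delta chi) (PI * INR q * x) m (INR a / INR q))).
Proof.
  intros Hq H Hx. set (d := delta chi).
  assert (HQ : INR q <> 0) by (apply not_0_INR; lia).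
  set (f := fun z : Z => IZR z ^ d * chi z * gauss (PI * x / INR q) (IZR z)).
  assert (Hfopp : forall z, f (- z)%Z = f z).
  { intro z. unfold f. destruct (chi_opp q chi z Hq H) as [_ E]. rewrite E, opp_IZR. fold d.
    unfold gauss. replace ((- IZR z) ^ 2) with (IZR z ^ 2) by ring.
    replace (- IZR z) with (-1 * IZR z) by ring. rewrite Rpow_mult_distr.
    assert (S2 : (-1) ^ d * (-1) ^ d = 1).
    { rewrite <- Rpow_mult_distr. replace (-1 * -1) with 1 by ring. apply pow1. }
    transitivity ((-1) ^ d * (-1) ^ d * (IZR z ^ d * chi z * exp (- (PI * x / INR q * IZR z ^ 2)))); [ring|].
    rewrite S2. ring. }
  assert (E1 : theta q chi x = Series (fun n => f (Z.of_nat n)) + Series (fun n => f (- Z.of_nat (S n))%Z)).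
  { unfold theta, SeriesZ. f_equal; apply Series_ext; intro n; rewrite theta_term_Z; auto. }
  pose proof (ex_series_Rabs_theta_term q chi x Hq H Hx) as Hex.
  assert (A1 : ex_series (fun n => Rabs (f (Z.of_nat n)))).
  { eapply ex_series_ext; [|exact Hex]. intro n. unfold f, theta_term. now rewrite <- INR_IZR_INZ. }
  assert (A2 : ex_series (fun n => Rabs (f (- Z.of_nat (S n))%Z))).
  { apply (ex_series_incr_1 (fun n => Rabs (f (Z.of_nat n)))) in A1.
    eapply ex_series_ext; [|exact A1]. intro n. cbv beta. now rewrite Hfopp. }
  destruct (Series_residues q (fun n => f (Z.of_nat n)) ltac:(lia) A1) as [X1 Y1].
  destruct (Series_residues q (fun n => f (- Z.of_nat (S n))%Z) ltac:(lia) A2) as [X2 Y2].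
  rewrite E1, Y1, Y2. clear E1 Y1 Y2.
  (* Since -(q m + (q - 1 - a) + 1) = a + q (-m - 1), reversing the residues on the negative half
     aligns its classes with those of the positive half. *)
  rewrite (rsum_rev q (fun a => Series (fun m => f (- Z.of_nat (S (q * m + a)))%Z))), <- rsum_plus.
  apply rsum_ext. intros a Ha. rewrite <- Series_plus; [|now apply X1|apply X2; lia].
  rewrite <- Series_scal_l. apply Series_ext. intro m. unfold gauss_pair_d.
  assert (F : forall k : Z, f (Z.of_nat a + k * Z.of_nat q)%Z = chi (Z.of_nat a) * INR q ^ d *
     ((IZR k + INR a / INR q) ^ d * gauss (PI * INR q * x) (IZR k + INR a / INR q))).
  { intro k. unfold f. rewrite (chi_period q chi _ k H).
    rewrite plus_IZR, mult_IZR, <- !INR_IZR_INZ.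
    replace (INR a + IZR k * INR q) with (INR q * (IZR k + INR a / INR q)) by (field; auto).
    rewrite Rpow_mult_distr.
    replace (gauss (PI * x / INR q) (INR q * (IZR k + INR a / INR q)))
      with (gauss (PI * INR q * x) (IZR k + INR a / INR q)); [ring|].
    unfold gauss. do 2 f_equal. field. auto. }
  replace (Z.of_nat (q * m + a)) with (Z.of_nat a + Z.of_nat m * Z.of_nat q)%Z by lia.
  replace (- Z.of_nat (S (q * m + (q - 1 - a))))%Z with (Z.of_nat a + (- Z.of_nat m - 1) * Z.of_nat q)%Z by lia.
  rewrite !F, minus_IZR, opp_IZR, <- INR_IZR_INZ.
  replace (- INR m - 1 + INR a / INR q) with (INR a / INR q - INR m - 1) by ring. ring.
Qed.

(** Poisson summation on each residue class, with kappa = pi q x, produces Gaussians of parameter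
    pi^2 / kappa = pi / (q x), those of theta at 1/x. The finite sum over classes is then a Gauss
    sum, and separability restores chi(n). *)
Lemma theta_reflection (q : nat) (chi : Z -> R) :
  (1 < q)%nat -> real_dirichlet_character q chi -> primitive_character q chi ->
  exists W, forall x, 0 < x ->
    theta q chi x = W / (x ^ delta chi * sqrt x) * theta q chi (1 / x).
Proof.
  intros Hq H Hprim. set (d := delta chi).
  assert (Hd : (d <= 1)%nat) by (apply (chi_opp q chi 0); auto).
  assert (HQ : 0 < INR q) by (apply lt_0_INR; lia). assert (Hpi : 0 < PI) by exact PI_RGT_0.
  set (G := gauss_sum q chi d 1).
  exists (2 * gauss_cos 1 0 / sqrt (PI * INR q) * G).
  intros x Hx. assert (Hk : 0 < PI * INR q * x) by (apply Rmult_lt_0_compat; [apply Rmult_lt_0_compat; assumption|assumption]).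
  assert (Hx' : 0 < 1 / x) by (apply Rdiv_lt_0_compat; lra).
  rewrite (theta_residues q chi x Hq H Hx). fold d.
  set (c := 2 * (PI / (PI * INR q * x)) ^ d * gauss_cos (PI * INR q * x) 0).
  set (rho := PI ^ 2 / (PI * INR q * x)).
  assert (Hr : 0 < rho) by (apply Rdiv_lt_0_compat; auto; now apply pow_lt).
  rewrite (rsum_ext q _ (fun a => INR q ^ d * c *
     Series (fun n => chi (Z.of_nat a) * dual_term_d d rho n (INR a / INR q)))).
  2:{ intros a _. rewrite poisson_gauss_d by auto. rewrite Series_scal_l. unfold c, rho. ring. }
  rewrite rsum_scal.
  assert (Hex : forall a, (a < q)%nat -> ex_series (fun n => chi (Z.of_nat a) * dual_term_d d rho n (INR a / INR q))).
  { intros a _. apply ex_series_Rscal.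
    eapply ex_series_dominated; [|apply (ex_series_exp_neg (rho / 4) (2 * (1 + 2 / rho))); lra].
    intro n. now apply dual_term_d_bound. }
  rewrite <- (proj2 (rsum_Series q _ Hex)).
  rewrite (Series_ext _ (fun n => 2 * G * theta_term q chi n (1 / x))).
  - rewrite Series_scal_l, (theta_one_sided q chi (1 / x) Hq H Hx').
    unfold c. rewrite gauss_cos_0_scale by auto.
    rewrite (sqrt_mult (PI * INR q) x) by (try apply Rmult_le_pos; lra).
    assert (S1 : 0 < sqrt x) by now apply sqrt_lt_R0.
    assert (S2 : 0 < sqrt (PI * INR q)) by (apply sqrt_lt_R0, Rmult_lt_0_compat; auto).
    replace (PI / (PI * INR q * x)) with (/ INR q * / x) by (field; lra).
    rewrite Rpow_mult_distr, !pow_inv.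
    assert (0 < x ^ d) by now apply pow_lt. assert (0 < INR q ^ d) by now apply pow_lt.
    field. repeat split; lra.
  - intro n. unfold dual_term_d, theta_term. fold d.
    replace (PI * (1 / x) / INR q) with rho by (unfold rho; field; lra).
    transitivity (cos_weight n * INR n ^ d * gauss rho (INR n) * gauss_sum q chi d (Z.of_nat n)).
    + unfold gauss_sum. rewrite <- rsum_scal. apply rsum_ext. intros a _.
      rewrite <- INR_IZR_INZ.
      replace (2 * PI * INR n * (INR a / INR q)) with (2 * PI * (INR n * INR a / INR q)) by (field; lra).
      ring.
    + rewrite (gauss_sum_separable q chi d (Z.of_nat n) Hq H Hprim). fold G.
      (* For n > 0 the weight is the factor 2 of the right-hand side; at n = 0 the weight is 1, but
         both sides vanish. *)
      destruct n as [|n]; [|simpl cos_weight; ring].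
      change (Z.of_nat 0) with 0%Z. rewrite (chi_0 q chi Hq H). ring.
Qed.

(* The root number is 1: compare both sides of the reflection formula at x = 1. *)
Lemma theta_functional_equation (q : nat) (chi : Z -> R) :
  (1 < q)%nat -> real_dirichlet_character q chi -> primitive_character q chi ->
  (forall x, 0 < x -> 0 < theta q chi x) ->
  forall x, 0 < x -> theta q chi x = / (x ^ delta chi * sqrt x) * theta q chi (1 / x).
Proof.
  intros Hq H Hprim Hpos x Hx. destruct (theta_reflection q chi Hq H Hprim) as [W HW].
  assert (W = 1) as ->.
  { pose proof (HW 1 Rlt_0_1) as E. specialize (Hpos 1 Rlt_0_1).
    rewrite pow1, sqrt_1, Rmult_1_l in E. replace (1 / 1) with 1 in E by field.
    unfold Rdiv in E. rewrite Rinv_1, Rmult_1_r in E.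
    apply (Rmult_eq_reg_r (theta q chi 1)); lra. }
  rewrite (HW x Hx). unfold Rdiv. ring.
Qed.

(** * Power series on the unit disk *)

(** Radius of convergence at least 1, in the form in which the power series lemmas take their
    hypothesis at a point. *)
Definition disk (a : nat -> R) : Prop := forall x, Rabs x < 1 -> Rbar_lt (Rabs x) (CV_radius a).

Lemma disk_intro (a : nat -> R) :
  (forall r, 0 < r < 1 -> ex_series (fun n => a n * r ^ n)) -> disk a.
Proof.
  intros H x Hx. set (r := (1 + Rabs x) / 2). pose proof (Rabs_pos x).
  apply Rbar_lt_le_trans with (Finite r); [simpl; unfold r; lra|].
  apply Rbar_not_lt_le. intro C. rewrite <- (Rabs_pos_eq r) in C by (unfold r; lra).
  apply (CV_disk_outside a r C). apply ex_series_lim_0. apply H. unfold r; lra.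
Qed.

Lemma disk_abs (a : nat -> R) (r : R) :
  disk a -> 0 <= r < 1 -> ex_series (fun n => Rabs (a n) * r ^ n).
Proof.
  intros H Hr. eapply ex_series_ext; [|apply (CV_disk_inside a r)].
  - intro n. cbv beta. rewrite Rabs_mult, <- RPow_abs, (Rabs_pos_eq r); auto; lra.
  - apply H. rewrite Rabs_pos_eq; lra.
Qed.

Lemma disk_ex_series (a : nat -> R) (x : R) :
  disk a -> Rabs x < 1 -> ex_series (fun n => a n * x ^ n).
Proof. intros H Hx. apply ex_series_Rabs, CV_disk_inside, H, Hx. Qed.

Lemma disk_le (a b : nat -> R) :
  disk b -> (forall n, Rabs (a n) <= Rabs (b n)) -> disk a.
Proof.
  intros H Hab. apply disk_intro. intros r Hr.
  apply (ex_series_dominated _ (fun n => Rabs (b n) * r ^ n)).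
  - intro n. assert (0 < r ^ n) by (apply pow_lt; lra).
    rewrite Rabs_mult, (Rabs_pos_eq (r ^ n)) by lra. apply Rmult_le_compat_r; [lra|auto].
  - apply disk_abs; auto; lra.
Qed.

Lemma disk_mult (a b : nat -> R) : disk a -> disk b -> disk (PS_mult a b).
Proof.
  intros Ha Hb. apply disk_intro. intros r Hr.
  assert (Hr' : Rabs r < 1) by (rewrite Rabs_pos_eq; lra).
  apply ex_pseries_R. now apply ex_pseries_mult; [apply Ha|apply Hb].
Qed.

Lemma disk_lin (a b : nat -> R) (u v : R) :
  disk a -> disk b -> disk (fun n => u * a n + v * b n).
Proof.
  intros Ha Hb. apply disk_intro. intros r Hr.
  assert (Hr' : Rabs r < 1) by (rewrite Rabs_pos_eq; lra).
  apply (ex_series_ext (fun n => u * (a n * r ^ n) + v * (b n * r ^ n))).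
  - intro n. req. ring.
  - apply ex_series_Rplus; apply ex_series_Rscal; now apply disk_ex_series.
Qed.

Lemma PSeries_lin (a b : nat -> R) (u v x : R) :
  disk a -> disk b -> Rabs x < 1 ->
  PSeries (fun n => u * a n + v * b n) x = u * PSeries a x + v * PSeries b x.
Proof.
  intros Ha Hb Hx. unfold PSeries.
  rewrite (Series_ext _ (fun n => u * (a n * x ^ n) + v * (b n * x ^ n))) by (intro; ring).
  rewrite Series_plus, !Series_scal_l; auto;
    apply ex_series_Rscal; now apply disk_ex_series.
Qed.

Lemma disk_decr (a : nat -> R) : disk a -> disk (PS_decr_1 a).
Proof. intros H x Hx. rewrite CV_radius_decr_1. now apply H. Qed.

(** The coefficients of z a'(z). This operator acts diagonally and therefore commutes with
    restriction to a ray. *)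
Definition euler (a : nat -> R) (n : nat) : R := INR n * a n.

Lemma euler_incr_derive (a : nat -> R) (n : nat) : euler a n = PS_incr_1 (PS_derive a) n.
Proof.
  unfold euler. destruct n as [|n].
  - simpl. change (@zero R_NormedModule) with 0. ring.
  - reflexivity.
Qed.

Lemma disk_euler (a : nat -> R) : disk a -> disk (euler a).
Proof.
  intros H x Hx. rewrite (CV_radius_ext _ _ (euler_incr_derive a)).
  rewrite CV_radius_incr_1, CV_radius_derive. now apply H.
Qed.

Lemma PSeries_euler (a : nat -> R) (x : R) :
  disk a -> Rabs x < 1 -> PSeries (euler a) x = x * Derive (PSeries a) x.
Proof.
  intros H Hx. rewrite Derive_PSeries by now apply H.
  rewrite <- PSeries_incr_1. apply PSeries_ext. apply euler_incr_derive.
Qed.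

Lemma disk_continuous (a : nat -> R) (x : R) : disk a -> Rabs x < 1 -> continuous (PSeries a) x.
Proof. intros H Hx. apply continuity_pt_filterlim, PSeries_continuity, H, Hx. Qed.

Lemma disk_is_derive (a : nat -> R) (x : R) :
  disk a -> Rabs x < 1 -> is_derive (PSeries a) x (Derive (PSeries a) x).
Proof. intros H Hx. apply Derive_correct, ex_derive_PSeries, H, Hx. Qed.

(** The constant term is the limit at 0 from the right; once it is zero, divide by z and repeat. *)
Lemma PSeries_zero_right (n : nat) : forall a : nat -> R,
  disk a -> (forall z, 0 < z < 1 -> PSeries a z = 0) -> a n = 0.
Proof.
  assert (H0 : forall a, disk a -> (forall z, 0 < z < 1 -> PSeries a z = 0) -> a 0%nat = 0).
  { intros a Ha Hz. destruct (Req_dec (a 0%nat) 0) as [|N]; auto. exfalso.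
    destruct (continuous_R_elim (PSeries a) 0 (Rabs (a 0%nat))) as [d [Hd H]].
    - apply disk_continuous; auto. rewrite Rabs_R0; lra.
    - now apply Rabs_pos_lt.
    - rewrite PSeries_0 in H. pose proof (Rmin_l d 1). pose proof (Rmin_r d 1).
      assert (0 < Rmin d 1) by (apply Rmin_glb_lt; lra).
      specialize (H (Rmin d 1 / 2)). rewrite Hz in H by lra.
      unfold Rminus in H at 2. rewrite Rplus_0_l, Rabs_Ropp in H.
      assert (C : Rabs (a 0%nat) < Rabs (a 0%nat)); [|lra]. apply H.
      rewrite Rminus_0_r, Rabs_pos_eq; lra. }
  induction n as [|n IH]; intros a Ha Hz; auto.
  change (a (S n)) with (PS_decr_1 a n). apply IH; [now apply disk_decr|].
  intros z Hz'. pose proof (Hz z Hz') as Hz1.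
  rewrite PSeries_decr_1 in Hz1.
  - rewrite (H0 a Ha Hz) in Hz1.
    apply (Rmult_eq_reg_l z); lra.
  - apply ex_pseries_R, disk_ex_series; auto. rewrite Rabs_pos_eq; lra.
Qed.

(** * Zeros of a power series have finite order *)

Lemma INR_fact_pos (n : nat) : 0 < INR (fact n).
Proof. apply lt_0_INR, lt_O_fact. Qed.

Lemma binomial_term_le (k n : nat) (x y : R) :
  0 <= x -> 0 <= y ->
  INR (fact (k + n)) / (INR (fact k) * INR (fact n)) * x ^ k * y ^ n <= (x + y) ^ (k + n).
Proof.
  intros Hx Hy. rewrite binomial.
  apply Rle_trans with (Binomial.C (k + n) k * x ^ k * y ^ (k + n - k)).
  - unfold Binomial.C. replace (k + n - k)%nat with n by lia. lra.
  - rewrite <- sum_n_Reals, <- rsum_sum_n.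
    apply (rsum_ge_term (S (k + n)) k (fun i => Binomial.C (k + n) i * x ^ i * y ^ (k + n - i))); [|lia].
    intro i. repeat apply Rmult_le_pos; try (now apply pow_le).
    + left. apply INR_fact_pos.
    + left. apply Rinv_0_lt_compat, Rmult_lt_0_compat; apply INR_fact_pos.
Qed.

(** A Cauchy estimate without complex integration: binomial(k+n, n) |x|^k rho^n is a single term of
    (|x| + rho)^(k+n), hence at most R0^(k+n). *)
Lemma PS_derive_n_bound (a : nat -> R) (n : nat) (x rho R0 : R) :
  disk a -> 0 < rho -> Rabs x + rho <= R0 -> R0 < 1 ->
  Rabs (PSeries (PS_derive_n n a) x) <=
    INR (fact n) / rho ^ n * Series (fun k => Rabs (a k) * R0 ^ k).
Proof.
  intros Ha Hr HR H1. pose proof (Rabs_pos x) as Hx.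
  assert (HR0 : 0 < R0) by lra.
  assert (HM : ex_series (fun k => Rabs (a k) * R0 ^ k)) by (apply disk_abs; auto; lra).
  assert (Hn : 0 < INR (fact n) / rho ^ n) by (apply Rdiv_lt_0_compat; [apply INR_fact_pos|now apply pow_lt]).
  assert (HM' : ex_series (fun k => Rabs (a (n + k)%nat) * R0 ^ (n + k))) by
    (apply (ex_series_incr_n (fun k => Rabs (a k) * R0 ^ k)); auto).
  assert (Hb : forall k, Rabs (PS_derive_n n a k * x ^ k) <=
      INR (fact n) / rho ^ n * (Rabs (a (n + k)%nat) * R0 ^ (n + k))).
  { intro k. unfold PS_derive_n. rewrite (Nat.add_comm n k).
    pose proof (INR_fact_pos (k + n)). pose proof (INR_fact_pos k). pose proof (INR_fact_pos n).
    rewrite !Rabs_mult, <- RPow_abs.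
    rewrite (Rabs_pos_eq (INR (fact (k + n)) / INR (fact k))) by (left; now apply Rdiv_lt_0_compat).
    pose proof (binomial_term_le k n (Rabs x) rho Hx (Rlt_le _ _ Hr)) as B.
    assert (B2 : (Rabs x + rho) ^ (k + n) <= R0 ^ (k + n)) by (apply pow_incr; lra).
    assert (Hrn : 0 < rho ^ n) by now apply pow_lt.
    replace (INR (fact (k + n)) / INR (fact k) * Rabs (a (k + n)%nat) * Rabs x ^ k)
      with (INR (fact n) / rho ^ n * (Rabs (a (k + n)%nat) *
        (INR (fact (k + n)) / (INR (fact k) * INR (fact n)) * Rabs x ^ k * rho ^ n)))
      by (field; repeat split; lra).
    apply Rmult_le_compat_l; [lra|]. apply Rmult_le_compat_l; [apply Rabs_pos|]. lra. }
  unfold PSeries. eapply Rle_trans; [apply Series_Rabs|].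
  - apply (ex_series_dominated _ (fun k => INR (fact n) / rho ^ n * (Rabs (a (n + k)%nat) * R0 ^ (n + k)))).
    + intro k. rewrite Rabs_Rabsolu. apply Hb.
    + now apply ex_series_Rscal.
  - eapply Rle_trans.
    + apply Series_le; [intro k; split; [apply Rabs_pos|apply Hb]|]. now apply ex_series_Rscal.
    + rewrite Series_scal_l. apply Rmult_le_compat_l; [lra|].
      destruct n as [|n]; [simpl; lra|].
      rewrite (Series_incr_n (fun k => Rabs (a k) * R0 ^ k) (S n)) by (auto; lia).
      simpl pred. rewrite <- sum_n_Reals.
      assert (0 <= sum_n (fun k => Rabs (a k) * R0 ^ k) n).
      { apply sum_n_ge_0. intro k. apply Rmult_le_pos; [apply Rabs_pos|apply pow_le; lra]. }
      lra.
Qed.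

(** With all derivatives zero at x only the Lagrange remainder is left, at most M ((y - x) /
    rho)^(n+1) <= M 2^-(n+1). As y lies between x and 0, the intermediate point is no farther from 0
    than x, so the same rho works there. *)
Lemma flat_step (a : nat -> R) (x y rho R0 : R) :
  disk a -> x <= y <= 0 -> y - x <= rho / 2 -> 0 < rho -> Rabs x + rho <= R0 -> R0 < 1 ->
  (forall n, Derive_n (PSeries a) n x = 0) -> PSeries a y = 0.
Proof.
  intros Ha Hxy Hd Hr HR H1 HD.
  destruct (Req_dec x y) as [<-|Nxy]; [exact (HD 0%nat)|].
  set (M := Series (fun k => Rabs (a k) * R0 ^ k)).
  assert (HM : 0 <= M).
  { eapply Rle_trans; [|apply (sum_n_le_Series (fun k => Rabs (a k) * R0 ^ k) 0)].
    - rewrite sum_O. apply Rmult_le_pos; [apply Rabs_pos|simpl; lra].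
    - intro k. apply Rmult_le_pos; [apply Rabs_pos|apply pow_le; pose proof (Rabs_pos x); lra].
    - apply disk_abs; auto. pose proof (Rabs_pos x). lra. }
  assert (Hb : forall n, Rabs (PSeries a y) <= M * (1 / 2) ^ S n).
  { intro n. destruct (Taylor_Lagrange (PSeries a) n x y) as [zeta [Hz E]]; [lra| |].
    - intros t Ht k _. apply ex_derive_n_PSeries, Ha. rewrite Rabs_left1 by lra.
      rewrite Rabs_left1 in HR; lra.
    - rewrite E. rewrite (sum_eq_R0 _ n) by (intros m _; rewrite HD; ring). rewrite Rplus_0_l.
      assert (Hz1 : Rabs zeta <= Rabs x) by (rewrite !Rabs_left1; lra).
      rewrite Derive_n_PSeries by (apply Ha; lra).
      pose proof (PS_derive_n_bound a (S n) zeta rho R0 Ha Hr ltac:(lra) H1) as B. fold M in B.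
      set (F := INR (fact (S n))) in *. assert (HF : 0 < F) by apply INR_fact_pos.
      assert (Hrn : 0 < rho ^ S n) by now apply pow_lt.
      assert (Hp : 0 <= (y - x) ^ S n / F).
      { apply Rmult_le_pos; [apply pow_le; lra|]. left. now apply Rinv_0_lt_compat. }
      rewrite Rabs_mult, (Rabs_pos_eq (_ / _)) by auto.
      apply Rle_trans with ((y - x) ^ S n / F * (F / rho ^ S n * M)).
      + now apply Rmult_le_compat_l.
      + replace ((y - x) ^ S n / F * (F / rho ^ S n * M)) with (M * ((y - x) ^ S n * / rho ^ S n))
          by (field; split; lra).
        apply Rmult_le_compat_l; auto. rewrite <- pow_inv, <- Rpow_mult_distr.
        apply pow_incr. assert (0 < / rho) by now apply Rinv_0_lt_compat. split.
        * apply Rmult_le_pos; lra.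
        * apply Rmult_le_reg_r with rho; auto. rewrite Rmult_assoc, Rinv_l; lra. }
  destruct (Req_dec (PSeries a y) 0) as [|N]; auto. exfalso.
  assert (Hp : 0 < Rabs (PSeries a y)) by now apply Rabs_pos_lt.
  destruct (pow_lt_1_zero (1 / 2)) with (y := Rabs (PSeries a y) / (M + 1)) as [n Hn].
  - rewrite Rabs_pos_eq; lra.
  - apply Rdiv_lt_0_compat; lra.
  - specialize (Hn (S n) ltac:(lia)). specialize (Hb n).
    rewrite Rabs_pos_eq in Hn by (apply pow_le; lra).
    apply (Rmult_lt_compat_r (M + 1)) in Hn; [|lra].
    unfold Rdiv in Hn at 2. rewrite (Rmult_assoc (Rabs _)), Rinv_l in Hn by lra.
    pose proof (pow_lt (1 / 2) (S n) ltac:(lra)). lra.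
Qed.

(** Identity theorem along a segment: vanishing to infinite order at x0 spreads to 0 in steps of
    fixed length. The point is negative because the Taylor formula expands to the right, and this
    must lead towards 0; positive points are reached by reflection. *)
Lemma flat_point_zero (a : nat -> R) (x0 : R) :
  disk a -> -1 < x0 < 0 -> (forall n, Derive_n (PSeries a) n x0 = 0) -> PSeries a 0 = 0.
Proof.
  (* R0 is midway between |x0| and 1, and rho = R0 - |x0|. *)
  intros Ha Hx HD. set (R0 := (1 - x0) / 2). set (rho := R0 + x0).
  assert (Hr : 0 < rho) by (unfold rho, R0; lra). assert (HR : R0 < 1) by (unfold R0; lra).
  assert (Hbase : forall x, x0 <= x <= 0 -> Rabs x + rho <= R0).
  { intros x Hx'. rewrite Rabs_left1 by lra. unfold rho. lra. }
  assert (claim : forall k y, x0 <= y <= 0 -> y <= x0 + INR (S k) * (rho / 4) -> PSeries a y = 0).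
  { induction k as [|k IH]; intros y Hy Hk.
    - simpl INR in Hk. apply (flat_step a x0 y rho R0); auto; try lra. apply Hbase; lra.
    - destruct (Rle_dec y (x0 + INR (S k) * (rho / 4))) as [L|L]; [now apply IH|].
      rewrite (S_INR (S k)) in Hk. set (xk := x0 + INR (S k) * (rho / 4)) in *.
      assert (HS : rho / 4 <= INR (S k) * (rho / 4)).
      { rewrite S_INR. pose proof (pos_INR k). nra. }
      (* [xb] is interior to the stretch where the series is already zero, so all derivatives vanish
         there; the next stretch is within 3 rho / 8 of it. *)
      set (xb := xk - rho / 8). assert (x0 < xb < xk) by (unfold xb, xk; lra).
      apply (flat_step a xb y rho R0); auto; try lra.
      + unfold xb, xk in *; lra.
      + apply Hbase. lra.
      + intro n. rewrite (Derive_n_ext_loc (PSeries a) (fun _ => 0) n xb).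
        * destruct n as [|n]; [reflexivity|apply Derive_n_const].
        * assert (Hd : 0 < Rmin (xb - x0) (xk - xb)) by (apply Rmin_glb_lt; lra).
          exists (mkposreal _ Hd). intros t Ht. apply Rabs_def2 in Ht.
          unfold minus, plus, opp in Ht; simpl in Ht.
          pose proof (Rmin_l (xb - x0) (xk - xb)). pose proof (Rmin_r (xb - x0) (xk - xb)).
          apply IH; fold xk; lra. }
  destruct (nfloor_ex (- x0 / (rho / 4))) as [k [_ Hk]].
  { apply Rmult_le_pos; [lra|]. left. apply Rinv_0_lt_compat. lra. }
  apply (claim k); [lra|]. rewrite S_INR.
  apply (Rmult_lt_compat_r (rho / 4)) in Hk; [|lra].
  replace (- x0 / (rho / 4) * (rho / 4)) with (- x0) in Hk by (field; lra). lra.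
Qed.

Lemma PSeries_reflect (a : nat -> R) (x : R) : PSeries (fun n => (-1) ^ n * a n) x = PSeries a (- x).
Proof.
  unfold PSeries. apply Series_ext. intro n.
  replace (- x) with (-1 * x) by ring. rewrite Rpow_mult_distr. ring.
Qed.

Lemma disk_reflect (a : nat -> R) : disk a -> disk (fun n => (-1) ^ n * a n).
Proof.
  intros H. apply (disk_le _ a H). intro n. rewrite Rabs_mult, pow_1_abs. lra.
Qed.

Lemma Derive_n_reflect (a : nat -> R) (n : nat) (x : R) :
  disk a -> Rabs x < 1 ->
  Derive_n (PSeries (fun n => (-1) ^ n * a n)) n (- x) = (-1) ^ n * Derive_n (PSeries a) n x.
Proof.
  intros H Hx. rewrite (Derive_n_ext _ (fun y => PSeries a (- y))) by apply PSeries_reflect.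
  rewrite Derive_n_comp_opp, Ropp_involutive; auto.
  assert (Hd : 0 < 1 - Rabs x) by lra. rewrite Ropp_involutive.
  exists (mkposreal _ Hd). intros y Hy k _. apply ex_derive_n_PSeries, H.
  assert (Rabs (y - x) < 1 - Rabs x) by exact Hy. pose proof (Rabs_triang_inv y x). lra.
Qed.

(** If every derivative vanished at s, the reflected series would be flat at -s, which forces a(0) =
    0. *)
Lemma disk_finite_order (a : nat -> R) (s : R) :
  disk a -> a 0%nat <> 0 -> 0 < s < 1 ->
  exists n, Derive_n (PSeries a) n s <> 0 /\ forall m, (m < n)%nat -> Derive_n (PSeries a) m s = 0.
Proof.
  intros Ha H0 Hs.
  assert (Hex : exists n, Derive_n (PSeries a) n s <> 0).
  { apply Classical_Prop.NNPP. intro N. apply H0.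
    pose proof (flat_point_zero _ (- s) (disk_reflect a Ha) ltac:(lra)) as F.
    rewrite PSeries_reflect, Ropp_0, PSeries_0 in F. apply F. intro n.
    rewrite Derive_n_reflect by (auto; rewrite Rabs_pos_eq; lra).
    destruct (Req_dec (Derive_n (PSeries a) n s) 0) as [E|E]; [rewrite E; ring|].
    exfalso. apply N. now exists n. }
  destruct Hex as [n Hn].
  revert Hn. induction n as [n IH] using (well_founded_induction Wf_nat.lt_wf). intro Hn.
  destruct (Classical_Prop.classic (exists m, (m < n)%nat /\ Derive_n (PSeries a) m s <> 0)) as [[m [Hm Hm']]|N].
  - now apply (IH m).
  - exists n. split; auto. intros m Hm. destruct (Req_dec (Derive_n (PSeries a) m s) 0) as [|E]; auto.
    exfalso. apply N. now exists m.
Qed.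

(** * Real powers of power series *)

Lemma taylor_right (a : nat -> R) (s t : R) (n : nat) :
  disk a -> 0 < s < 1 -> 0 < t < 1 - s -> (forall m, (m < n)%nat -> Derive_n (PSeries a) m s = 0) ->
  exists z, Rabs (z - s) <= t /\ PSeries a (s + t) = t ^ n / INR (fact n) * Derive_n (PSeries a) n z.
Proof.
  intros Ha Hs Ht H. destruct n as [|n].
  - exists (s + t). split; [rewrite Rabs_pos_eq; lra|]. simpl. field.
  - destruct (Taylor_Lagrange (PSeries a) n s (s + t)) as [z [Hz E]]; [lra| |].
    + intros u Hu k _. apply ex_derive_n_PSeries, Ha. rewrite Rabs_pos_eq; lra.
    + exists z. split; [rewrite Rabs_pos_eq; lra|]. rewrite E.
      rewrite (sum_eq_R0 _ n) by (intros m Hm; rewrite H by lia; ring).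
      replace (s + t - s) with t by ring. ring.
Qed.

Lemma taylor_left (a : nat -> R) (s t : R) (n : nat) :
  disk a -> 0 < s < 1 -> 0 < t < s -> (forall m, (m < n)%nat -> Derive_n (PSeries a) m s = 0) ->
  exists z, Rabs (z - s) <= t /\ PSeries a (s - t) = t ^ n / INR (fact n) * ((-1) ^ n * Derive_n (PSeries a) n z).
Proof.
  intros Ha Hs Ht H. destruct n as [|n].
  - exists (s - t). split; [rewrite Rabs_left1; lra|]. simpl. field.
  - set (b := fun n => (-1) ^ n * a n).
    assert (Hb : disk b) by now apply disk_reflect.
    destruct (Taylor_Lagrange (PSeries b) n (- s) (- s + t)) as [z [Hz E]]; [lra| |].
    + intros u Hu k _. apply ex_derive_n_PSeries, Hb. rewrite Rabs_left1; lra.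
    + exists (- z). split; [apply Rabs_le; lra|].
      unfold b in E at 1. rewrite PSeries_reflect in E.
      replace (- (- s + t)) with (s - t) in E by ring. rewrite E.
      rewrite (sum_eq_R0 _ n).
      2:{ intros m Hm. unfold b. rewrite Derive_n_reflect, H by (auto; try lia; rewrite Rabs_pos_eq; lra). ring. }
      replace (- s + t - - s) with t by ring. rewrite <- (Ropp_involutive z) at 1.
      unfold b. rewrite Derive_n_reflect by (auto; rewrite Rabs_pos_eq; lra). ring.
Qed.

(** If n is the order at s, the values at s + t and s - t are, up to sign, t^n / n! times the n-th
    derivative at points near s, which is close to its nonzero value at s. Nonnegativity of the
    series permits passing to absolute values, so the ratio tends to 1 whether or not s is a
    zero. *)
Lemma disk_symmetric_ratio (a : nat -> R) (s eps : R) :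
  disk a -> a 0%nat <> 0 -> 0 < s < 1 -> (forall r, 0 <= r < 1 -> 0 <= PSeries a r) -> 0 < eps ->
  exists eta, 0 < eta /\ eta < s /\ eta < 1 - s /\ forall t, 0 < t < eta ->
    0 < PSeries a (s + t) /\ 0 < PSeries a (s - t) /\
    Rabs (PSeries a (s + t) / PSeries a (s - t) - 1) < eps.
Proof.
  intros Ha H0 Hs Hp He. destruct (disk_finite_order a s Ha H0 Hs) as [n [Hn Hm]].
  set (D := Derive_n (PSeries a) n) in *. set (A := Rabs (D s)).
  assert (HA : 0 < A) by now apply Rabs_pos_lt.
  assert (HDc : continuous D s).
  { apply (continuous_ext_loc _ (PSeries (PS_derive_n n a))).
    - assert (Hd : 0 < 1 - s) by lra. exists (mkposreal _ Hd). intros y Hy.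
      symmetry. apply Derive_n_PSeries, Ha. assert (Hy' : Rabs (y - s) < 1 - s) by exact Hy.
      pose proof (Rabs_triang_inv y s). rewrite (Rabs_pos_eq s) in H; lra.
    - apply continuity_pt_filterlim, PSeries_continuity. rewrite CV_radius_derive_n.
      apply Ha. rewrite Rabs_pos_eq; lra. }
  (* tau <= 1/2 keeps the n-th derivative above A/2 in modulus, and tau <= eps/8 then makes the
     ratio differ from 1 by less than eps. *)
  set (tau := Rmin (1 / 2) (eps / 8)).
  assert (Htau : 0 < tau) by (apply Rmin_glb_lt; lra).
  assert (Htau1 : tau <= 1 / 2) by apply Rmin_l. assert (Htau2 : tau <= eps / 8) by apply Rmin_r.
  destruct (continuous_R_elim D s (A * tau) HDc) as [d [Hd HD]]; [nra|].
  set (eta := Rmin d (Rmin (s / 2) ((1 - s) / 2))).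
  assert (E1 : 0 < eta) by (repeat apply Rmin_glb_lt; lra).
  assert (E2 : eta <= d) by apply Rmin_l.
  assert (E3 : eta <= s / 2) by (eapply Rle_trans; [apply Rmin_r|apply Rmin_l]).
  assert (E4 : eta <= (1 - s) / 2) by (eapply Rle_trans; [apply Rmin_r|apply Rmin_r]).
  exists eta. repeat split; try lra.
  - destruct (taylor_right a s t n Ha Hs ltac:(lra) Hm) as [z [Hz E]].
    specialize (Hp (s + t) ltac:(lra)). destruct Hp as [Hp|Hp]; auto. exfalso.
    rewrite E in Hp. symmetry in Hp. apply Rmult_integral in Hp.
    assert (Hc : 0 < t ^ n / INR (fact n)) by (apply Rdiv_lt_0_compat; [apply pow_lt; lra|apply INR_fact_pos]).
    destruct Hp as [Hp|Hp]; [lra|]. specialize (HD z ltac:(lra)). fold D in Hp. rewrite Hp in HD.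
    rewrite Rminus_0_l, Rabs_Ropp in HD. fold A in HD. nra.
  - destruct (taylor_left a s t n Ha Hs ltac:(lra) Hm) as [z [Hz E]].
    specialize (Hp (s - t) ltac:(lra)). destruct Hp as [Hp|Hp]; auto. exfalso.
    rewrite E in Hp. symmetry in Hp. apply Rmult_integral in Hp.
    assert (Hc : 0 < t ^ n / INR (fact n)) by (apply Rdiv_lt_0_compat; [apply pow_lt; lra|apply INR_fact_pos]).
    destruct Hp as [Hp|Hp]; [lra|]. apply Rmult_integral in Hp.
    destruct Hp as [Hp|Hp]; [revert Hp; apply pow_nonzero; lra|].
    specialize (HD z ltac:(lra)). fold D in Hp. rewrite Hp in HD.
    rewrite Rminus_0_l, Rabs_Ropp in HD. fold A in HD. nra.
  - destruct (taylor_right a s t n Ha Hs ltac:(lra) Hm) as [z [Hz E]].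
    destruct (taylor_left a s t n Ha Hs ltac:(lra) Hm) as [w [Hw F]].
    set (c := t ^ n / INR (fact n)) in *. fold D in E, F.
    assert (Hc : 0 < c) by (apply Rdiv_lt_0_compat; [apply pow_lt; lra|apply INR_fact_pos]).
    pose proof (HD z ltac:(lra)) as Dz. pose proof (HD w ltac:(lra)) as Dw.
    assert (P1 : PSeries a (s + t) = c * Rabs (D z)).
    { rewrite <- (Rabs_pos_eq (PSeries a (s + t))) by (apply Hp; lra).
      rewrite E, Rabs_mult, (Rabs_pos_eq c); lra. }
    assert (P2 : PSeries a (s - t) = c * Rabs (D w)).
    { rewrite <- (Rabs_pos_eq (PSeries a (s - t))) by (apply Hp; lra).
      rewrite F, !Rabs_mult, pow_1_abs, (Rabs_pos_eq c); lra. }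
    rewrite P1, P2.
    assert (Bz : Rabs (Rabs (D z) - A) < A * tau).
    { eapply Rle_lt_trans; [apply Rabs_triang_inv2|exact Dz]. }
    assert (Bw : Rabs (Rabs (D w) - A) < A * tau).
    { eapply Rle_lt_trans; [apply Rabs_triang_inv2|exact Dw]. }
    apply Rabs_def2 in Bz. apply Rabs_def2 in Bw.
    assert (Hw0 : A / 2 < Rabs (D w)) by nra.
    replace (c * Rabs (D z) / (c * Rabs (D w)) - 1) with ((Rabs (D z) - Rabs (D w)) / Rabs (D w))
      by (field; split; lra).
    unfold Rdiv. rewrite Rabs_mult, Rabs_inv, Rabs_Rabsolu.
    apply Rmult_lt_reg_r with (Rabs (D w)); [lra|]. rewrite Rmult_assoc, Rinv_l, Rmult_1_r by lra.
    apply Rle_lt_trans with (2 * (A * tau)).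
    + apply Rabs_le. lra.
    + nra.
Qed.

(** The equation says exactly that h k^(-alpha) has derivative zero. *)
Lemma power_ode_invariant (h k : R -> R) (h' k' : R -> R) (alpha x y : R) :
  x <= y ->
  (forall r, x <= r <= y -> is_derive h r (h' r) /\ is_derive k r (k' r) /\ 0 < k r /\
     h' r * k r = alpha * h r * k' r) ->
  h x * exp (- alpha * ln (k x)) = h y * exp (- alpha * ln (k y)).
Proof.
  intros Hxy H. destruct (Req_dec x y) as [->|N]; auto.
  apply (eq_is_derive (fun r => h r * exp (- alpha * ln (k r)))); [|lra].
  intros t Ht. destruct (H t Ht) as [H1 [H2 [H3 H4]]].
  assert (D2 : is_derive (fun r => exp (- alpha * ln (k r))) t
     (- alpha * (k' t / k t) * exp (- alpha * ln (k t)))).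
  { pose proof (is_derive_unique _ _ _ H2) as E.
    auto_derive.
    - split; [now exists (k' t)|auto].
    - replace (Derive (fun x0 => k x0) t) with (k' t) by (symmetry; exact E). field. lra. }
  pose proof (is_derive_mult _ _ _ _ _ H1 D2 Rmult_comm) as D.
  match type of D with is_derive _ _ ?v => replace (@zero R_NormedModule) with v; [exact D|] end.
  unfold plus, mult, zero; simpl.
  transitivity ((h' t * k t - alpha * h t * k' t) / k t * exp (- alpha * ln (k t))); [field; lra|].
  rewrite H4. field. lra.
Qed.

(** The quotient phi = h k^(-alpha) equals 1 at 0, and a supremum argument carries this to r1.
    [Hloc] extends phi = 1 beyond any s: where k(s) > 0 by constancy of phi, at a zero of k by
    comparing the two sides of s. *)
Lemma power_ode_PSeries (eta kappa : nat -> R) (alpha r1 : R) :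
  disk eta -> disk kappa -> eta 0%nat = 1 -> kappa 0%nat = 1 ->
  (forall r, 0 <= r < 1 -> 0 <= PSeries eta r) -> (forall r, 0 <= r < 1 -> 0 <= PSeries kappa r) ->
  (forall r, 0 < r < 1 -> Derive (PSeries eta) r * PSeries kappa r =
                          alpha * PSeries eta r * Derive (PSeries kappa) r) ->
  0 < r1 < 1 -> 0 < PSeries kappa r1 ->
  PSeries eta r1 * exp (- alpha * ln (PSeries kappa r1)) = 1.
Proof.
  intros Hde Hdk He0 Hk0 Hep Hkp Hode Hr1 Hkr1.
  set (h := PSeries eta) in *. set (k := PSeries kappa) in *.
  set (phi := fun r => h r * exp (- alpha * ln (k r))).
  assert (Hinv : forall x y, 0 < x -> x <= y -> y < 1 -> (forall r, x <= r <= y -> 0 < k r) -> phi x = phi y).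
  { intros x y Hx Hxy Hy Hk. apply (power_ode_invariant h k (Derive h) (Derive k)); auto.
    intros r Hr. assert (Rabs r < 1) by (rewrite Rabs_pos_eq; lra).
    split; [now apply disk_is_derive|]. split; [now apply disk_is_derive|]. split; [now apply Hk|apply Hode; lra]. }
  assert (Hphic : forall x, 0 <= x < 1 -> 0 < k x -> continuous phi x).
  { intros x Hx Hkx. assert (Hx' : Rabs x < 1) by (rewrite Rabs_pos_eq; lra).
    apply (continuous_mult (K := R_AbsRing) h (fun r => exp (- alpha * ln (k r)))).
    - now apply disk_continuous.
    - apply (continuous_comp (fun r => - alpha * ln (k r)) exp).
      + apply (continuous_scal_r (V := R_NormedModule) (- alpha) (fun r => ln (k r))).
        apply (continuous_comp k ln); [now apply disk_continuous|].
        apply continuity_pt_filterlim, derivable_continuous_pt. exists (/ k x). now apply derivable_pt_lim_ln.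
      + apply continuity_pt_filterlim, derivable_continuous_pt, derivable_pt_exp. }
  assert (Hkpos_near : forall x, 0 <= x < 1 -> 0 < k x ->
     exists d, 0 < d /\ d <= 1 - x /\ forall y, 0 <= y -> Rabs (y - x) < d -> 0 < k y).
  { intros x Hx Hkx. destruct (continuous_R_elim k x (k x)) as [d [Hd H]]; auto.
    - apply disk_continuous; auto. rewrite Rabs_pos_eq; lra.
    - exists (Rmin d (1 - x)). split; [apply Rmin_glb_lt; lra|]. split; [apply Rmin_r|].
      intros y _ Hy. pose proof (Rmin_l d (1 - x)). specialize (H y ltac:(lra)). apply Rabs_def2 in H. lra. }
  assert (Hloc : forall s, 0 <= s < 1 ->
     (forall t, 0 <= t < s -> 0 < k t -> phi t = 1) ->
     exists d, 0 < d /\ d <= 1 - s /\ forall t, s <= t < s + d -> 0 < k t -> phi t = 1).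
  { intros s Hs Hleft. destruct (Rle_lt_or_eq_dec 0 (k s) (Hkp s Hs)) as [Hks|Hks].
    - destruct (Hkpos_near s Hs Hks) as [d [Hd [Hd1 Hd2]]].
      exists d. repeat split; auto. intros t Ht Hkt.
      assert (Hphis : phi s = 1).
      { destruct (Req_dec s 0) as [->|Ns].
        - unfold phi, h, k. rewrite !PSeries_0, He0, Hk0, ln_1, Rmult_0_r, exp_0. ring.
        - set (u := Rmax (s / 2) (s - d / 2)).
          assert (s / 2 <= u) by apply Rmax_l. assert (s - d / 2 <= u) by apply Rmax_r.
          assert (u < s) by (apply Rmax_lub_lt; lra).
          assert (Hu : 0 < k u) by (apply Hd2; [lra|rewrite Rabs_left; lra]).
          rewrite <- (Hinv u s); [apply Hleft; lra|lra|lra|lra|].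
          intros r Hr. apply Hd2; [lra|]. apply Rabs_def1; lra. }
      (* The differential equation is available for r > 0 only, so at s = 0 continuity of phi
         replaces the invariance. *)
      destruct (Req_dec s 0) as [Es|Ns].
      + destruct (Req_dec t s) as [->|Nt]; auto.
        apply Rminus_diag_uniq. destruct (Req_dec (phi t - 1) 0) as [|N]; auto. exfalso.
        destruct (continuous_R_elim phi s (Rabs (phi t - 1)) (Hphic s Hs Hks)) as [d' [Hd' H]].
        { now apply Rabs_pos_lt. }
        set (u := Rmin t (s + d' / 2)).
        assert (u <= t) by apply Rmin_l. assert (u <= s + d' / 2) by apply Rmin_r.
        assert (s < u) by (apply Rmin_glb_lt; lra).
        specialize (H u). rewrite (Hinv u t), Hphis in H; try lra.
        * assert (C : Rabs (phi t - 1) < Rabs (phi t - 1)); [|lra]. apply H. rewrite Rabs_pos_eq; lra.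
        * intros r Hr. apply Hd2; [lra|]. apply Rabs_def1; lra.
      + rewrite <- (Hinv s t); auto; try lra. intros r Hr. apply Hd2; [lra|]. apply Rabs_def1; lra.
    - assert (Hs0 : 0 < s).
      { destruct (Req_dec s 0) as [->|]; [|lra]. unfold k in Hks. rewrite PSeries_0, Hk0 in Hks. lra. }
      (* A zero [s] of [k]: compare [phi] at [s - t] and [s + t] as [t] tends to 0. *)
      destruct (disk_symmetric_ratio kappa s 1 Hdk) as [d [Hd [Hd1 [Hd2 Hd3]]]]; auto; try lra.
      fold k in Hd3. exists d. repeat split; try lra. intros t Ht Hkt.
      assert (Hts : s < t) by (destruct (Req_dec t s) as [->|]; lra).
      assert (Hconst : forall u, 0 < u < d -> phi (s + u) = phi t).
      { assert (Hmono : forall x y, s < x -> x <= y -> y < s + d -> phi x = phi y).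
        { intros x y Hx Hxy Hy. apply Hinv; try lra. intros r Hr.
          replace r with (s + (r - s)) by ring. apply Hd3. lra. }
        intros u Hu. destruct (Rle_dec (s + u) t); [apply Hmono; lra|symmetry; apply Hmono; lra]. }
      apply Rminus_diag_uniq. destruct (Req_dec (phi t - 1) 0) as [|N]; auto. exfalso.
      (* z and w are the ratios of h and of k at s + u and s - u. Since phi(s - u) = 1 and phi(s +
         u) = phi(t), their combination z w^(-alpha) is phi(t), while both tend to 1. *)
      assert (Hlim : forall eps, 0 < eps -> exists z w, Rabs (z - 1) < eps /\ Rabs (w - 1) < eps /\ 0 < w /\
                phi t = z * exp (- alpha * ln w)).
      { intros eps Heps.
        destruct (disk_symmetric_ratio eta s eps Hde) as [d1 [A1 [A2 [A3 A4]]]]; auto; try lra.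
        destruct (disk_symmetric_ratio kappa s eps Hdk) as [d2 [B1 [B2 [B3 B4]]]]; auto; try lra.
        fold h in A4. fold k in B4.
        set (u := Rmin d (Rmin d1 d2) / 2).
        assert (0 < Rmin d (Rmin d1 d2)) by (repeat apply Rmin_glb_lt; lra).
        assert (Rmin d (Rmin d1 d2) <= d) by apply Rmin_l.
        assert (Rmin d (Rmin d1 d2) <= d1) by (eapply Rle_trans; [apply Rmin_r|apply Rmin_l]).
        assert (Rmin d (Rmin d1 d2) <= d2) by (eapply Rle_trans; [apply Rmin_r|apply Rmin_r]).
        assert (0 < u) by (unfold u; lra).
        destruct (A4 u ltac:(unfold u in *; lra)) as [C1 [C2 C3]].
        destruct (B4 u ltac:(unfold u in *; lra)) as [D1 [D2 D3]].
        exists (h (s + u) / h (s - u)), (k (s + u) / k (s - u)). repeat split; auto.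
        - now apply Rdiv_lt_0_compat.
        - rewrite <- (Hconst u) by (unfold u in *; lra).
          assert (L : phi (s - u) = 1) by (apply Hleft; unfold u in *; lra).
          unfold phi in *. unfold Rdiv at 2. rewrite ln_mult, ln_Rinv by (auto; now apply Rinv_0_lt_compat).
          replace (- alpha * (ln (k (s + u)) + - ln (k (s - u))))
            with (- alpha * ln (k (s + u)) + - (- alpha * ln (k (s - u)))) by ring.
          rewrite exp_plus, exp_Ropp.
          assert (0 < exp (- alpha * ln (k (s - u)))) by apply exp_pos.
          transitivity (h (s + u) * exp (- alpha * ln (k (s + u))) / (h (s - u) * exp (- alpha * ln (k (s - u))))).
          + rewrite L. field.
          + field. split; lra. }
      assert (Hc : continuous (fun w => exp (- alpha * ln w)) 1).
      { apply (ex_derive_continuous (V := R_NormedModule)). auto_derive. lra. }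
      set (g := fun w => exp (- alpha * ln w)) in *.
      assert (Hg1 : g 1 = 1) by (unfold g; rewrite ln_1, Rmult_0_r; apply exp_0).
      (* With z and w^(-alpha) within e <= 1 of 1, their product is within e^2 + 2e <= 3e of 1, less
         than |phi(t) - 1|. *)
      set (e := Rmin 1 (Rabs (phi t - 1) / 4)).
      assert (He : 0 < e) by (apply Rmin_glb_lt; [lra|]; pose proof (Rabs_pos_lt _ N); lra).
      assert (He1 : e <= 1) by apply Rmin_l.
      assert (He2 : e <= Rabs (phi t - 1) / 4) by apply Rmin_r.
      destruct (continuous_R_elim g 1 e Hc He) as [d3 [Hd4 Hd5]].
      destruct (Hlim (Rmin e d3)) as [z [w [Z1 [Z2 [Z3 Z4]]]]]; [now apply Rmin_glb_lt|].
      pose proof (Rmin_l e d3). pose proof (Rmin_r e d3).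
      specialize (Hd5 w ltac:(lra)). rewrite Hg1 in Hd5. change (exp (- alpha * ln w)) with (g w) in Z4.
      assert (Z1' : Rabs (z - 1) < e) by lra.
      assert (Rabs (phi t - 1) < 3 * e).
      { rewrite Z4. replace (z * g w - 1) with ((z - 1) * (g w - 1) + (z - 1) + (g w - 1)) by ring.
        eapply Rle_lt_trans; [apply Rabs_triang|]. eapply Rle_lt_trans; [apply Rplus_le_compat_r, Rabs_triang|].
        rewrite Rabs_mult. pose proof (Rabs_pos (z - 1)). pose proof (Rabs_pos (g w - 1)). nra. }
      pose proof (Rabs_pos_lt _ N). lra. }
  change (phi r1 = 1).
  destruct (completeness (fun r => 0 <= r <= r1 /\ forall t, 0 <= t <= r -> 0 < k t -> phi t = 1)) as [s [Hub Hlub]].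
  - exists r1. intros r [Hr _]. lra.
  - exists 0. split; [lra|]. intros t Ht _. replace t with 0 by lra.
    unfold phi, h, k. rewrite !PSeries_0, He0, Hk0, ln_1, Rmult_0_r, exp_0. ring.
  - assert (Hs1 : s <= r1) by (apply Hlub; intros r [Hr _]; lra).
    assert (Hs0 : 0 <= s).
    { apply Hub. split; [lra|]. intros t Ht _. replace t with 0 by lra.
      unfold phi, h, k. rewrite !PSeries_0, He0, Hk0, ln_1, Rmult_0_r, exp_0. ring. }
    assert (Hbelow : forall t, 0 <= t < s -> 0 < k t -> phi t = 1).
    { intros t Ht Hkt. apply Classical_Prop.NNPP. intro N.
      assert (s <= t); [|lra]. apply Hlub. intros r [Hr1' Hr2]. apply Rnot_lt_le. intro L.
      apply N, Hr2; auto; lra. }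
    destruct (Hloc s ltac:(lra) Hbelow) as [d [Hd [Hd1 Hd2]]].
    assert (Hext : forall t, 0 <= t < s + d -> 0 < k t -> phi t = 1).
    { intros t Ht Hkt. destruct (Rlt_dec t s); [apply Hbelow|apply Hd2]; auto; lra. }
    destruct (Rlt_dec r1 (s + d)) as [L|L]; [apply Hext; auto; lra|].
    assert (s + d / 2 <= s); [|lra]. apply Hub. split; [lra|].
    intros t Ht. apply Hext. lra.
Qed.

(** p(r e^(i phi)) is [PSeries (ray_re p phi) r] + i [PSeries (ray_im p phi) r], so complex values
    of p on a ray are pairs of real power series in r. *)
Definition ray_re (p : nat -> R) (phi : R) (n : nat) : R := p n * cos (INR n * phi).
Definition ray_im (p : nat -> R) (phi : R) (n : nat) : R := p n * sin (INR n * phi).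

Lemma Rabs_cos_le (x : R) : Rabs (cos x) <= 1.
Proof. pose proof (COS_bound x). apply Rabs_le; lra. Qed.

Lemma Rabs_sin_le_1 (x : R) : Rabs (sin x) <= 1.
Proof. pose proof (SIN_bound x). apply Rabs_le; lra. Qed.

Lemma ray_re_abs (p : nat -> R) (phi : R) (n : nat) : Rabs (ray_re p phi n) <= Rabs (p n).
Proof.
  unfold ray_re. rewrite Rabs_mult. pose proof (Rabs_cos_le (INR n * phi)).
  pose proof (Rabs_pos (p n)). nra.
Qed.

Lemma ray_im_abs (p : nat -> R) (phi : R) (n : nat) : Rabs (ray_im p phi n) <= Rabs (p n).
Proof.
  unfold ray_im. rewrite Rabs_mult. pose proof (Rabs_sin_le_1 (INR n * phi)).
  pose proof (Rabs_pos (p n)). nra.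
Qed.

Lemma disk_ray (p : nat -> R) (phi : R) : disk p -> disk (ray_re p phi) /\ disk (ray_im p phi).
Proof.
  intros H. split; apply (disk_le _ p H); intro n; [apply ray_re_abs|apply ray_im_abs].
Qed.

Lemma sum_f_R0_lin (f g : nat -> R) (u v : R) (n : nat) :
  u * sum_f_R0 f n + v * sum_f_R0 g n = sum_f_R0 (fun k => u * f k + v * g k) n.
Proof. induction n as [|n IH]; simpl; [ring|]. rewrite <- IH. ring. Qed.

(** e^(i n phi) = e^(i k phi) e^(i (n-k) phi) in each term of the Cauchy product. The explicit
    factors 1 and -1 fit [disk_lin] and [PSeries_lin]. *)
Lemma ray_mult_coeff (p q : nat -> R) (phi : R) (n : nat) :
  ray_re (PS_mult p q) phi n =
    1 * PS_mult (ray_re p phi) (ray_re q phi) n + (-1) * PS_mult (ray_im p phi) (ray_im q phi) n /\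
  ray_im (PS_mult p q) phi n =
    1 * PS_mult (ray_re p phi) (ray_im q phi) n + 1 * PS_mult (ray_im p phi) (ray_re q phi) n.
Proof.
  unfold ray_re, ray_im, PS_mult. rewrite !sum_f_R0_lin, !(Rmult_comm (sum_f_R0 _ n)), !scal_sum.
  assert (E : forall k, (k <= n)%nat -> INR n * phi = INR k * phi + INR (n - k) * phi).
  { intros k Hk. rewrite <- Rmult_plus_distr_r, <- plus_INR. do 2 f_equal. lia. }
  split; apply sum_eq; intros k Hk; rewrite (E k Hk); [rewrite cos_plus|rewrite sin_plus]; ring.
Qed.

Lemma ray_mult (p q : nat -> R) (phi r : R) :
  disk p -> disk q -> Rabs r < 1 ->
  PSeries (ray_re (PS_mult p q) phi) r =
    PSeries (ray_re p phi) r * PSeries (ray_re q phi) r - PSeries (ray_im p phi) r * PSeries (ray_im q phi) r /\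
  PSeries (ray_im (PS_mult p q) phi) r =
    PSeries (ray_re p phi) r * PSeries (ray_im q phi) r + PSeries (ray_im p phi) r * PSeries (ray_re q phi) r.
Proof.
  intros Hp Hq Hr. destruct (disk_ray p phi Hp) as [P1 P2]. destruct (disk_ray q phi Hq) as [Q1 Q2].
  rewrite (PSeries_ext _ _ r (fun n => proj1 (ray_mult_coeff p q phi n))).
  rewrite (PSeries_ext _ _ r (fun n => proj2 (ray_mult_coeff p q phi n))).
  rewrite !PSeries_lin by (auto using disk_mult).
  rewrite !PSeries_mult by (auto; now apply P1 || now apply P2 || now apply Q1 || now apply Q2).
  split; ring.
Qed.

Lemma ray_euler (p : nat -> R) (phi : R) (n : nat) :
  ray_re (euler p) phi n = euler (ray_re p phi) n /\ ray_im (euler p) phi n = euler (ray_im p phi) n.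
Proof. unfold ray_re, ray_im, euler. split; ring. Qed.

(** The coefficients in r of |p(r e^(i phi))|^2. As a power series it admits the finite-order
    argument at its zeros. *)
Definition sq_mod (p : nat -> R) (phi : R) (n : nat) : R :=
  1 * PS_mult (ray_re p phi) (ray_re p phi) n + 1 * PS_mult (ray_im p phi) (ray_im p phi) n.

Lemma disk_sq_mod (p : nat -> R) (phi : R) : disk p -> disk (sq_mod p phi).
Proof.
  intros H. destruct (disk_ray p phi H). apply disk_lin; now apply disk_mult.
Qed.

Lemma PSeries_sq_mod (p : nat -> R) (phi r : R) :
  disk p -> Rabs r < 1 ->
  PSeries (sq_mod p phi) r = PSeries (ray_re p phi) r ^ 2 + PSeries (ray_im p phi) r ^ 2.
Proof.
  intros H Hr. destruct (disk_ray p phi H) as [P1 P2]. unfold sq_mod.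
  rewrite PSeries_lin by (auto using disk_mult).
  rewrite !PSeries_mult by (auto; now apply P1 || now apply P2). ring.
Qed.

Lemma sq_mod_0 (p : nat -> R) (phi : R) : p 0%nat = 1 -> sq_mod p phi 0%nat = 1.
Proof.
  intros H. unfold sq_mod, PS_mult, ray_re, ray_im. simpl.
  rewrite !Rmult_0_l, cos_0, sin_0, H. ring.
Qed.

Lemma Derive_sq_mod (p : nat -> R) (phi r : R) :
  disk p -> Rabs r < 1 ->
  r * Derive (PSeries (sq_mod p phi)) r =
    2 * (PSeries (ray_re p phi) r * PSeries (ray_re (euler p) phi) r +
         PSeries (ray_im p phi) r * PSeries (ray_im (euler p) phi) r).
Proof.
  intros H Hr. destruct (disk_ray p phi H) as [P1 P2].
  rewrite (PSeries_ext _ _ r (fun n => proj1 (ray_euler p phi n))).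
  rewrite (PSeries_ext _ _ r (fun n => proj2 (ray_euler p phi n))).
  rewrite !PSeries_euler by auto.
  pose proof (disk_is_derive _ r P1 Hr) as D1. pose proof (disk_is_derive _ r P2 Hr) as D2.
  set (f := PSeries (ray_re p phi)) in *. set (g := PSeries (ray_im p phi)) in *.
  assert (D : is_derive (PSeries (sq_mod p phi)) r (2 * f r * Derive f r + 2 * g r * Derive g r)).
  { apply (is_derive_ext_loc (fun r => f r ^ 2 + g r ^ 2)).
    - assert (Hd : 0 < 1 - Rabs r) by lra. exists (mkposreal _ Hd). intros y Hy.
      assert (Hy' : Rabs (y - r) < 1 - Rabs r) by exact Hy. pose proof (Rabs_triang_inv y r).
      symmetry. apply PSeries_sq_mod; auto. lra.
    - auto_derive.
      + split; [now exists (Derive f r)|]. split; [now exists (Derive g r)|auto].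
      + change (Derive (fun x => f x) r) with (Derive f r). change (Derive (fun x => g x) r) with (Derive g r). ring. }
  rewrite (is_derive_unique _ _ _ D). ring.
Qed.

(* Multiply the identity [(z c') g = alpha c (z g')] on the ray by the conjugate of [c g] and take
   real parts. *)
Lemma sq_mod_ode (c g : nat -> R) (alpha phi r : R) :
  disk c -> disk g -> (forall n, PS_mult (euler c) g n = alpha * PS_mult c (euler g) n) -> 0 < r < 1 ->
  Derive (PSeries (sq_mod c phi)) r * PSeries (sq_mod g phi) r =
    alpha * PSeries (sq_mod c phi) r * Derive (PSeries (sq_mod g phi)) r.
Proof.
  intros Hc Hg HE Hr. assert (Hr' : Rabs r < 1) by (rewrite Rabs_pos_eq; lra).
  assert (Hdc := disk_euler c Hc). assert (Hdg := disk_euler g Hg).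
  destruct (ray_mult (euler c) g phi r Hdc Hg Hr') as [E1 E2].
  destruct (ray_mult c (euler g) phi r Hc Hdg Hr') as [E3 E4].
  assert (E5 : PSeries (ray_re (PS_mult (euler c) g) phi) r = alpha * PSeries (ray_re (PS_mult c (euler g)) phi) r).
  { rewrite <- PSeries_scal. apply PSeries_ext. intro n. unfold ray_re, PS_scal. rewrite HE.
    unfold scal; simpl; unfold mult; simpl. ring. }
  assert (E6 : PSeries (ray_im (PS_mult (euler c) g) phi) r = alpha * PSeries (ray_im (PS_mult c (euler g)) phi) r).
  { rewrite <- PSeries_scal. apply PSeries_ext. intro n. unfold ray_im, PS_scal. rewrite HE.
    unfold scal; simpl; unfold mult; simpl. ring. }
  rewrite E1, E3 in E5. rewrite E2, E4 in E6.
  pose proof (Derive_sq_mod c phi r Hc Hr') as D1. pose proof (Derive_sq_mod g phi r Hg Hr') as D2.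
  apply (Rmult_eq_reg_l r); [|lra].
  rewrite <- Rmult_assoc, D1.
  transitivity (alpha * PSeries (sq_mod c phi) r * (r * Derive (PSeries (sq_mod g phi)) r)); [|ring].
  rewrite D2, !PSeries_sq_mod by auto.
  set (A := PSeries (ray_re c phi) r) in *. set (B := PSeries (ray_im c phi) r) in *.
  set (G := PSeries (ray_re g phi) r) in *. set (H := PSeries (ray_im g phi) r) in *.
  set (P := PSeries (ray_re (euler c) phi) r) in *. set (Q := PSeries (ray_im (euler c) phi) r) in *.
  set (S := PSeries (ray_re (euler g) phi) r) in *. set (T := PSeries (ray_im (euler g) phi) r) in *.
  transitivity (2 * ((A * G - B * H) * (P * G - Q * H) + (A * H + B * G) * (P * H + Q * G))); [ring|].
  rewrite E5, E6. ring.
Qed.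

(** The Cauchy square of the geometric series. *)
Lemma Series_succ_geom (r : R) :
  0 <= r < 1 -> is_series (fun n => INR (S n) * r ^ n) (/ (1 - r) ^ 2).
Proof.
  intros Hr.
  assert (H1 : disk (fun _ => 1)).
  { apply disk_intro. intros x Hx. apply (ex_series_ext (fun n => x ^ n)); [intro; req; ring|].
    apply ex_series_geom. rewrite Rabs_pos_eq; lra. }
  assert (Hr' : Rabs r < 1) by (rewrite Rabs_pos_eq; lra).
  assert (E : forall n, PS_mult (fun _ => 1) (fun _ => 1) n = INR (S n)).
  { intro n. unfold PS_mult. induction n as [|n IH]; [simpl; ring|]. simpl sum_f_R0. 
    rewrite IH, (S_INR (S n)). ring. }
  replace (/ (1 - r) ^ 2) with (Series (fun n => INR (S n) * r ^ n)).
  - apply Series_correct. apply (ex_series_ext (fun n => PS_mult (fun _ => 1) (fun _ => 1) n * r ^ n)).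
    + intro n. now rewrite E.
    + apply disk_ex_series; auto. now apply disk_mult.
  - transitivity (PSeries (PS_mult (fun _ => 1) (fun _ => 1)) r).
    + apply Series_ext. intro n. now rewrite E.
    + rewrite PSeries_mult by now apply H1. unfold PSeries.
      rewrite (Series_ext _ (fun n => r ^ n)) by (intro; ring).
      rewrite Series_geom by auto. field. lra.
Qed.

Lemma PSeries_abs_le_succ (a : nat -> R) (r : R) :
  (forall n, Rabs (a n) <= INR (S n)) -> 0 <= r < 1 -> Rabs (PSeries a r) <= / (1 - r) ^ 2.
Proof.
  intros Ha Hr. pose proof (Series_succ_geom r Hr) as HS. unfold PSeries.
  assert (Hb : forall n, Rabs (a n * r ^ n) <= INR (S n) * r ^ n).
  { intro n. assert (0 <= r ^ n) by (apply pow_le; lra).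
    rewrite Rabs_mult, (Rabs_pos_eq (r ^ n)) by auto. now apply Rmult_le_compat_r. }
  assert (Hex : ex_series (fun n => INR (S n) * r ^ n)) by (eexists; exact HS).
  eapply Rle_trans; [apply Series_Rabs|].
  - apply (ex_series_dominated _ (fun n => INR (S n) * r ^ n)); auto. intro n. now rewrite Rabs_Rabsolu.
  - rewrite <- (is_series_unique _ _ HS). apply Series_le; auto.
    intro n. split; [apply Rabs_pos|auto].
Qed.

(** |c|^2 = (|g|^2)^alpha is at most max(1, |g|^2) because 0 < alpha <= 1. The real and imaginary
    parts of g are each at most (1 - r)^(-2), whence the factor 2. *)
Lemma ray_bound (c g : nat -> R) (alpha phi r : R) :
  disk c -> disk g -> c 0%nat = 1 -> g 0%nat = 1 -> 0 < alpha <= 1 ->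
  (forall n, PS_mult (euler c) g n = alpha * PS_mult c (euler g) n) ->
  (forall n, Rabs (g n) <= INR (S n)) -> 0 < r < 1 ->
  PSeries (sq_mod c phi) r <= 2 * (/ (1 - r) ^ 2) ^ 2.
Proof.
  intros Hc Hg Hc0 Hg0 Hal HE Hgb.
  set (h := PSeries (sq_mod c phi)). set (k := PSeries (sq_mod g phi)).
  assert (Hhp : forall r, 0 <= r < 1 -> 0 <= h r).
  { intros x Hx. unfold h. rewrite PSeries_sq_mod by (auto; rewrite Rabs_pos_eq; lra).
    pose proof (pow2_ge_0 (PSeries (ray_re c phi) x)). pose proof (pow2_ge_0 (PSeries (ray_im c phi) x)). lra. }
  assert (Hkp : forall r, 0 <= r < 1 -> 0 <= k r).
  { intros x Hx. unfold k. rewrite PSeries_sq_mod by (auto; rewrite Rabs_pos_eq; lra).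
    pose proof (pow2_ge_0 (PSeries (ray_re g phi) x)). pose proof (pow2_ge_0 (PSeries (ray_im g phi) x)). lra. }
  assert (HS1 : forall x, 0 <= x < 1 -> 1 <= / (1 - x) ^ 2).
  { intros x Hx. rewrite <- Rinv_1. apply Rinv_le_contravar; [apply pow_lt; lra|]. nra. }
  assert (Hkb : forall x, 0 <= x < 1 -> k x <= 2 * (/ (1 - x) ^ 2) ^ 2).
  { intros x Hx. unfold k. rewrite PSeries_sq_mod by (auto; rewrite Rabs_pos_eq; lra).
    assert (B1 : Rabs (PSeries (ray_re g phi) x) <= / (1 - x) ^ 2).
    { apply PSeries_abs_le_succ; auto. intro n. eapply Rle_trans; [apply ray_re_abs|auto]. }
    assert (B2 : Rabs (PSeries (ray_im g phi) x) <= / (1 - x) ^ 2).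
    { apply PSeries_abs_le_succ; auto. intro n. eapply Rle_trans; [apply ray_im_abs|auto]. }
    rewrite <- (pow2_abs (PSeries (ray_re _ _) x)), <- (pow2_abs (PSeries (ray_im _ _) x)).
    pose proof (pow_incr _ _ 2 (conj (Rabs_pos _) B1)). pose proof (pow_incr _ _ 2 (conj (Rabs_pos _) B2)). lra. }
  assert (Hpos : forall x, 0 < x < 1 -> 0 < k x -> h x <= 2 * (/ (1 - x) ^ 2) ^ 2).
  { intros x Hx Hkx.
    pose proof (power_ode_PSeries (sq_mod c phi) (sq_mod g phi) alpha x
      (disk_sq_mod c phi Hc) (disk_sq_mod g phi Hg) (sq_mod_0 c phi Hc0) (sq_mod_0 g phi Hg0) Hhp Hkp
      (fun r Hr => sq_mod_ode c g alpha phi r Hc Hg HE Hr) Hx Hkx) as E.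
    fold h k in E.
    assert (E2 : h x = exp (alpha * ln (k x))).
    { apply (Rmult_eq_reg_r (exp (- alpha * ln (k x)))); [|apply Rgt_not_eq, exp_pos].
      rewrite E, <- exp_plus. replace (alpha * ln (k x) + - alpha * ln (k x)) with 0 by ring.
      now rewrite exp_0. }
    specialize (Hkb x ltac:(lra)). specialize (HS1 x ltac:(lra)).
    assert (1 <= 2 * (/ (1 - x) ^ 2) ^ 2) by nra.
    rewrite E2. destruct (Rle_dec (ln (k x)) 0) as [L|L].
    - apply Rle_trans with (exp 0); [apply exp_le; nra|rewrite exp_0; lra].
    - apply Rle_trans with (exp (ln (k x))); [apply exp_le; nra|rewrite exp_ln; lra]. }
  intros Hr. destruct (Rle_lt_or_eq_dec 0 (k r) (Hkp r ltac:(lra))) as [L|L]; [now apply Hpos|].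
  (* At a zero of [k], approach r from the left through points where [k] is positive. *)
  assert (Hk0 : sq_mod g phi 0%nat <> 0) by (rewrite sq_mod_0; auto; lra).
  destruct (disk_symmetric_ratio (sq_mod g phi) r 1 (disk_sq_mod g phi Hg) Hk0 Hr Hkp Rlt_0_1)
    as [d [Hd [Hd1 [Hd2 Hd3]]]].
  apply Rnot_lt_le. intro N. set (K := 2 * (/ (1 - r) ^ 2) ^ 2) in *.
  assert (Hhc : continuous h r).
  { apply disk_continuous; [now apply disk_sq_mod|rewrite Rabs_pos_eq; lra]. }
  destruct (continuous_R_elim h r (h r - K) Hhc) as [d' [Hd' H]]; [lra|].
  set (t := Rmin d d' / 2). assert (0 < Rmin d d') by now apply Rmin_glb_lt.
  pose proof (Rmin_l d d'). pose proof (Rmin_r d d').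
  assert (Ht : 0 < t < d) by (unfold t; lra).
  specialize (H (r - t)). assert (Rabs (h (r - t) - h r) < h r - K).
  { apply H. replace (r - t - r) with (- t) by ring. rewrite Rabs_Ropp, Rabs_pos_eq; unfold t; lra. }
  specialize (Hpos (r - t) ltac:(lra) (proj1 (proj2 (Hd3 t Ht)))).
  assert (2 * (/ (1 - (r - t)) ^ 2) ^ 2 <= K).
  { unfold K. apply Rmult_le_compat_l; [lra|]. apply pow_incr. split.
    - left. apply Rinv_0_lt_compat, pow_lt. lra.
    - apply Rinv_le_contravar; [apply pow_lt; lra|]. apply pow_incr. lra. }
  apply Rabs_def2 in H3. lra.
Qed.

(** c(m) r^m is the mean over the circle of the real part of c(r e^(i phi)) e^(-i m phi). That real
    part is bounded by |A| + |A'| <= 2B, where A and A' are the two components of c. *)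
Lemma cauchy_coeff_bound (c : nat -> R) (r B : R) (m : nat) :
  disk c -> 0 < r < 1 -> (forall phi, PSeries (sq_mod c phi) r <= B ^ 2) -> 0 <= B ->
  Rabs (c m) * r ^ m <= 2 * B.
Proof.
  intros Hc Hr HB HB0. assert (Hr' : Rabs r < 1) by (rewrite Rabs_pos_eq; lra).
  set (f := fun n phi => c n * r ^ n * cos ((INR n - INR m) * phi)).
  set (M := fun n => Rabs (c n) * r ^ n).
  assert (HM : ex_series M) by (apply disk_abs; auto; lra).
  assert (Hf : forall n phi, Rabs (f n phi) <= M n).
  { intros n phi. unfold f, M. rewrite !Rabs_mult, <- RPow_abs, (Rabs_pos_eq r) by lra.
    pose proof (Rabs_cos_le ((INR n - INR m) * phi)).
    assert (0 <= Rabs (c n) * r ^ n) by (apply Rmult_le_pos; [apply Rabs_pos|apply pow_le; lra]). nra. }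
  assert (Hfc : forall n phi, continuous (f n) phi).
  { intros n phi. apply (ex_derive_continuous (V := R_NormedModule)). unfold f. auto_derive; auto. }
  assert (HTc : forall phi, continuous (fun phi => Series (fun n => f n phi)) phi).
  { intro phi. apply (continuous_Series f M phi 1); auto; lra. }
  assert (Hpi : 0 < PI) by exact PI_RGT_0.
  pose proof (is_series_RInt f M 0 (2 * PI) HM (fun n t _ => Hf n t) (fun n t _ => Hfc n t) (fun t _ => HTc t)) as HS.
  assert (HI : forall n, RInt (f n) 0 (2 * PI) = if Nat.eq_dec n m then 2 * PI * (c m * r ^ m) else 0).
  { intro n. apply is_RInt_unique. destruct (Nat.eq_dec n m) as [->|N].
    - pose (F := fun phi => c m * r ^ m * phi).
      replace (2 * PI * (c m * r ^ m)) with (F (2 * PI) - F 0) by (unfold F; ring).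
      apply (is_RInt_derive F).
      + intros x _. unfold F, f. auto_derive; auto. rewrite Rminus_diag, Rmult_0_l, cos_0. ring.
      + intros; apply Hfc.
    - assert (HN : INR n - INR m <> 0) by (apply Rminus_eq_contra; now apply not_INR).
      pose (F := fun phi => c n * r ^ n * (/ (INR n - INR m) * sin ((INR n - INR m) * phi))).
      replace 0 with (F (2 * PI) - F 0) at 2.
      + apply (is_RInt_derive F).
        * intros x _. unfold F, f. auto_derive; auto. field. exact HN.
        * intros; apply Hfc.
      + unfold F. rewrite Rmult_0_r, sin_0.
        rewrite (sin_eq_0_1 ((INR n - INR m) * (2 * PI))); [ring|].
        exists (2 * (Z.of_nat n - Z.of_nat m))%Z. rewrite mult_IZR, minus_IZR, <- !INR_IZR_INZ. ring. }
  assert (HS2 : is_series (fun n => RInt (f n) 0 (2 * PI)) (2 * PI * (c m * r ^ m))).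
  { pose proof (is_series_single (fun n => RInt (f n) 0 (2 * PI)) m) as S1. cbv beta in S1.
    rewrite (HI m) in S1. destruct (Nat.eq_dec m m) as [_|]; [|lia]. apply S1.
    intros n Hn. rewrite HI. destruct (Nat.eq_dec n m); [lia|auto]. }
  assert (HT : RInt (fun phi => Series (fun n => f n phi)) 0 (2 * PI) = 2 * PI * (c m * r ^ m)).
  { rewrite <- (is_series_unique _ _ HS). apply is_series_unique, HS2. }
  assert (HTb : forall phi, Rabs (Series (fun n => f n phi)) <= 2 * B).
  { intro phi. specialize (HB phi). rewrite PSeries_sq_mod in HB by auto.
    destruct (disk_ray c phi Hc) as [D1 D2].
    assert (E : Series (fun n => f n phi) = cos (INR m * phi) * PSeries (ray_re c phi) r +
                                            sin (INR m * phi) * PSeries (ray_im c phi) r).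
    { unfold PSeries. rewrite <- !Series_scal_l, <- Series_plus.
      - apply Series_ext. intro n. unfold f, ray_re, ray_im.
        rewrite Rmult_minus_distr_r, cos_minus. ring.
      - apply ex_series_Rscal. now apply disk_ex_series.
      - apply ex_series_Rscal. now apply disk_ex_series. }
    set (A := PSeries (ray_re c phi) r) in *. set (A' := PSeries (ray_im c phi) r) in *.
    assert (HA : Rabs A <= B) by (apply Rsqr_incr_0_var; [rewrite <- Rsqr_abs; unfold Rsqr; pose proof (pow2_ge_0 A'); lra|auto]).
    assert (HA' : Rabs A' <= B) by (apply Rsqr_incr_0_var; [rewrite <- Rsqr_abs; unfold Rsqr; pose proof (pow2_ge_0 A); lra|auto]).
    rewrite E. eapply Rle_trans; [apply Rabs_triang|]. rewrite !Rabs_mult.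
    pose proof (Rabs_cos_le (INR m * phi)). pose proof (Rabs_sin_le_1 (INR m * phi)).
    pose proof (Rabs_pos A). pose proof (Rabs_pos A'). nra. }
  assert (HF : Rabs (2 * PI * (c m * r ^ m)) <= (2 * PI - 0) * (2 * B)).
  { rewrite <- HT. apply abs_RInt_le_const; [lra| |auto].
    apply (ex_RInt_continuous (V := R_CompleteNormedModule)). auto. }
  rewrite Rminus_0_r, Rabs_mult, (Rabs_pos_eq (2 * PI)), Rabs_mult, <- RPow_abs, (Rabs_pos_eq r) in HF by lra.
  apply (Rmult_le_reg_l (2 * PI)); lra.
Qed.

(** * Growth of the coefficients *)

Lemma continuous_ln (x : R) : 0 < x -> continuous ln x.
Proof.
  intros Hx. apply continuity_pt_filterlim, derivable_continuous_pt.
  exists (/ x). now apply derivable_pt_lim_ln.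
Qed.

Lemma power_coeff_0 (c g : nat -> R) (alpha : R) :
  disk c -> disk g -> g 0%nat = 1 ->
  (forall z, 0 < z < 1 -> PSeries c z = exp (alpha * ln (PSeries g z))) -> c 0%nat = 1.
Proof.
  intros Hc Hg Hg0 HE.
  assert (H0 : Rabs 0 < 1) by (rewrite Rabs_R0; lra).
  set (f := fun z => exp (alpha * ln (PSeries g z))) in *.
  assert (Hf : continuous f 0).
  { apply (continuous_comp (fun z => alpha * ln (PSeries g z)) exp).
    - apply (continuous_scal_r (V := R_NormedModule) alpha (fun z => ln (PSeries g z))).
      apply (continuous_comp (PSeries g) ln); [now apply disk_continuous|].
      apply continuous_ln. rewrite PSeries_0, Hg0. lra.
    - apply continuity_pt_filterlim, derivable_continuous_pt, derivable_pt_exp. }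
  assert (Hf0 : f 0 = 1) by (unfold f; rewrite PSeries_0, Hg0, ln_1, Rmult_0_r; apply exp_0).
  apply Rminus_diag_uniq. destruct (Req_dec (c 0%nat - 1) 0) as [|N]; auto. exfalso.
  pose proof (Rabs_pos_lt _ N) as Hp.
  destruct (continuous_R_elim f 0 (Rabs (c 0%nat - 1) / 2) Hf) as [d1 [Hd1 H1]]; [lra|].
  destruct (continuous_R_elim (PSeries c) 0 (Rabs (c 0%nat - 1) / 2) (disk_continuous c 0 Hc H0)) as [d2 [Hd2 H2]]; [lra|].
  set (t := Rmin (1 / 2) (Rmin d1 d2 / 2)).
  assert (0 < Rmin d1 d2) by now apply Rmin_glb_lt.
  pose proof (Rmin_l d1 d2). pose proof (Rmin_r d1 d2).
  assert (0 < t) by (apply Rmin_glb_lt; lra). assert (t <= 1 / 2) by apply Rmin_l.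
  assert (t <= Rmin d1 d2 / 2) by apply Rmin_r.
  specialize (H1 t). specialize (H2 t). rewrite Rminus_0_r, Rabs_pos_eq in H1, H2 by lra.
  specialize (H1 ltac:(lra)). specialize (H2 ltac:(lra)).
  rewrite Hf0 in H1. rewrite PSeries_0, HE in H2 by lra. fold (f t) in H2.
  assert (Rabs (c 0%nat - 1) < Rabs (c 0%nat - 1)); [|lra].
  replace (c 0%nat - 1) with ((f t - 1) - (f t - c 0%nat)) at 1 by ring.
  eapply Rle_lt_trans; [apply Rabs_triang|]. rewrite Rabs_Ropp. lra.
Qed.

(* Logarithmic differentiation of [c = g ^ alpha]. *)
Lemma power_coeff_euler (c g : nat -> R) (alpha : R) :
  disk c -> disk g -> (forall z, 0 < z < 1 -> 0 < PSeries g z) ->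
  (forall z, 0 < z < 1 -> PSeries c z = exp (alpha * ln (PSeries g z))) ->
  forall n, PS_mult (euler c) g n = alpha * PS_mult c (euler g) n.
Proof.
  intros Hc Hg Hp HE n.
  assert (Hdc := disk_euler c Hc). assert (Hdg := disk_euler g Hg).
  assert (M1 := disk_mult _ _ Hdc Hg). assert (M2 := disk_mult _ _ Hc Hdg).
  assert (E : 1 * PS_mult (euler c) g n + - alpha * PS_mult c (euler g) n = 0); [|lra].
  apply (PSeries_zero_right n (fun n => 1 * PS_mult (euler c) g n + - alpha * PS_mult c (euler g) n)).
  - now apply disk_lin.
  - intros z Hz. assert (Hz' : Rabs z < 1) by (rewrite Rabs_pos_eq; lra).
    rewrite PSeries_lin by auto.
    rewrite !PSeries_mult by (now apply Hdc || now apply Hg || now apply Hc || now apply Hdg).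
    rewrite !PSeries_euler by auto.
    assert (D : is_derive (PSeries c) z (alpha * (Derive (PSeries g) z / PSeries g z) * PSeries c z)).
    { apply (is_derive_ext_loc (fun z => exp (alpha * ln (PSeries g z)))).
      - assert (Hd : 0 < Rmin z (1 - z)) by (apply Rmin_glb_lt; lra).
        exists (mkposreal _ Hd). intros y Hy. symmetry. apply HE.
        assert (Hy' : Rabs (y - z) < Rmin z (1 - z)) by exact Hy.
        pose proof (Rmin_l z (1 - z)). pose proof (Rmin_r z (1 - z)). apply Rabs_def2 in Hy'. lra.
      - rewrite HE by auto. pose proof (disk_is_derive g z Hg Hz') as Dg.
        auto_derive.
        + split; [now exists (Derive (PSeries g) z)|]. split; [now apply Hp|auto].
        + change (Derive (fun x => PSeries g x) z) with (Derive (PSeries g) z).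
          field. apply Rgt_not_eq, Hp, Hz. }
    rewrite (is_derive_unique _ _ _ D). field. apply Rgt_not_eq, Hp, Hz.
Qed.

(** Cauchy's bound is taken on the larger circle r = sqrt(rho): rho^m = r^m r^m, one factor is used
    up by the bound and the other leaves a geometric series. From 4 (1 - r)^(-3) and 1 - r >= (1 -
    rho)/2 comes 4 * 2^3 = 32. *)
Lemma power_coeff_bound (c g : nat -> R) (alpha rho : R) :
  disk c -> disk g -> g 0%nat = 1 -> (forall n, Rabs (g n) <= INR (S n)) -> 0 < alpha <= 1 ->
  (forall z, 0 < z < 1 -> 0 < PSeries g z) ->
  (forall z, 0 < z < 1 -> PSeries c z = exp (alpha * ln (PSeries g z))) ->
  0 < rho < 1 ->
  Series (fun m => Rabs (c m) * rho ^ m) <= 32 * (/ (1 - rho)) ^ 3.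
Proof.
  intros Hc Hg Hg0 Hgb Hal Hp HE Hrho.
  set (r := sqrt rho).
  assert (Hrr : r * r = rho) by (apply sqrt_sqrt; lra).
  assert (Hr0 : 0 < r) by (apply sqrt_lt_R0; lra).
  assert (Hr : 0 < r < 1) by nra.
  assert (Hir : 0 < / (1 - r)) by (apply Rinv_0_lt_compat; lra).
  assert (Hm : forall m, Rabs (c m) * r ^ m <= 4 * (/ (1 - r)) ^ 2).
  { intro m. replace (4 * (/ (1 - r)) ^ 2) with (2 * (2 * / (1 - r) ^ 2)) by (field; lra).
    apply cauchy_coeff_bound; auto.
    - intro phi. eapply Rle_trans.
      + apply (ray_bound c g alpha phi r); auto.
        * eapply power_coeff_0; eauto.
        * apply power_coeff_euler; auto.
      + pose proof (pow2_ge_0 (/ (1 - r) ^ 2)). rewrite Rpow_mult_distr. lra.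
    - assert (0 < / (1 - r) ^ 2) by (apply Rinv_0_lt_compat, pow_lt; lra). lra. }
  assert (Hge : is_series (fun m => 4 * (/ (1 - r)) ^ 2 * r ^ m) (4 * (/ (1 - r)) ^ 2 * / (1 - r))).
  { apply (is_series_scal (V := R_NormedModule) (4 * (/ (1 - r)) ^ 2)).
    apply is_series_geom. rewrite Rabs_pos_eq; lra. }
  apply Rle_trans with (4 * (/ (1 - r)) ^ 2 * / (1 - r)).
  - rewrite <- (is_series_unique _ _ Hge). apply Series_le; [|eexists; exact Hge].
    intro m. assert (0 < r ^ m) by (now apply pow_lt). split.
    + apply Rmult_le_pos; [apply Rabs_pos|apply pow_le; lra].
    + rewrite <- Hrr, Rpow_mult_distr, <- Rmult_assoc. apply Rmult_le_compat_r; [lra|auto].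
  - replace (4 * (/ (1 - r)) ^ 2 * / (1 - r)) with (4 * (/ (1 - r)) ^ 3) by ring.
    replace (32 * (/ (1 - rho)) ^ 3) with (4 * (2 * / (1 - rho)) ^ 3) by ring.
    apply Rmult_le_compat_l; [lra|]. apply pow_incr. split; [lra|].
    replace (2 * / (1 - rho)) with (/ ((1 - rho) / 2)) by (field; lra).
    apply Rinv_le_contravar; nra.
Qed.

(* [square_coeff] are the coefficients of [sum_n n^delta chi(n) z^(n^2)]. *)
Definition square_coeff (chi : Z -> R) (k : nat) : R :=
  let n := Nat.sqrt k in
  if Nat.eq_dec (n * n) k then INR n ^ delta chi * chi (Z.of_nat n) else 0.

Lemma square_coeff_bound (q : nat) (chi : Z -> R) (k : nat) :
  (1 < q)%nat -> real_dirichlet_character q chi -> Rabs (square_coeff chi k) <= INR k.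
Proof.
  intros Hq H. unfold square_coeff. pose proof (pos_INR k).
  destruct (Nat.eq_dec _ k) as [E|N]; [|rewrite Rabs_R0; auto].
  set (n := Nat.sqrt k) in *. destruct (chi_opp q chi 0 Hq H) as [Hd _].
  destruct n as [|n].
  - change (Z.of_nat 0) with 0%Z. rewrite (chi_0 q chi Hq H), Rmult_0_r, Rabs_R0. auto.
  - pose proof (chi_bound q chi (Z.of_nat (S n)) ltac:(lia) H) as B.
    assert (Hn : 1 <= INR (S n)) by (rewrite S_INR; pose proof (pos_INR n); lra).
    assert (Hk : INR (S n) <= INR k) by (apply le_INR; nia).
    assert (Hpw : 0 <= INR (S n) ^ delta chi <= INR (S n)).
    { destruct (delta chi) as [|[|d]]; [rewrite pow_O; lra|rewrite pow_1; lra|lia]. }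
    rewrite Rabs_mult, (Rabs_pos_eq (_ ^ _)) by lra. pose proof (Rabs_pos (chi (Z.of_nat (S n)))). nra.
Qed.

(** The coefficients of g = theta / (2z) with z = exp(-pi x / q); dividing by z makes the constant
    term chi(1) = 1. *)
Definition theta_coeff (chi : Z -> R) : nat -> R := PS_decr_1 (square_coeff chi).

Lemma theta_coeff_bound (q : nat) (chi : Z -> R) (k : nat) :
  (1 < q)%nat -> real_dirichlet_character q chi -> Rabs (theta_coeff chi k) <= INR (S k).
Proof. intros. now apply (square_coeff_bound q). Qed.

Lemma theta_coeff_0 (q : nat) (chi : Z -> R) : real_dirichlet_character q chi -> theta_coeff chi 0 = 1.
Proof.
  intros H. unfold theta_coeff, PS_decr_1, square_coeff. simpl.
  change (Z.pos 1) with 1%Z. rewrite (chi_1 q chi H), pow1. ring.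
Qed.

Lemma disk_succ (a : nat -> R) : (forall n, Rabs (a n) <= INR (S n)) -> disk a.
Proof.
  intros H. apply disk_intro. intros r Hr.
  apply (ex_series_dominated _ (fun n => INR (S n) * r ^ n)).
  - intro n. assert (0 < r ^ n) by (apply pow_lt; lra).
    rewrite Rabs_mult, (Rabs_pos_eq (r ^ n)) by lra. apply Rmult_le_compat_r; [lra|auto].
  - eexists. apply Series_succ_geom. lra.
Qed.

Lemma sum_squares (f : nat -> R) (b : nat -> R) (N : nat) :
  (forall k, b k = let n := Nat.sqrt k in if Nat.eq_dec (n * n) k then f n else 0) ->
  sum_n b (N * N) = sum_n f N.
Proof.
  intros Hb. induction N as [|N IH].
  - rewrite !sum_O, Hb. reflexivity.
  - rewrite (sum_Sn_R f), <- IH.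
    (* After N^2 come 2N non-squares, where [b] is zero, and then the next square. *)
    rewrite <- !rsum_sum_n. replace (S (S N * S N)) with (S (N * N) + S (2 * N))%nat by lia.
    rewrite rsum_app. f_equal. simpl rsum at 1.
    rewrite (rsum_ext (N + (N + 0)) _ (fun _ => 0)).
    + assert (Z : forall n, rsum n (fun _ => 0) = 0) by (induction n as [|n IHn]; simpl; lra).
      rewrite Z, Rplus_0_l, Hb. cbv zeta.
      replace (S (N * N + (N + (N + 0)))) with (S N * S N)%nat by lia.
      rewrite Nat.sqrt_square. destruct (Nat.eq_dec _ _); [auto|lia].
    + intros k Hk. rewrite Hb. cbv zeta.
      replace (Nat.sqrt _) with N by (symmetry; apply Nat.sqrt_unique; lia).
      destruct (Nat.eq_dec _ _); [lia|auto].
Qed.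

Lemma theta_PSeries (q : nat) (chi : Z -> R) (x : R) :
  (1 < q)%nat -> real_dirichlet_character q chi -> 0 < x ->
  theta q chi x = 2 * (exp (- (PI * x / INR q)) * PSeries (theta_coeff chi) (exp (- (PI * x / INR q)))).
Proof.
  intros Hq H Hx. rewrite (theta_one_sided q chi x Hq H Hx). f_equal.
  pose proof (theta_kappa_pos q x Hq Hx) as Hk. set (z := exp (- (PI * x / INR q))).
  assert (Hz : 0 < z < 1).
  { split; [apply exp_pos|]. unfold z. rewrite <- exp_0. apply exp_increasing. lra. }
  assert (Hzr : Rabs z < 1) by (rewrite Rabs_pos_eq; lra).
  assert (Hd : disk (square_coeff chi)).
  { apply disk_succ. intro n. eapply Rle_trans; [now apply (square_coeff_bound q)|].
    rewrite S_INR. lra. }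
  assert (E0 : square_coeff chi 0 = 0).
  { pose proof (square_coeff_bound q chi 0 Hq H) as B. simpl INR in B.
    pose proof (Rabs_pos (square_coeff chi 0)). apply Rabs_eq_0. lra. }
  transitivity (PSeries (square_coeff chi) z).
  2:{ rewrite PSeries_decr_1 by (now apply ex_pseries_R, disk_ex_series).
      rewrite E0. unfold theta_coeff. ring. }
  set (b := fun k => square_coeff chi k * z ^ k).
  assert (Hb : is_series b (PSeries (square_coeff chi) z)).
  { apply Series_correct. now apply disk_ex_series. }
  apply is_series_unique.
  (* The partial sums of theta are those of the power series at square indices, a subsequence of a
     convergent sequence. *)
  refine (is_lim_seq_ext (fun N => sum_n b (N * N)) _ (Finite (PSeries (square_coeff chi) z)) _ _).
  - intro N. apply sum_squares. intro k. unfold b, square_coeff. cbv zeta.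
    destruct (Nat.eq_dec _ k) as [E|]; [|ring]. unfold theta_term, gauss, z.
    rewrite exp_pow. f_equal. f_equal. rewrite <- E at 1. rewrite mult_INR. ring.
  - apply (is_lim_seq_subseq (sum_n b) _ (fun N => (N * N)%nat)); auto.
    apply eventually_subseq. intro n. lia.
Qed.

Lemma one_minus_exp_neg (u : R) : 0 < u -> / (1 - exp (- u)) <= 1 + 1 / u.
Proof.
  intros Hu. pose proof (exp_ineq1_le u) as B. pose proof (exp_pos u) as P.
  assert (E : exp (- u) <= / (1 + u)).
  { rewrite exp_Ropp. apply Rinv_le_contravar; lra. }
  replace (1 + 1 / u) with (/ (1 - / (1 + u))) by (field; lra).
  apply Rinv_le_contravar; [|lra].
  assert (/ (1 + u) < 1) by (rewrite <- Rinv_1; apply Rinv_lt_contravar; lra). lra.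
Qed.

(* The polynomial growth as x -> 0 is what makes the double series converge: the factor with [1 / x]
   in place of [x] decays exponentially there. *)
Lemma theta_power_coeffs_bound (q : nat) (chi : Z -> R) (alpha : R) (c : nat -> R) :
  (1 < q)%nat -> real_dirichlet_character q chi -> (forall x, 0 < x -> 0 < theta q chi x) ->
  0 < alpha <= 1 -> theta_power_coeffs q chi alpha c ->
  exists K, 0 < K /\ forall x, 0 < x ->
    ex_series (fun m => Rabs (c m * exp (- (PI * (INR m + alpha) * x / INR q)))) /\
    Series (fun m => Rabs (c m * exp (- (PI * (INR m + alpha) * x / INR q)))) <=
      K * (exp (- (PI * alpha / INR q * x)) * (1 + 1 / x) ^ 3).
Proof.
  intros Hq H Hpos Hal Hc.
  assert (HQ : 0 < INR q) by (apply lt_0_INR; lia). assert (Hpi : 0 < PI) by exact PI_RGT_0.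
  set (g := theta_coeff chi).
  assert (Hgb : forall n, Rabs (g n) <= INR (S n)) by (intro; now apply (theta_coeff_bound q)).
  assert (Hg : disk g) by now apply disk_succ.
  assert (Hg0 : g 0%nat = 1) by now apply (theta_coeff_0 q).
  assert (Hzx : forall z, 0 < z < 1 -> exists x, 0 < x /\ z = exp (- (PI * x / INR q))).
  { intros z Hz. exists (- ln z * INR q / PI). split.
    - assert (ln z < 0) by (rewrite <- ln_1; apply ln_increasing; lra).
      apply Rdiv_lt_0_compat; auto. apply Rmult_lt_0_compat; lra.
    - replace (- (PI * (- ln z * INR q / PI) / INR q)) with (ln z) by (field; lra).
      symmetry. apply exp_ln. lra. }
  assert (Hterm : forall x m, exp (- (PI * (INR m + alpha) * x / INR q)) =
            exp (- (PI * alpha / INR q * x)) * exp (- (PI * x / INR q)) ^ m).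
  { intros x m. rewrite exp_pow, <- exp_plus. f_equal. field. lra. }
  assert (Hgpos : forall z, 0 < z < 1 -> 0 < PSeries g z).
  { intros z Hz. destruct (Hzx z Hz) as [x [Hx ->]]. specialize (Hpos x Hx).
    rewrite (theta_PSeries q chi x Hq H Hx) in Hpos. fold g in Hpos.
    pose proof (exp_pos (- (PI * x / INR q))). apply Rnot_le_lt. intro N.
    assert (exp (- (PI * x / INR q)) * PSeries g (exp (- (PI * x / INR q))) <= 0) by nra. lra. }
  (* Every z in (0,1) is exp(-pi x / q) for some x > 0, so convergence of the expansion at all x > 0
     gives radius at least 1. *)
  assert (Hcd : disk c).
  { apply disk_intro. intros z Hz. destruct (Hzx z Hz) as [x [Hx ->]].
    destruct (Hc x Hx) as [Hex _].
    apply (ex_series_ext (fun m => exp (PI * alpha / INR q * x) * (c m * exp (- (PI * (INR m + alpha) * x / INR q))))).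
    - intro m. req. rewrite Hterm, exp_Ropp. field. apply Rgt_not_eq, exp_pos.
    - now apply ex_series_Rscal. }
  (* Cancel 2^alpha and z^alpha from the defining expansion of theta^alpha = (2 z g)^alpha. *)
  assert (HE : forall z, 0 < z < 1 -> PSeries c z = exp (alpha * ln (PSeries g z))).
  { intros z Hz. pose proof (Hgpos z Hz) as Hgz. destruct (Hzx z Hz) as [x [Hx Ez]].
    destruct (Hc x Hx) as [_ E]. rewrite (theta_PSeries q chi x Hq H Hx) in E. fold g in E.
    rewrite <- Ez in E.
    rewrite (Series_ext _ (fun m => exp (- (PI * alpha / INR q * x)) * (c m * z ^ m))) in E
      by (intro m; rewrite Hterm, <- Ez; ring).
    rewrite Series_scal_l in E. fold (PSeries c z) in E.
    unfold Rpower in E. rewrite ln_mult, ln_mult in E by (try lra; nra).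
    rewrite Ez, ln_exp in E. rewrite <- Ez in E.
    rewrite !Rmult_plus_distr_l, !exp_plus in E.
    replace (alpha * - (PI * x / INR q)) with (- (PI * alpha / INR q * x)) in E by (field; lra).
    pose proof (exp_pos (alpha * ln 2)). pose proof (exp_pos (- (PI * alpha / INR q * x))).
    apply (Rmult_eq_reg_l (exp (alpha * ln 2) * exp (- (PI * alpha / INR q * x)))); [|nra].
    rewrite !Rmult_assoc. symmetry. exact E. }
  exists (32 * (1 + INR q / PI) ^ 3).
  assert (HqP : 0 < INR q / PI) by now apply Rdiv_lt_0_compat.
  split; [apply Rmult_lt_0_compat; [lra|apply pow_lt; lra]|].
  intros x Hx. pose proof (theta_kappa_pos q x Hq Hx) as Hk. set (z := exp (- (PI * x / INR q))).
  assert (Hz : 0 < z < 1).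
  { split; [apply exp_pos|]. unfold z. rewrite <- exp_0. apply exp_increasing. lra. }
  set (w := exp (- (PI * alpha / INR q * x))). assert (Hw : 0 < w) by apply exp_pos.
  assert (Habs : forall m, Rabs (c m * exp (- (PI * (INR m + alpha) * x / INR q))) = w * (Rabs (c m) * z ^ m)).
  { intro m. rewrite Hterm. fold z w. assert (0 < z ^ m) by (apply pow_lt; lra).
    rewrite !Rabs_mult, (Rabs_pos_eq w), (Rabs_pos_eq (z ^ m)) by lra. ring. }
  split.
  - apply (ex_series_ext (fun m => w * (Rabs (c m) * z ^ m))); [intro; now rewrite Habs|].
    apply ex_series_Rscal. apply disk_abs; auto; lra.
  - rewrite (Series_ext _ _ Habs), Series_scal_l.
    pose proof (power_coeff_bound c g alpha z Hcd Hg Hg0 Hgb Hal Hgpos HE Hz) as B.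
    replace (32 * (1 + INR q / PI) ^ 3 * (w * (1 + 1 / x) ^ 3))
      with (w * (32 * ((1 + INR q / PI) * (1 + 1 / x)) ^ 3)) by ring.
    apply Rmult_le_compat_l; [lra|]. eapply Rle_trans; [exact B|].
    apply Rmult_le_compat_l; [lra|]. apply pow_incr.
    split; [left; apply Rinv_0_lt_compat; lra|].
    eapply Rle_trans; [apply one_minus_exp_neg; auto|].
    replace (1 / (PI * x / INR q)) with (INR q / PI * (1 / x)) by (field; lra).
    assert (0 < 1 / x) by (apply Rdiv_lt_0_compat; lra). nra.
Qed.

(** * Complex-valued integrals and series *)

Definition is_Cint (f : R -> C) (l : C) : Prop :=
  is_int (fun t => Re (f t)) (Re l) /\ is_int (fun t => Im (f t)) (Im l).

Definition Ccont0 (f : R -> C) : Prop := cont0 (fun t => Re (f t)) /\ cont0 (fun t => Im (f t)).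

Lemma is_Cint_CRInt (f : R -> C) (l : C) : is_Cint f l -> CRInt_0_infty f = l.
Proof.
  intros [H1 H2]. unfold CRInt_0_infty.
  apply (@is_RInt_gen_unique C_R_CompleteNormedModule (at_right 0) (Rbar_locally p_infty) _ _ f l).
  intros P [eps HP].
  assert (L1 : locally (Re l) (fun y => Rabs (y - Re l) < eps)) by (exists eps; intros y Hy; exact Hy).
  assert (L2 : locally (Im l) (fun y => Rabs (y - Im l) < eps)) by (exists eps; intros y Hy; exact Hy).
  specialize (H1 _ L1). specialize (H2 _ L2). unfold filtermapi in *.
  generalize (filter_and _ _ H1 H2). apply filter_imp.
  intros [a b] [[u [U1 U2]] [v [V1 V2]]]. exists (u, v). split.
  - exact (is_RInt_fct_extend_pair (U := R_NormedModule) (V := R_NormedModule) f a b u v U1 V1).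
  - apply HP. split; [exact U2|exact V2].
Qed.

Lemma is_Cint_ext (f g : R -> C) (l : C) :
  (forall t, 0 < t -> f t = g t) -> is_Cint f l -> is_Cint g l.
Proof.
  intros H [H1 H2]. split; (eapply is_int_ext; [|eassumption]); intros x Hx; cbv beta; now rewrite H.
Qed.

Lemma is_Cint_plus (f g : R -> C) (l1 l2 : C) :
  is_Cint f l1 -> is_Cint g l2 -> is_Cint (fun t => f t + g t)%C (l1 + l2)%C.
Proof. intros [A1 A2] [B1 B2]. split; now apply is_int_plus. Qed.

Lemma is_Cint_scal (f : R -> C) (k l : C) :
  is_Cint f l -> is_Cint (fun t => k * f t)%C (k * l)%C.
Proof.
  intros [A1 A2]. split.
  - exact (is_int_minus _ _ _ _ (is_int_scal _ (Re k) _ A1) (is_int_scal _ (Im k) _ A2)).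
  - exact (is_int_plus _ _ _ _ (is_int_scal _ (Re k) _ A2) (is_int_scal _ (Im k) _ A1)).
Qed.

Lemma is_Cint_unique (f : R -> C) (l1 l2 : C) : is_Cint f l1 -> is_Cint f l2 -> l1 = l2.
Proof. intros H1 H2. rewrite <- (is_Cint_CRInt _ _ H1). now apply is_Cint_CRInt. Qed.

Lemma Rabs_Re_le (z : C) : Rabs (Re z) <= Cmod z.
Proof. apply re_le_Cmod. Qed.

Lemma Rabs_Im_le (z : C) : Rabs (Im z) <= Cmod z.
Proof. eapply Rle_trans; [apply Rmax_r|apply Rmax_Cmod]. Qed.

Lemma Cmod_le_Re_Im (z : C) : Cmod z <= Rabs (Re z) + Rabs (Im z).
Proof.
  replace z with (RtoC (Re z) + Ci * RtoC (Im z))%C at 1.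
  - eapply Rle_trans; [apply Cmod_triangle|]. rewrite Cmod_mult, !Cmod_R.
    replace (Cmod Ci) with 1; [lra|]. unfold Cmod, Ci. simpl. rewrite <- sqrt_1 at 1. f_equal. ring.
  - destruct z as [u v]. unfold Cplus, Cmult, Ci, RtoC, Re, Im. simpl. f_equal; ring.
Qed.

Lemma ex_Cint_dominated (f : R -> C) (D : R -> R) (I : R) :
  Ccont0 f -> cont0 D -> (forall t, 0 < t -> Cmod (f t) <= D t) -> is_int D I -> exists l, is_Cint f l.
Proof.
  intros [C1 C2] HD Hb HI.
  destruct (is_int_dominated (fun t => Re (f t)) D I) as [u Hu]; auto.
  { intros x Hx. eapply Rle_trans; [apply Rabs_Re_le|auto]. }
  destruct (is_int_dominated (fun t => Im (f t)) D I) as [v Hv]; auto.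
  { intros x Hx. eapply Rle_trans; [apply Rabs_Im_le|auto]. }
  exists (u, v). split; auto.
Qed.

(** The factor 2 is the price of bounding the two components separately. *)
Lemma is_Cint_norm (f : R -> C) (D : R -> R) (l : C) (I : R) :
  (forall t, 0 < t -> Cmod (f t) <= D t) -> is_Cint f l -> is_int D I -> Cmod l <= 2 * I.
Proof.
  intros Hb [H1 H2] HI.
  assert (B1 : Rabs (Re l) <= I).
  { refine (is_int_norm _ D _ _ _ H1 HI). intros x Hx. eapply Rle_trans; [apply Rabs_Re_le|auto]. }
  assert (B2 : Rabs (Im l) <= I).
  { refine (is_int_norm _ D _ _ _ H2 HI). intros x Hx. eapply Rle_trans; [apply Rabs_Im_le|auto]. }
  pose proof (Cmod_le_Re_Im l). lra.
Qed.

Definition is_Cseries (a : nat -> C) (l : C) : Prop :=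
  is_series (fun n => Re (a n)) (Re l) /\ is_series (fun n => Im (a n)) (Im l).

Lemma sum_n_C (a : nat -> C) (n : nat) :
  @sum_n C_AbelianGroup a n = (sum_n (fun k => Re (a k)) n, sum_n (fun k => Im (a k)) n).
Proof.
  induction n as [|n IH].
  - rewrite !sum_O. now destruct (a 0%nat).
  - rewrite !sum_Sn, IH. reflexivity.
Qed.

Lemma is_Cseries_correct (a : nat -> C) (l : C) :
  is_Cseries a l -> Cex_series a /\ CSeries a = l.
Proof.
  intros [H1 H2]. split.
  - exists l. intros P [eps HP].
    assert (L1 : locally (Re l) (fun y => Rabs (y - Re l) < eps)) by (exists eps; intros y Hy; exact Hy).
    assert (L2 : locally (Im l) (fun y => Rabs (y - Im l) < eps)) by (exists eps; intros y Hy; exact Hy).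
    specialize (H1 _ L1). specialize (H2 _ L2). unfold filtermap in *.
    generalize (filter_and _ _ H1 H2). apply filter_imp. intros n [A B].
    apply HP. change (sum_n a n) with (@sum_n C_AbelianGroup a n). rewrite sum_n_C.
    split; [exact A|exact B].
  - unfold CSeries. rewrite (is_series_unique _ _ H1), (is_series_unique _ _ H2). now destruct l.
Qed.

Lemma is_Cseries_ext (a b : nat -> C) (l : C) : (forall n, a n = b n) -> is_Cseries a l -> is_Cseries b l.
Proof.
  intros H [H1 H2]. split; (eapply is_series_ext; [|eassumption]); intro n; cbv beta; now rewrite H.
Qed.

Lemma is_Cseries_scal (a : nat -> C) (k l : C) :
  is_Cseries a l -> is_Cseries (fun n => k * a n)%C (k * l)%C.
Proof.
  intros [H1 H2]. split.
  - exact (is_series_minus (V := R_NormedModule) _ _ _ _ (is_series_scal (V := R_NormedModule) (Re k) _ _ H1)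
             (is_series_scal (V := R_NormedModule) (Im k) _ _ H2)).
  - exact (is_series_plus (V := R_NormedModule) _ _ _ _ (is_series_scal (V := R_NormedModule) (Re k) _ _ H2)
             (is_series_scal (V := R_NormedModule) (Im k) _ _ H1)).
Qed.

Lemma is_Cseries_abs (a : nat -> C) (b : nat -> R) :
  (forall n, Cmod (a n) <= b n) -> ex_series b -> is_Cseries a (CSeries a).
Proof.
  intros H Hb. split; apply Series_correct; apply (ex_series_dominated _ b); auto; intro n.
  - eapply Rle_trans; [apply Rabs_Re_le|auto].
  - eapply Rle_trans; [apply Rabs_Im_le|auto].
Qed.

Definition Clocal_Mtest (f : nat -> R -> C) : Prop :=
  forall a b, 0 < a < b -> exists M, ex_series M /\
    forall n t, a <= t <= b -> Cmod (f n t) <= M n.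

Lemma Clocal_Mtest_Re_Im (f : nat -> R -> C) :
  Clocal_Mtest f -> local_Mtest (fun n t => Re (f n t)) /\ local_Mtest (fun n t => Im (f n t)).
Proof.
  intros H. split; intros a b Hab; destruct (H a b Hab) as [M [H1 H2]]; exists M; split; auto;
    intros n t Ht; (eapply Rle_trans; [|apply (H2 n t Ht)]); [apply Rabs_Re_le|apply Rabs_Im_le].
Qed.

Lemma is_Cint_Series (f : nat -> R -> C) (I : nat -> R) (D : nat -> R -> R) (v : nat -> C) :
  (forall n, Ccont0 (f n)) -> Clocal_Mtest f ->
  (forall n, cont0 (D n)) -> (forall n t, 0 < t -> Cmod (f n t) <= D n t) ->
  (forall n, is_int (D n) (I n)) -> ex_series I ->
  (forall n, is_Cint (f n) (v n)) ->
  is_Cseries v (CSeries v) /\ is_Cint (fun t => CSeries (fun n => f n t)) (CSeries v).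
Proof.
  intros Hc HM HD HfD HDI HI Hv.
  destruct (Clocal_Mtest_Re_Im f HM) as [M1 M2].
  assert (HDp : forall n x, 0 < x -> 0 <= D n x).
  { intros n x Hx. eapply Rle_trans; [apply Cmod_ge_0|apply (HfD n x Hx)]. }
  assert (B : forall (g : nat -> R -> R), (forall n, cont0 (g n)) ->
     (forall n t, Rabs (g n t) <= Cmod (f n t)) ->
     forall n a b, 0 < a < b -> RInt (fun t => Rabs (g n t)) a b <= I n).
  { intros g Hg Hgf n a b Hab. apply Rle_trans with (RInt (D n) a b).
    - apply RInt_le; [lra| | |].
      + apply cont0_ex_RInt; try lra. now apply cont0_Rabs.
      + apply cont0_ex_RInt; auto; lra.
      + intros x Hx. eapply Rle_trans; [apply Hgf|apply HfD; lra].
    - apply RInt_le_is_int; auto. }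
  destruct (is_int_Series (fun n t => Re (f n t)) I (fun n => Re (v n)) (fun n => proj1 (Hc n)) M1 HI
    (B (fun n t => Re (f n t)) (fun n => proj1 (Hc n)) (fun n t => Rabs_Re_le (f n t)))
    (fun n => proj1 (Hv n))) as [A1 A2].
  destruct (is_int_Series (fun n t => Im (f n t)) I (fun n => Im (v n)) (fun n => proj2 (Hc n)) M2 HI
    (B (fun n t => Im (f n t)) (fun n => proj2 (Hc n)) (fun n t => Rabs_Im_le (f n t)))
    (fun n => proj2 (Hv n))) as [A3 A4].
  exact (conj (conj (Series_correct _ A1) (Series_correct _ A3)) (conj A2 A4)).
Qed.

Lemma is_Cint_Series_dominated (f : nat -> R -> C) (v : nat -> C) (D : R -> R) (I : R) :
  (forall n, Ccont0 (f n)) -> Clocal_Mtest f -> cont0 D -> is_int D I ->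
  (forall n t, 0 < t -> sum_n (fun k => Cmod (f k t)) n <= D t) ->
  (forall n, is_Cint (f n) (v n)) ->
  is_Cseries v (CSeries v) /\ is_Cint (fun t => CSeries (fun n => f n t)) (CSeries v).
Proof.
  intros Hc HM HD HI Hs Hv.
  destruct (Clocal_Mtest_Re_Im f HM) as [M1 M2].
  assert (B : forall (g : nat -> R -> R), (forall n t, Rabs (g n t) <= Cmod (f n t)) ->
     forall n t, 0 < t -> sum_n (fun k => Rabs (g k t)) n <= D t).
  { intros g Hg n t Ht. eapply Rle_trans; [|apply (Hs n t Ht)].
    apply sum_n_m_le. intro k. apply Hg. }
  destruct (is_int_Series_dominated (fun n t => Re (f n t)) (fun n => Re (v n)) D I (fun n => proj1 (Hc n)) M1 HD HI
    (B (fun n t => Re (f n t)) (fun n t => Rabs_Re_le (f n t))) (fun n => proj1 (Hv n))) as [A1 A2].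
  destruct (is_int_Series_dominated (fun n t => Im (f n t)) (fun n => Im (v n)) D I (fun n => proj2 (Hc n)) M2 HD HI
    (B (fun n t => Im (f n t)) (fun n t => Rabs_Im_le (f n t))) (fun n => proj2 (Hv n))) as [A3 A4].
  exact (conj (conj (Series_correct _ A1) (Series_correct _ A3)) (conj A2 A4)).
Qed.

Lemma is_Cint_comp_scale (f : R -> C) (k : R) (l : C) :
  0 < k -> Ccont0 f -> is_Cint f l -> is_Cint (fun t => RtoC k * f (k * t)%R)%C l.
Proof.
  intros Hk [C1 C2] [H1 H2]. split.
  - eapply is_int_ext; [|exact (is_int_comp_scale _ k _ Hk C1 H1)]. intros x _.
    unfold Re, Im, Cmult, RtoC; simpl. ring.
  - eapply is_int_ext; [|exact (is_int_comp_scale _ k _ Hk C2 H2)]. intros x _.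
    unfold Re, Im, Cmult, RtoC; simpl. ring.
Qed.

Lemma is_Cint_comp_inv (f : R -> C) (k : R) (l : C) :
  0 < k -> Ccont0 f -> is_Cint f l -> is_Cint (fun t => RtoC (k / t ^ 2)%R * f (k / t)%R)%C l.
Proof.
  intros Hk [C1 C2] [H1 H2]. split.
  - eapply is_int_ext; [|exact (is_int_comp_inv _ k _ Hk C1 H1)]. intros x _.
    unfold Re, Im, Cmult, RtoC; simpl. ring.
  - eapply is_int_ext; [|exact (is_int_comp_inv _ k _ Hk C2 H2)]. intros x _.
    unfold Re, Im, Cmult, RtoC; simpl. ring.
Qed.

Lemma Cexp_plus (z w : C) : Cexp (z + w) = (Cexp z * Cexp w)%C.
Proof.
  unfold Cexp, Cplus, Cmult, Re, Im; simpl. rewrite exp_plus, cos_plus, sin_plus. f_equal; ring.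
Qed.

Lemma Cexp_0 : Cexp (RtoC 0) = RtoC 1.
Proof. unfold Cexp, RtoC, Re, Im; simpl. rewrite exp_0, cos_0, sin_0. f_equal; ring. Qed.

Lemma Cexp_RtoC (x : R) : Cexp (RtoC x) = RtoC (exp x).
Proof. unfold Cexp, RtoC, Re, Im; simpl. rewrite cos_0, sin_0. f_equal; ring. Qed.

Lemma Cmod_Cexp (z : C) : Cmod (Cexp z) = exp (Re z).
Proof.
  unfold Cmod, Cexp; simpl fst; simpl snd.
  replace ((exp (Re z) * cos (Im z)) ^ 2 + (exp (Re z) * sin (Im z)) ^ 2) with (exp (Re z) ^ 2).
  - apply sqrt_pow2. left; apply exp_pos.
  - pose proof (sin2_cos2 (Im z)) as E. unfold Rsqr in E.
    transitivity (exp (Re z) ^ 2 * (sin (Im z) * sin (Im z) + cos (Im z) * cos (Im z))); [rewrite E; ring|ring].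
Qed.

Lemma RCpower_plus (x : R) (s t : C) : RCpower x (s + t) = (RCpower x s * RCpower x t)%C.
Proof. unfold RCpower. rewrite <- Cexp_plus. f_equal. ring. Qed.

Lemma RCpower_mult (x y : R) (s : C) : 0 < x -> 0 < y -> RCpower (x * y) s = (RCpower x s * RCpower y s)%C.
Proof.
  intros Hx Hy. unfold RCpower. rewrite <- Cexp_plus, ln_mult by auto. f_equal. rewrite RtoC_plus. ring.
Qed.

Lemma RCpower_RtoC (x a : R) : RCpower x (RtoC a) = RtoC (Rpower x a).
Proof. unfold RCpower, Rpower. rewrite <- RtoC_mult. apply Cexp_RtoC. Qed.

Lemma RCpower_1 (x : R) : 0 < x -> RCpower x (RtoC 1) = RtoC x.
Proof. intros Hx. rewrite RCpower_RtoC, Rpower_1; auto. Qed.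

Lemma RCpower_opp (x : R) (s : C) : (RCpower x s * RCpower x (- s) = RtoC 1)%C.
Proof.
  rewrite <- RCpower_plus. replace (s + - s)%C with (RtoC 0) by ring.
  unfold RCpower. replace (RtoC 0 * RtoC (ln x))%C with (RtoC 0) by ring. apply Cexp_0.
Qed.

Lemma RCpower_inv_base (x : R) (s : C) : 0 < x -> RCpower (/ x) s = RCpower x (- s).
Proof.
  intros Hx. unfold RCpower. rewrite ln_Rinv by auto. f_equal. rewrite RtoC_opp. ring.
Qed.

Lemma Cmod_RCpower (x : R) (s : C) : Cmod (RCpower x s) = Rpower x (Re s).
Proof.
  unfold RCpower, Rpower. rewrite Cmod_Cexp. f_equal. unfold Re, Cmult, RtoC; simpl. ring.
Qed.

Lemma Ccont0_RCpower (s : C) : Ccont0 (fun x => RCpower x s).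
Proof.
  split; intros x Hx; apply (ex_derive_continuous (V := R_NormedModule));
    unfold RCpower, Cexp, Cmult, RtoC, Re, Im; simpl; auto_derive; auto.
Qed.

Lemma Ccont0_mult (f g : R -> C) : Ccont0 f -> Ccont0 g -> Ccont0 (fun x => f x * g x)%C.
Proof.
  intros [F1 F2] [G1 G2]. split; intros x Hx.
  - exact (continuous_minus (V := R_NormedModule) _ _ x
      (continuous_mult (K := R_AbsRing) _ _ x (F1 x Hx) (G1 x Hx))
      (continuous_mult (K := R_AbsRing) _ _ x (F2 x Hx) (G2 x Hx))).
  - exact (continuous_plus (V := R_NormedModule) _ _ x
      (continuous_mult (K := R_AbsRing) _ _ x (F1 x Hx) (G2 x Hx))
      (continuous_mult (K := R_AbsRing) _ _ x (F2 x Hx) (G1 x Hx))).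
Qed.

Lemma Ccont0_RtoC (f : R -> R) : cont0 f -> Ccont0 (fun x => RtoC (f x)).
Proof. intros H. split; [exact H|]. intros x _. apply continuous_const. Qed.

(** * Euler and Bessel integrals *)

(** u = x + 1/x is the common gauge for both ends of the half line: it is invariant under x -> 1/x
    and dominates x, 1/x, |ln x| and, in suitable powers, every x^s. *)
Lemma add_inv_bounds (x : R) : 0 < x -> 1 <= x + 1 / x /\ x <= x + 1 / x /\ 1 / x <= x + 1 / x.
Proof.
  intros Hx. assert (H : 0 < 1 / x) by (apply Rdiv_lt_0_compat; lra). repeat split; try lra.
  destruct (Rle_dec 1 x); [lra|].
  assert (1 <= 1 / x); [|lra]. replace (1 / x) with (/ x) by (field; lra).
  rewrite <- Rinv_1. apply Rinv_le_contravar; lra.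
Qed.

Lemma Rabs_ln_le (x : R) : 0 < x -> Rabs (ln x) <= ln (x + 1 / x).
Proof.
  intros Hx. destruct (add_inv_bounds x Hx) as [H1 [H2 H3]].
  assert (H : 0 < 1 / x) by (apply Rdiv_lt_0_compat; lra).
  assert (L : forall u v, 0 < u -> u <= v -> ln u <= ln v).
  { intros u v Hu [Hv| ->]; [left; now apply ln_increasing|lra]. }
  apply Rabs_le. split; [|apply L; auto].
  apply Ropp_le_cancel. rewrite Ropp_involutive, <- ln_Rinv by auto.
  replace (/ x) with (1 / x) by (field; lra). now apply L.
Qed.

Lemma Rpower_le_pow (x s : R) (N : nat) :
  0 < x -> Rabs s <= INR N -> Rpower x s <= (x + 1 / x) ^ N.
Proof.
  intros Hx Hs. destruct (add_inv_bounds x Hx) as [H1 [H2 H3]].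
  rewrite <- Rpower_pow by lra. unfold Rpower. apply exp_le.
  eapply Rle_trans; [apply Rle_abs|]. rewrite Rabs_mult.
  apply Rmult_le_compat; try apply Rabs_pos; auto. now apply Rabs_ln_le.
Qed.

Lemma nat_above (x : R) : exists N : nat, x <= INR N.
Proof.
  destruct (nfloor_ex (Rabs x) (Rabs_pos x)) as [n [_ Hn]]. exists (S n). rewrite S_INR.
  pose proof (Rle_abs x). lra.
Qed.

Lemma kernel_dom (c : R) (N : nat) :
  0 < c -> exists K, 0 < K /\ forall x, 0 < x ->
    exp (- (c * (x + 1 / x))) * (x + 1 / x) ^ N <= K * dom 1 x.
Proof.
  (* The two additional powers of u pay for the factor (1 + x)^(-2) of [dom 1]. *)
  intros Hc. destruct (pow_le_exp (N + 2) c Hc) as [K [HK H]].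
  exists (4 * K). split; [lra|]. intros x Hx.
  destruct (add_inv_bounds x Hx) as [H1 [H2 H3]]. set (u := x + 1 / x) in *.
  specialize (H u ltac:(lra)).
  unfold dom. replace (1 - 1) with 0 by ring. unfold Rpower; rewrite Rmult_0_l, exp_0.
  unfold Rdiv; rewrite Rmult_1_l.
  apply Rmult_le_reg_r with ((1 + x) ^ 2); [apply pow_lt; lra|].
  rewrite (Rmult_assoc _ (/ _)), Rinv_l, Rmult_1_r by (apply pow_nonzero; lra).
  pose proof (exp_pos (- (c * u))) as Hp.
  assert (E : exp (c * u) * exp (- (c * u)) = 1) by (rewrite <- exp_plus, Rplus_opp_r; apply exp_0).
  apply (Rmult_le_compat_r (exp (- (c * u)))) in H; [|lra]. rewrite Rmult_assoc, E in H.
  assert (B : (1 + x) ^ 2 <= 4 * u ^ 2).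
  { replace (4 * u ^ 2) with ((2 * u) ^ 2) by ring. apply pow_incr. lra. }
  assert (0 <= exp (- (c * u)) * u ^ N) by (apply Rmult_le_pos; [lra|apply pow_le; lra]).
  apply Rle_trans with (exp (- (c * u)) * u ^ N * (4 * u ^ 2)).
  - now apply Rmult_le_compat_l.
  - replace (exp (- (c * u)) * u ^ N * (4 * u ^ 2)) with (4 * (u ^ (N + 2) * exp (- (c * u))))
      by (rewrite pow_add; ring). lra.
Qed.

Lemma kernel_power_dom (c s : R) (N : nat) :
  0 < c -> exists K, 0 < K /\ forall x, 0 < x ->
    exp (- (c * (x + 1 / x))) * (x + 1 / x) ^ N * Rpower x s <= K * dom 1 x.
Proof.
  intros Hc. destruct (nat_above (Rabs s)) as [M HM].
  destruct (kernel_dom c (N + M) Hc) as [K [HK H]]. exists K. split; auto. intros x Hx.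
  eapply Rle_trans; [|apply (H x Hx)]. rewrite pow_add, <- Rmult_assoc.
  destruct (add_inv_bounds x Hx) as [H1 _].
  apply Rmult_le_compat_l; [|now apply Rpower_le_pow].
  apply Rmult_le_pos; [left; apply exp_pos|apply pow_le; lra].
Qed.

Lemma ex_Cint_dom (f : R -> C) (e K : R) :
  0 < e -> Ccont0 f -> (forall t, 0 < t -> Cmod (f t) <= K * dom e t) -> exists l, is_Cint f l.
Proof.
  intros He Hc Hb. destruct (is_int_dom e He) as [I HI].
  apply (ex_Cint_dominated f (fun t => K * dom e t) (K * I)); auto.
  - intros x Hx. apply (continuous_scal_r (V := R_NormedModule) K (dom e)). now apply cont0_dom.
  - now apply is_int_scal.
Qed.

Lemma cont0_derivable (f : R -> R) : (forall x, 0 < x -> ex_derive f x) -> cont0 f.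
Proof. intros H x Hx. apply (ex_derive_continuous (V := R_NormedModule)). auto. Qed.

Lemma Cmod_RtoC_pos (x : R) : 0 <= x -> Cmod (RtoC x) = x.
Proof. intros Hx. rewrite Cmod_R. now apply Rabs_pos_eq. Qed.

Definition gamma_integrand (w : C) (t : R) : C := (RtoC (exp (- t)) * RCpower t (w - 1))%C.

Lemma Ccont0_gamma_integrand (w : C) : Ccont0 (gamma_integrand w).
Proof.
  apply Ccont0_mult; [|apply Ccont0_RCpower]. apply Ccont0_RtoC, cont0_derivable.
  intros x Hx. auto_derive; auto.
Qed.

(** [dom] with exponent s = Re w matches t^(s-1) at 0. What remains after division is exp(-t) (1 +
    t)^(s+1), which is bounded. *)
Lemma is_Cint_Gamma (w : C) : 0 < Re w -> is_Cint (gamma_integrand w) (Gamma w).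
Proof.
  intros Hw. set (s := Re w) in *.
  destruct (nat_above (s + 1)) as [N HN]. destruct (pow_le_exp N 1 Rlt_0_1) as [K [HK H]].
  assert (Hb : forall t, 0 < t -> Cmod (gamma_integrand w t) <= K * exp 1 * dom s t).
  { intros t Ht. unfold gamma_integrand. rewrite Cmod_mult, Cmod_RCpower, Cmod_RtoC_pos by (left; apply exp_pos).
    replace (Re (w - 1)%C) with (s - 1) by (unfold s, Re, Cminus, Cplus, Copp, RtoC; simpl; ring).
    unfold dom.
    assert (E : Rpower t (s - 1) = Rpower (t / (1 + t)) (s - 1) * Rpower (1 + t) (s - 1)).
    { rewrite Rpower_mult_distr; [f_equal; field; lra|apply Rdiv_lt_0_compat; lra|lra]. }
    rewrite E. set (P := Rpower (t / (1 + t)) (s - 1)).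
    assert (HP : 0 < P) by apply exp_pos.
    apply Rmult_le_reg_r with ((1 + t) ^ 2); [apply pow_lt; lra|].
    replace (K * exp 1 * (P / (1 + t) ^ 2) * (1 + t) ^ 2) with (P * (K * exp 1)) by (field; lra).
    replace (exp (- t) * (P * Rpower (1 + t) (s - 1)) * (1 + t) ^ 2)
      with (P * (exp (- t) * (Rpower (1 + t) (s - 1) * (1 + t) ^ 2))) by ring.
    apply Rmult_le_compat_l; [lra|].
    assert (E2 : Rpower (1 + t) (s - 1) * (1 + t) ^ 2 = Rpower (1 + t) (s + 1)).
    { rewrite <- (Rpower_pow 2) by lra. rewrite <- Rpower_plus. f_equal. simpl. ring. }
    rewrite E2.
    assert (B : Rpower (1 + t) (s + 1) <= (1 + t) ^ N).
    { rewrite <- Rpower_pow by lra. apply Rle_Rpower; lra. }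
    specialize (H (1 + t) ltac:(lra)). rewrite Rmult_1_l, exp_plus in H.
    assert (E3 : exp t * exp (- t) = 1) by (rewrite <- exp_plus, Rplus_opp_r; apply exp_0).
    pose proof (exp_pos (- t)) as Hp.
    apply Rle_trans with (exp (- t) * (K * (exp 1 * exp t))).
    - apply Rmult_le_compat_l; lra.
    - right. transitivity (K * exp 1 * (exp t * exp (- t))); [ring|rewrite E3; ring]. }
  destruct (ex_Cint_dom (gamma_integrand w) s (K * exp 1) Hw (Ccont0_gamma_integrand w) Hb) as [l Hl].
  unfold Gamma. change (fun t => (RtoC (exp (- t)) * RCpower t (w - 1))%C) with (gamma_integrand w).
  now rewrite (is_Cint_CRInt _ _ Hl).
Qed.

Lemma is_Cint_Gamma_scale (w : C) (k : R) :
  0 < Re w -> 0 < k ->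
  is_Cint (fun x => (RtoC (exp (- (k * x))) * RCpower x (w - 1))%C) (RCpower k (- w) * Gamma w)%C.
Proof.
  intros Hw Hk.
  pose proof (is_Cint_scal _ (RCpower k (- w)) _
    (is_Cint_comp_scale _ k _ Hk (Ccont0_gamma_integrand w) (is_Cint_Gamma w Hw))) as H.
  eapply is_Cint_ext; [|exact H]. intros x Hx. cbv beta. unfold gamma_integrand.
  rewrite RCpower_mult by auto.
  assert (E : (RtoC k * RCpower k (w - 1) = RCpower k w)%C).
  { rewrite <- (RCpower_1 k) by auto. rewrite <- RCpower_plus. f_equal. ring. }
  transitivity (RCpower k w * RCpower k (- w) * (RtoC (exp (- (k * x))) * RCpower x (w - 1)))%C.
  - rewrite <- E. ring.
  - rewrite RCpower_opp. ring.
Qed.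

Definition bessel_integrand (nu : C) (y t : R) : C :=
  (RtoC (exp (- (y / 2) * (t + 1 / t))) * RCpower t (- nu) * RtoC (1 / t))%C.

Lemma Ccont0_bessel_integrand (nu : C) (y : R) : Ccont0 (bessel_integrand nu y).
Proof.
  apply Ccont0_mult; [apply Ccont0_mult; [|apply Ccont0_RCpower]|];
    apply Ccont0_RtoC, cont0_derivable; intros x Hx; auto_derive; lra.
Qed.

Lemma is_Cint_Bessel (nu : C) (y : R) :
  0 < y -> is_Cint (bessel_integrand nu y) (RtoC 2 * BesselK nu y)%C.
Proof.
  intros Hy. destruct (kernel_power_dom (y / 2) (Re (- nu)%C) 1 ltac:(lra)) as [K [HK H]].
  destruct (ex_Cint_dom (bessel_integrand nu y) 1 K Rlt_0_1 (Ccont0_bessel_integrand nu y)) as [l Hl].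
  - intros t Ht. eapply Rle_trans; [|apply (H t Ht)]. unfold bessel_integrand.
    destruct (add_inv_bounds t Ht) as [H1 [H2 H3]].
    assert (0 < 1 / t) by (apply Rdiv_lt_0_compat; lra).
    rewrite !Cmod_mult, Cmod_RCpower, !Cmod_RtoC_pos by (try (left; apply exp_pos); lra).
    replace (- (y / 2) * (t + 1 / t)) with (- (y / 2 * (t + 1 / t))) by ring. rewrite pow_1.
    assert (0 < Rpower t (Re (- nu)%C)) by apply exp_pos.
    pose proof (exp_pos (- (y / 2 * (t + 1 / t)))).
    rewrite (Rmult_assoc (exp _) (t + 1 / t)), (Rmult_comm (t + 1 / t)), <- Rmult_assoc.
    apply Rmult_le_compat_l; auto. left. now apply Rmult_lt_0_compat.
  - replace (RtoC 2 * BesselK nu y)%C with l; auto. unfold BesselK.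
    change (fun t => (RtoC (exp (- (y / 2) * (t + 1 / t))) * RCpower t (- nu) * RtoC (1 / t))%C)
      with (bessel_integrand nu y).
    rewrite (is_Cint_CRInt _ _ Hl), Cmult_assoc, <- RtoC_mult.
    replace (2 * (1 / 2)) with 1 by field. ring.
Qed.

(* Substitute t = sqrt (b / a) / x in the defining integral of K. *)
Lemma is_Cint_two_sided_exp (mu : C) (a b : R) :
  0 < a -> 0 < b ->
  is_Cint (fun x => (RtoC (exp (- (a * x + b / x))) * RCpower x (mu - 1))%C)
    (RtoC 2 * (RCpower (b / a) (mu / RtoC 2) * BesselK mu (2 * sqrt (a * b))))%C.
Proof.
  intros Ha Hb.
  assert (Hba : 0 < b / a) by now apply Rdiv_lt_0_compat.
  set (k := sqrt (b / a)). assert (Hk : 0 < k) by now apply sqrt_lt_R0.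
  assert (Hkk : k * k = b / a) by (apply sqrt_sqrt; lra).
  set (y := sqrt (a * b)). assert (Hab : 0 < a * b) by now apply Rmult_lt_0_compat.
  assert (Hy : 0 < y) by now apply sqrt_lt_R0.
  assert (Hyk : y = a * k).
  { unfold y. replace (a * b) with ((a * k) ^ 2).
    - apply sqrt_pow2. left. now apply Rmult_lt_0_compat.
    - replace ((a * k) ^ 2) with (a * a * (k * k)) by ring. rewrite Hkk. field. lra. }
  assert (Hbk : b = y * k).
  { rewrite Hyk, Rmult_assoc, Hkk. field. lra. }
  assert (Hpow : RCpower (b / a) (mu / RtoC 2) = RCpower k mu).
  { rewrite <- Hkk, RCpower_mult, <- RCpower_plus by auto. f_equal. field. }
  pose proof (is_Cint_scal _ (RCpower k mu) _ (is_Cint_comp_inv _ k _ Hk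
    (Ccont0_bessel_integrand mu (2 * y)) (is_Cint_Bessel mu (2 * y) ltac:(lra)))) as H.
  rewrite Hpow. replace (RtoC 2 * (RCpower k mu * BesselK mu (2 * y)))%C
    with (RCpower k mu * (RtoC 2 * BesselK mu (2 * y)))%C by ring.
  eapply is_Cint_ext; [|exact H]. intros x Hx. cbv beta. unfold bessel_integrand.
  replace (- (2 * y / 2) * (k / x + 1 / (k / x))) with (- (a * x + b / x)).
  2:{ rewrite Hbk, Hyk. field. lra. }
  unfold Rdiv at 3. rewrite RCpower_mult by (auto; now apply Rinv_0_lt_compat).
  rewrite RCpower_inv_base by auto. replace (- - mu)%C with mu by ring.
  assert (E : RCpower x mu = (RtoC x * RCpower x (mu - 1))%C).
  { rewrite <- (RCpower_1 x) by auto. rewrite <- RCpower_plus. f_equal. ring. }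
  rewrite E.
  transitivity (RCpower k mu * RCpower k (- mu) * RtoC (k / x ^ 2 * x * (1 / (k / x))) *
     (RtoC (exp (- (a * x + b / x))) * RCpower x (mu - 1)))%C.
  - rewrite !RtoC_mult. ring.
  - rewrite RCpower_opp. replace (k / x ^ 2 * x * (1 / (k / x))) with 1 by (field; lra). ring.
Qed.

(** * The completed L-function *)

(** The coefficient bound gives theta <= 2 z (1 - z)^(-2), and 1/(1 - z) is at most a constant times
    x + 1/x. *)
Lemma theta_decay (q : nat) (chi : Z -> R) (x : R) :
  (1 < q)%nat -> real_dirichlet_character q chi -> 0 < x ->
  theta q chi x <= 8 * (1 + INR q / PI) ^ 2 * (exp (- (PI / INR q * x)) * (x + 1 / x) ^ 2).
Proof.
  intros Hq H Hx. pose proof (theta_kappa_pos q x Hq Hx) as Hk.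
  assert (HQ : 0 < INR q) by (apply lt_0_INR; lia). assert (Hpi : 0 < PI) by exact PI_RGT_0.
  assert (HqP : 0 < INR q / PI) by now apply Rdiv_lt_0_compat.
  rewrite (theta_PSeries q chi x Hq H Hx). set (z := exp (- (PI * x / INR q))).
  assert (Hz : 0 < z < 1).
  { split; [apply exp_pos|]. unfold z. rewrite <- exp_0. apply exp_increasing. lra. }
  replace (exp (- (PI / INR q * x))) with z by (unfold z; do 2 f_equal; field; lra).
  pose proof (PSeries_abs_le_succ (theta_coeff chi) z (fun n => theta_coeff_bound q chi n Hq H) ltac:(lra)) as B.
  apply Rle_trans with (2 * (z * / (1 - z) ^ 2)).
  - apply Rmult_le_compat_l; [lra|]. apply Rmult_le_compat_l; [lra|].
    eapply Rle_trans; [apply Rle_abs|exact B].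
  - rewrite <- pow_inv.
    assert (B2 : / (1 - z) <= 2 * (1 + INR q / PI) * (x + 1 / x)).
    { eapply Rle_trans; [apply one_minus_exp_neg; auto|].
      destruct (add_inv_bounds x Hx) as [H1 [H2 H3]].
      replace (1 / (PI * x / INR q)) with (INR q / PI * (1 / x)) by (field; lra). nra. }
    assert (B3 : 0 < / (1 - z)) by (apply Rinv_0_lt_compat; lra).
    apply Rle_trans with (2 * (z * (2 * (1 + INR q / PI) * (x + 1 / x)) ^ 2)); [|right; ring].
    apply Rmult_le_compat_l; [lra|]. apply Rmult_le_compat_l; [lra|].
    apply pow_incr. lra.
Qed.

(** For x >= 1 this is [theta_decay]; for x < 1 the functional equation reduces to 1/x, and its
    factor is at most x^(-2) <= u^2. The rate is halved because u = x + 1/x is at most twice the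
    larger of x and 1/x. *)
Lemma theta_bound (q : nat) (chi : Z -> R) :
  (1 < q)%nat -> real_dirichlet_character q chi -> primitive_character q chi ->
  (forall x, 0 < x -> 0 < theta q chi x) ->
  exists c K, 0 < c /\ 0 < K /\ forall x, 0 < x ->
    theta q chi x <= K * (exp (- (c * (x + 1 / x))) * (x + 1 / x) ^ 4).
Proof.
  intros Hq H Hprim Hpos.
  assert (HQ : 0 < INR q) by (apply lt_0_INR; lia). assert (Hpi : 0 < PI) by exact PI_RGT_0.
  assert (HqP : 0 < INR q / PI) by now apply Rdiv_lt_0_compat.
  set (K := 8 * (1 + INR q / PI) ^ 2). set (c := PI / INR q / 2).
  assert (Hc : 0 < c) by (unfold c; assert (0 < PI / INR q) by (now apply Rdiv_lt_0_compat); lra).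
  assert (HK : 0 < K) by (apply Rmult_lt_0_compat; [lra|apply pow_lt; lra]).
  exists c, K. repeat split; auto. intros x Hx.
  destruct (add_inv_bounds x Hx) as [H1 [H2 H3]]. set (u := x + 1 / x) in *.
  assert (Hu2 : u ^ 2 <= u ^ 4) by (apply Rle_pow; [lra|lia]).
  assert (Hcu : forall y, u <= 2 * y -> exp (- (PI / INR q * y)) <= exp (- (c * u))).
  { intros y Hy. apply exp_le. unfold c in *. nra. }
  assert (Hu0 : 0 <= u ^ 2) by (apply pow_le; lra).
  destruct (Rle_dec 1 x) as [L|L].
  - eapply Rle_trans; [now apply theta_decay|]. fold K u. apply Rmult_le_compat_l; [lra|].
    apply Rmult_le_compat; auto; [left; apply exp_pos|]. apply Hcu.
    assert (1 / x <= x); [|unfold u; lra]. apply Rmult_le_reg_r with x; auto.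
    unfold Rdiv. rewrite Rmult_assoc, Rinv_l by lra. nra.
  - assert (Hx' : 0 < 1 / x) by (apply Rdiv_lt_0_compat; lra).
    rewrite (theta_functional_equation q chi Hq H Hprim Hpos x Hx).
    pose proof (theta_decay q chi (1 / x) Hq H Hx') as B.
    replace (1 / x + 1 / (1 / x)) with u in B by (unfold u; field; lra). fold K in B.
    assert (Hsx : x <= sqrt x).
    { rewrite <- (sqrt_sqrt x) at 1 by lra. assert (0 < sqrt x) by now apply sqrt_lt_R0.
      assert (sqrt x <= 1) by (rewrite <- sqrt_1; apply sqrt_le_1_alt; lra). nra. }
    assert (Hxd : x <= x ^ delta chi).
    { destruct (chi_opp q chi 0 Hq H) as [Hd _].
      destruct (delta chi) as [|[|d]]; [simpl; lra|rewrite pow_1; lra|lia]. }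
    assert (B2 : / (x ^ delta chi * sqrt x) <= u ^ 2).
    { apply Rle_trans with ((1 / x) ^ 2); [|apply pow_incr; lra].
      replace ((1 / x) ^ 2) with (/ (x * x)) by (field; lra).
      apply Rinv_le_contravar; [nra|]. apply Rmult_le_compat; lra. }
    apply Rle_trans with (u ^ 2 * (K * (exp (- (c * u)) * u ^ 2))); [|right; ring].
    apply Rmult_le_compat; auto.
    + left. apply Rinv_0_lt_compat. apply Rmult_lt_0_compat; [now apply pow_lt|now apply sqrt_lt_R0].
    + left. auto.
    + eapply Rle_trans; [exact B|]. apply Rmult_le_compat_l; [lra|].
      apply Rmult_le_compat_r; auto. apply Hcu. unfold u.
      assert (x <= 1 / x); [|lra]. apply Rmult_le_reg_r with x; auto.
      unfold Rdiv. rewrite Rmult_assoc, Rinv_l by lra. nra.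
Qed.

Lemma cont0_theta (q : nat) (chi : Z -> R) :
  (1 < q)%nat -> real_dirichlet_character q chi -> cont0 (theta q chi).
Proof.
  intros Hq H x Hx. pose proof (theta_kappa_pos q x Hq Hx) as Hk.
  assert (Hg : disk (theta_coeff chi)) by (apply disk_succ; intro; now apply (theta_coeff_bound q)).
  set (z := fun x => exp (- (PI * x / INR q))).
  apply (continuous_ext_loc _ (fun x => 2 * (z x * PSeries (theta_coeff chi) (z x)))).
  - exists (mkposreal x Hx). intros y Hy. symmetry. apply theta_PSeries; auto.
    assert (Hy' : Rabs (y - x) < x) by exact Hy. apply Rabs_def2 in Hy'. lra.
  - assert (Hzc : continuous z x).
    { apply (ex_derive_continuous (V := R_NormedModule)). unfold z. auto_derive; auto. }
    apply (continuous_scal_r (V := R_NormedModule) 2 (fun x => z x * PSeries (theta_coeff chi) (z x))).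
    apply (continuous_mult (K := R_AbsRing) z (fun x => PSeries (theta_coeff chi) (z x))); auto.
    apply (continuous_comp z (PSeries (theta_coeff chi))); auto.
    apply disk_continuous; auto. unfold z. rewrite Rabs_pos_eq by (left; apply exp_pos).
    rewrite <- exp_0. apply exp_increasing. lra.
Qed.

Lemma Cmod_Cexp_remainder (z : C) :
  Cmod (Cexp z - RtoC 1 - z)%C <= 4 * (Cmod z ^ 2 * exp (Cmod z)).
Proof.
  set (a := Re z). set (b := Im z). set (r := Cmod z).
  assert (Ha : Rabs a <= r) by apply Rabs_Re_le. assert (Hb : Rabs b <= r) by apply Rabs_Im_le.
  assert (Hr : 0 <= r) by apply Cmod_ge_0.
  assert (HE : 1 <= exp r) by (pose proof (exp_ineq1_le r); lra).
  assert (M1 : forall x, Rabs (exp x - 1) <= Rabs x * exp (Rabs x)).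
  { intro x. destruct (MVT_gen exp 0 x exp) as [c [Hc E]].
    - intros y _. apply is_derive_exp.
    - intros y _. apply derivable_continuous_pt, derivable_pt_exp.
    - rewrite exp_0, Rminus_0_r in E. rewrite E, Rabs_mult, Rmult_comm.
      apply Rmult_le_compat_l; [apply Rabs_pos|]. rewrite Rabs_pos_eq by (left; apply exp_pos).
      apply exp_le. revert Hc. unfold Rmin, Rmax. destruct Rle_dec; unfold Rabs; destruct Rcase_abs; lra. }
  assert (M2 : Rabs (exp a - 1 - a) <= Rabs a ^ 2 * exp (Rabs a)).
  { destruct (MVT_gen (fun x => exp x - 1 - x) 0 a (fun x => exp x - 1)) as [c [Hc E]].
    - intros y _. auto_derive; auto. ring.
    - intros y _. apply continuity_pt_filterlim.
      apply (ex_derive_continuous (V := R_NormedModule) (fun x => exp x - 1 - x)). auto_derive; auto.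
    - rewrite exp_0 in E. replace (1 - 1 - 0) with 0 in E by ring. rewrite !Rminus_0_r in E.
      rewrite E, Rabs_mult.
      assert (Hca : Rabs c <= Rabs a).
      { revert Hc. unfold Rmin, Rmax. destruct Rle_dec; unfold Rabs; repeat destruct Rcase_abs; lra. }
      specialize (M1 c). pose proof (Rabs_pos a). pose proof (Rabs_pos c).
      assert (exp (Rabs c) <= exp (Rabs a)) by (apply exp_le; lra).
      pose proof (exp_pos (Rabs c)).
      apply Rle_trans with (Rabs c * exp (Rabs c) * Rabs a); [apply Rmult_le_compat_r; auto|].
      apply Rle_trans with (Rabs a * exp (Rabs a) * Rabs a); [|right; ring].
      apply Rmult_le_compat_r; auto. apply Rmult_le_compat; lra. }
  assert (Hea : exp (Rabs a) <= exp r) by (apply exp_le; lra).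
  assert (He : exp a <= exp r) by (apply exp_le; eapply Rle_trans; [apply Rle_abs|lra]).
  assert (Hr2 : 0 <= r ^ 2) by (apply pow2_ge_0).
  assert (Ha2 : Rabs a ^ 2 <= r ^ 2) by (apply pow_incr; split; [apply Rabs_pos|auto]).
  assert (Hb2 : b ^ 2 <= r ^ 2) by (rewrite <- (pow2_abs b); apply pow_incr; split; [apply Rabs_pos|auto]).
  eapply Rle_trans; [apply Cmod_le_Re_Im|].
  replace (Re (Cexp z - RtoC 1 - z)%C) with ((exp a - 1 - a) - exp a * (1 - cos b))
    by (unfold Cexp, Cminus, Cplus, Copp, RtoC, a, b, Re, Im; simpl; ring).
  replace (Im (Cexp z - RtoC 1 - z)%C) with ((exp a - 1) * sin b + (sin b - b))
    by (unfold Cexp, Cminus, Cplus, Copp, RtoC, a, b, Re, Im; simpl; ring).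
  assert (R1 : Rabs ((exp a - 1 - a) - exp a * (1 - cos b)) <= r ^ 2 * exp r + exp r * (r ^ 2 / 2)).
  { eapply Rle_trans; [apply Rabs_triang|]. rewrite Rabs_Ropp, Rabs_mult, (Rabs_pos_eq (exp a)) by (left; apply exp_pos).
    apply Rplus_le_compat.
    - eapply Rle_trans; [exact M2|]. apply Rmult_le_compat; auto; [apply pow2_ge_0|left; apply exp_pos].
    - apply Rmult_le_compat; auto; [left; apply exp_pos|apply Rabs_pos|].
      eapply Rle_trans; [apply one_minus_cos_le_sqr|]. lra. }
  assert (R2 : Rabs ((exp a - 1) * sin b + (sin b - b)) <= r * exp r * r + r ^ 2).
  { eapply Rle_trans; [apply Rabs_triang|]. rewrite Rabs_mult. apply Rplus_le_compat.
    - apply Rmult_le_compat; try apply Rabs_pos.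
      + eapply Rle_trans; [apply M1|]. apply Rmult_le_compat; auto; [apply Rabs_pos|left; apply exp_pos].
      + eapply Rle_trans; [apply Rabs_sin_le|auto].
    - eapply Rle_trans; [apply sin_minus_id_le|auto]. }
  replace (r * exp r * r) with (r ^ 2 * exp r) in R2 by ring.
  assert (r ^ 2 <= r ^ 2 * exp r) by nra. lra.
Qed.

Lemma RtoC_m1 : RtoC (-1) = (- RtoC 1)%C.
Proof. unfold RtoC, Copp; simpl. f_equal; ring. Qed.

(** The complex counterpart of [is_derive_quadratic], for differentiating the Mellin integral in
    s. *)
Lemma C_is_derive_quadratic (F : C -> C) (s l : C) (K : R) :
  (forall h, Cmod h <= 1 -> Cmod (F (s + h) - F s - h * l)%C <= K * Cmod h ^ 2) ->
  @ex_derive C_AbsRing C_NormedModule F s.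
Proof.
  intros H. exists l. split; [apply is_linear_scal_l|].
  (* [ex_derive] asks for the estimate at every limit x of the filter [locally s]; the only one is
     s. *)
  intros x Hx.
  pose proof (is_filter_lim_locally_unique (V := AbsRing_NormedModule C_AbsRing) s x Hx) as Ex. subst x.
  intros [eps He]. simpl.
  assert (HK : 0 < Rabs K + 1) by (pose proof (Rabs_pos K); lra).
  assert (Hd : 0 < Rmin 1 (eps / (Rabs K + 1))).
  { apply Rmin_glb_lt; [lra|]. now apply Rdiv_lt_0_compat. }
  exists (mkposreal _ Hd). intros y Hy.
  set (h := (y - s)%C).
  assert (Hh : Cmod h < Rmin 1 (eps / (Rabs K + 1))) by exact Hy.
  assert (H1 : Cmod h <= 1) by (pose proof (Rmin_l 1 (eps / (Rabs K + 1))); lra).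
  assert (H2 : Cmod h <= eps / (Rabs K + 1)) by (pose proof (Rmin_r 1 (eps / (Rabs K + 1))); lra).
  specialize (H h H1).
  assert (Ey : forall u v : C, (u + (v - u))%C = v) by (intros; ring).
  specialize (Ey s y). fold h in Ey. rewrite Ey in H.
  change (Cmod (F y - F s - h * l)%C <= eps * Cmod h).
  eapply Rle_trans; [exact H|]. pose proof (Cmod_ge_0 h) as H0.
  apply Rle_trans with ((Rabs K + 1) * Cmod h * Cmod h).
  - pose proof (Rle_abs K). simpl. nra.
  - apply Rmult_le_compat_r; auto.
    apply Rle_trans with ((Rabs K + 1) * (eps / (Rabs K + 1))); [apply Rmult_le_compat_l; lra|].
    right. field. lra.
Qed.

Definition mellin_exponent (chi : Z -> R) (s : C) : C := ((s + RtoC (INR (delta chi))) / RtoC 2)%C.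

Definition Lstar_integrand (q : nat) (chi : Z -> R) (s : C) (x : R) : C :=
  (RtoC (theta q chi x) * RCpower x (mellin_exponent chi s - 1))%C.

Definition Lstar_fun (q : nat) (chi : Z -> R) (s : C) : C :=
  (RtoC (1 / 2) * CRInt_0_infty (Lstar_integrand q chi s))%C.

(** The spare factor u^N is room for logarithms: N = 0 gives existence of the integral, N = 3 its
    differentiability in s. *)
Lemma Lstar_integrand_bound (q : nat) (chi : Z -> R) (s : C) (N : nat) :
  (1 < q)%nat -> real_dirichlet_character q chi -> primitive_character q chi ->
  (forall x, 0 < x -> 0 < theta q chi x) ->
  exists K, 0 < K /\ forall x, 0 < x ->
    Cmod (Lstar_integrand q chi s x) * (x + 1 / x) ^ N <= K * dom 1 x.
Proof.
  intros Hq H Hprim Hpos. destruct (theta_bound q chi Hq H Hprim Hpos) as [c [K1 [Hc [HK1 H1]]]].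
  destruct (kernel_power_dom c (Re (mellin_exponent chi s - 1)%C) (4 + N) Hc) as [K2 [HK2 H2]].
  exists (K1 * K2). split; [now apply Rmult_lt_0_compat|]. intros x Hx.
  specialize (H1 x Hx). specialize (H2 x Hx). specialize (Hpos x Hx).
  unfold Lstar_integrand. rewrite Cmod_mult, Cmod_RCpower, Cmod_RtoC_pos by lra.
  destruct (add_inv_bounds x Hx) as [B1 _]. set (u := x + 1 / x) in *.
  set (P := Rpower x (Re (mellin_exponent chi s - 1)%C)) in *. assert (HP : 0 < P) by apply exp_pos.
  assert (Hu : 0 < u ^ N) by (apply pow_lt; lra).
  apply Rle_trans with (K1 * (exp (- (c * u)) * u ^ 4) * P * u ^ N).
  - apply Rmult_le_compat_r; [lra|]. apply Rmult_le_compat_r; lra.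
  - rewrite pow_add in H2.
    replace (K1 * (exp (- (c * u)) * u ^ 4) * P * u ^ N)
      with (K1 * (exp (- (c * u)) * (u ^ 4 * u ^ N) * P)) by ring.
    rewrite (Rmult_assoc K1 K2). apply Rmult_le_compat_l; lra.
Qed.

Lemma Ccont0_Lstar_integrand (q : nat) (chi : Z -> R) (s : C) :
  (1 < q)%nat -> real_dirichlet_character q chi -> Ccont0 (Lstar_integrand q chi s).
Proof.
  intros Hq H. apply Ccont0_mult; [|apply Ccont0_RCpower]. now apply Ccont0_RtoC, cont0_theta.
Qed.

Lemma is_Cint_Lstar (q : nat) (chi : Z -> R) (s : C) :
  (1 < q)%nat -> real_dirichlet_character q chi -> primitive_character q chi ->
  (forall x, 0 < x -> 0 < theta q chi x) ->
  is_Cint (Lstar_integrand q chi s) (RtoC 2 * Lstar_fun q chi s)%C.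
Proof.
  intros Hq H Hprim Hpos. destruct (Lstar_integrand_bound q chi s 0 Hq H Hprim Hpos) as [K [HK HB]].
  destruct (ex_Cint_dom (Lstar_integrand q chi s) 1 K Rlt_0_1 (Ccont0_Lstar_integrand q chi s Hq H)) as [l Hl].
  - intros t Ht. specialize (HB t Ht). simpl in HB. lra.
  - unfold Lstar_fun. rewrite (is_Cint_CRInt _ _ Hl), Cmult_assoc, <- RtoC_mult.
    replace (2 * (1 / 2)) with 1 by field. now rewrite Cmult_1_l.
Qed.

(** Passing from s to s + h multiplies the integrand by exp(z) with z = h ln(x) / 2. For |h| <= 1
    one has |z| <= |h| u and exp|z| <= u, so the second-order remainder of exp(z) costs 4 |h|^2
    u^3. *)
Lemma Lstar_entire (q : nat) (chi : Z -> R) :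
  (1 < q)%nat -> real_dirichlet_character q chi -> primitive_character q chi ->
  (forall x, 0 < x -> 0 < theta q chi x) -> entire (Lstar_fun q chi).
Proof.
  intros Hq H Hprim Hpos s.
  destruct (Lstar_integrand_bound q chi s 3 Hq H Hprim Hpos) as [K [HK HB]].
  destruct (is_int_dom 1 Rlt_0_1) as [I HI].
  assert (Hlnu : forall x, 0 < x -> Rabs (ln x / 2) <= x + 1 / x /\ exp (Rabs (ln x / 2)) <= x + 1 / x).
  { intros x Hx. destruct (add_inv_bounds x Hx) as [B1 _].
    assert (E : Rabs (ln x / 2) <= ln (x + 1 / x)).
    { unfold Rdiv at 1. rewrite Rabs_mult, (Rabs_pos_eq (/ 2)) by lra.
      pose proof (Rabs_ln_le x Hx). pose proof (Rabs_pos (ln x)). lra. }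
    split.
    - eapply Rle_trans; [exact E|]. pose proof (exp_ineq1_le (ln (x + 1 / x))) as B.
      rewrite exp_ln in B by lra. lra.
    - apply Rle_trans with (exp (ln (x + 1 / x))); [now apply exp_le|]. rewrite exp_ln; lra. }
  set (g := fun x => (Lstar_integrand q chi s x * RtoC (ln x / 2))%C).
  assert (Hgc : Ccont0 g).
  { apply Ccont0_mult; [now apply Ccont0_Lstar_integrand|]. apply Ccont0_RtoC, cont0_derivable.
    intros x Hx. auto_derive. lra. }
  destruct (ex_Cint_dom g 1 K Rlt_0_1 Hgc) as [l Hl].
  { intros t Ht. eapply Rle_trans; [|apply (HB t Ht)]. unfold g. rewrite Cmod_mult, Cmod_R.
    apply Rmult_le_compat_l; [apply Cmod_ge_0|]. destruct (add_inv_bounds t Ht) as [B1 _].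
    apply Rle_trans with ((t + 1 / t) ^ 1); [rewrite pow_1; now apply Hlnu|].
    apply Rle_pow; [lra|lia]. }
  apply (C_is_derive_quadratic _ s (RtoC (1 / 2) * l)%C (4 * K * I)).
  intros h Hh.
  pose proof (is_Cint_Lstar q chi s Hq H Hprim Hpos) as I0.
  pose proof (is_Cint_Lstar q chi (s + h)%C Hq H Hprim Hpos) as I1.
  pose proof (is_Cint_plus _ _ _ _ (is_Cint_plus _ _ _ _ I1 (is_Cint_scal _ (RtoC (-1)) _ I0))
                (is_Cint_scal _ (- h)%C _ Hl)) as J.
  set (z := fun x => (h * RtoC (ln x / 2))%C).
  assert (Hbound : Cmod (RtoC 2 * Lstar_fun q chi (s + h) + RtoC (-1) * (RtoC 2 * Lstar_fun q chi s) + - h * l)%C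
            <= 2 * (4 * Cmod h ^ 2 * K * I)).
  { refine (is_Cint_norm _ (fun x => 4 * Cmod h ^ 2 * K * dom 1 x) _ _ _ J (is_int_scal _ _ _ HI)).
    intros x Hx. cbv beta.
    assert (E : Lstar_integrand q chi (s + h)%C x = (Lstar_integrand q chi s x * Cexp (z x))%C).
    { unfold Lstar_integrand. rewrite <- Cmult_assoc. f_equal. unfold RCpower. rewrite <- Cexp_plus. f_equal.
      unfold z, mellin_exponent. replace (RtoC (ln x / 2)) with (RtoC (ln x) / RtoC 2)%C.
      - field.
      - rewrite <- RtoC_div; [reflexivity|lra]. }
    rewrite E. unfold g.
    replace (Lstar_integrand q chi s x * Cexp (z x) + RtoC (-1) * Lstar_integrand q chi s x +
       - h * (Lstar_integrand q chi s x * RtoC (ln x / 2)))%C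
      with (Lstar_integrand q chi s x * (Cexp (z x) - RtoC 1 - z x))%C
      by (unfold z; rewrite RtoC_m1; ring).
    rewrite Cmod_mult. destruct (Hlnu x Hx) as [L1 L2]. destruct (add_inv_bounds x Hx) as [B1 _].
    set (u := x + 1 / x) in *.
    assert (Hz : Cmod (z x) <= Cmod h * u).
    { unfold z. rewrite Cmod_mult, Cmod_R. apply Rmult_le_compat_l; [apply Cmod_ge_0|auto]. }
    assert (Hze : exp (Cmod (z x)) <= u).
    { eapply Rle_trans; [|exact L2]. apply exp_le. unfold z. rewrite Cmod_mult, Cmod_R.
      pose proof (Rabs_pos (ln x / 2)). pose proof (Cmod_ge_0 h). nra. }
    specialize (HB x Hx). fold u in HB. pose proof (Cmod_ge_0 (Lstar_integrand q chi s x)) as HL.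
    apply Rle_trans with (Cmod (Lstar_integrand q chi s x) * (4 * ((Cmod h * u) ^ 2 * u))).
    - apply Rmult_le_compat_l; auto. eapply Rle_trans; [apply Cmod_Cexp_remainder|].
      apply Rmult_le_compat_l; [lra|]. apply Rmult_le_compat; auto.
      + apply pow2_ge_0.
      + left; apply exp_pos.
      + apply pow_incr. split; [apply Cmod_ge_0|auto].
    - replace (Cmod (Lstar_integrand q chi s x) * (4 * ((Cmod h * u) ^ 2 * u)))
        with (4 * Cmod h ^ 2 * (Cmod (Lstar_integrand q chi s x) * u ^ 3)) by ring.
      rewrite (Rmult_assoc (4 * Cmod h ^ 2)). apply Rmult_le_compat_l; auto.
      pose proof (pow2_ge_0 (Cmod h)). lra. }
  replace (Lstar_fun q chi (s + h) - Lstar_fun q chi s - h * (RtoC (1 / 2) * l))%C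
    with (RtoC (1 / 2) * (RtoC 2 * Lstar_fun q chi (s + h) + RtoC (-1) * (RtoC 2 * Lstar_fun q chi s) + - h * l))%C.
  - rewrite Cmod_mult, Cmod_RtoC_pos by lra. lra.
  - replace (RtoC (1 / 2)) with (/ RtoC 2)%C by (rewrite <- RtoC_inv by lra; f_equal; field).
    rewrite RtoC_m1. field.
Qed.

(** [F] is an antiderivative of t^(-p); by the mean value theorem its increments dominate the terms,
    and they telescope. *)
Lemma ex_series_Rpower (p : R) : 1 < p -> ex_series (fun n => Rpower (INR (S n)) (- p)).
Proof.
  intros Hp. set (e := p - 1). set (F := fun t => - / e * Rpower t (- e)).
  assert (Hb : forall n, Rpower (INR (S (S n))) (- p) <= F (INR (S (S n))) - F (INR (S n))).
  { intro n. set (x := INR (S n)). assert (Hx : 0 < x) by (apply lt_0_INR; lia).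
    rewrite (S_INR (S n)). fold x.
    destruct (MVT_gen F x (x + 1) (fun t => Rpower t (- p))) as [c [Hc E]].
    - intros t Ht. rewrite Rmin_left in Ht by lra. unfold F, Rpower. auto_derive; [lra|].
      replace (- p * ln t) with (- e * ln t + - ln t) by (unfold e; ring).
      rewrite exp_plus, exp_Ropp, exp_ln by lra. field. unfold e. lra.
    - intros t Ht. rewrite Rmin_left in Ht by lra. apply continuity_pt_filterlim.
      apply (ex_derive_continuous (V := R_NormedModule)). unfold F, Rpower. auto_derive. lra.
    - rewrite Rmin_left, Rmax_right in Hc by lra. rewrite E.
      replace (x + 1 - x) with 1 by ring. rewrite Rmult_1_r.
      unfold Rpower. apply exp_le.
      assert (ln c <= ln (x + 1)) by (destruct (proj2 Hc) as [L| ->]; [left; apply ln_increasing; lra|lra]).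
      nra. }
  assert (HF : forall x, 0 < x -> F x < 0).
  { intros x Hx. unfold F. assert (0 < / e) by (apply Rinv_0_lt_compat; unfold e; lra).
    assert (0 < Rpower x (- e)) by apply exp_pos. nra. }
  apply ex_series_incr_1.
  apply (ex_series_bounded _ (- F 1)).
  - intro k. left. apply exp_pos.
  - intro n. apply Rle_trans with (F (INR (S (S n))) - F 1).
    + induction n as [|n IH].
      * rewrite sum_O. apply (Hb 0%nat).
      * rewrite sum_Sn_R. specialize (Hb (S n)). lra.
    + specialize (HF (INR (S (S n))) ltac:(apply lt_0_INR; lia)). lra.
Qed.

Lemma is_Cseries_dirichlet (q : nat) (chi : Z -> R) (s : C) :
  (1 < q)%nat -> real_dirichlet_character q chi -> 1 < Re s ->
  is_Cseries (dirichlet_term chi s) (CSeries (dirichlet_term chi s)).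
Proof.
  intros Hq H Hs. apply (is_Cseries_abs _ (fun n => Rpower (INR (S n)) (- Re s))).
  - intro n. unfold dirichlet_term. rewrite Cmod_mult, Cmod_R, Cmod_RCpower.
    replace (Re (- s)%C) with (- Re s) by reflexivity.
    pose proof (chi_bound q chi (Z.of_nat (S n)) ltac:(lia) H).
    assert (0 < Rpower (INR (S n)) (- Re s)) by apply exp_pos. nra.
  - now apply ex_series_Rpower.
Qed.

Lemma CSeries_RtoC_mult (r : nat -> R) (z : C) :
  CSeries (fun n => RtoC (r n) * z)%C = (RtoC (Series r) * z)%C.
Proof.
  unfold CSeries. transitivity (Series r * Re z, Series r * Im z)%R.
  - rewrite <- !Series_scal_r. f_equal; apply Series_ext; intro n; unfold Re, Im, Cmult, RtoC; simpl; ring.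
  - unfold Cmult, RtoC, Re, Im; simpl. f_equal; ring.
Qed.

Lemma Re_mellin_exponent (chi : Z -> R) (s : C) : Re (mellin_exponent chi s) = (Re s + INR (delta chi)) / 2.
Proof.
  unfold mellin_exponent, Cdiv. rewrite <- RtoC_inv by lra.
  unfold Re, Cmult, Cplus, RtoC; simpl. field.
Qed.

Lemma Re_minus_1 (w : C) : Re (w - 1)%C = Re w - 1.
Proof. unfold Re, Cminus, Cplus, Copp, RtoC; simpl. ring. Qed.

(* The left-hand side is the Mellin transform at [w] of the term of index [S n] of theta. *)
Lemma mellin_term (q : nat) (chi : Z -> R) (s : C) (n : nat) :
  (1 < q)%nat ->
  let w := mellin_exponent chi s in
  (RtoC (INR (S n) ^ delta chi * chi (Z.of_nat (S n))) *
     (RCpower (PI * INR (S n) ^ 2 / INR q) (- w) * Gamma w))%C =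
  (RCpower (INR q) w * RCpower PI (- w) * Gamma w * dirichlet_term chi s n)%C.
Proof.
  intros Hq w. assert (HQ : 0 < INR q) by (apply lt_0_INR; lia). assert (Hpi : 0 < PI) by exact PI_RGT_0.
  set (N := INR (S n)). assert (HN : 0 < N) by (apply lt_0_INR; lia).
  assert (HN2 : 0 < N ^ 2) by now apply pow_lt.
  unfold dirichlet_term. fold N. unfold Rdiv.
  rewrite (RCpower_mult (PI * N ^ 2)) by (try apply Rmult_lt_0_compat; auto; now apply Rinv_0_lt_compat).
  rewrite (RCpower_mult PI) by auto.
  rewrite RCpower_inv_base by auto. replace (- - w)%C with w by ring.
  assert (E : (RtoC (N ^ delta chi) * RCpower (N ^ 2) (- w) = RCpower N (- s))%C).
  { rewrite <- (Rpower_pow (delta chi) N HN), <- RCpower_RtoC.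
    replace (N ^ 2) with (N * N) by ring. rewrite RCpower_mult, <- !RCpower_plus by auto. f_equal.
    unfold w, mellin_exponent. field. }
  rewrite <- E, RtoC_mult. ring.
Qed.

(** Each term of theta has a Gamma integral as Mellin transform. The interchange is justified by
    integrals of absolute values, which are Gamma integrals at the real exponent Re w. *)
Lemma Lstar_dirichlet (q : nat) (chi : Z -> R) (s : C) :
  (1 < q)%nat -> real_dirichlet_character q chi -> primitive_character q chi ->
  (forall x, 0 < x -> 0 < theta q chi x) -> 1 < Re s ->
  let w := mellin_exponent chi s in
  Cex_series (dirichlet_term chi s) /\
  Lstar_fun q chi s =
    (RCpower (INR q) w * RCpower PI (- w) * Gamma w * CSeries (dirichlet_term chi s))%C.
Proof.
  intros Hq H Hprim Hpos Hs w.
  pose proof (is_Cseries_dirichlet q chi s Hq H Hs) as Hdir.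
  split; [exact (proj1 (is_Cseries_correct _ _ Hdir))|].
  assert (HQ : 0 < INR q) by (apply lt_0_INR; lia). assert (Hpi : 0 < PI) by exact PI_RGT_0.
  set (d := delta chi). set (sg := Re w).
  assert (Hsg : sg = (Re s + INR d) / 2) by apply Re_mellin_exponent.
  assert (Hsg0 : 0 < sg) by (rewrite Hsg; pose proof (pos_INR d); lra).
  assert (Hd : (d <= 1)%nat) by (apply (chi_opp q chi 0); auto).
  set (k := fun n => PI * INR (S n) ^ 2 / INR q).
  assert (HN : forall n, 0 < INR (S n)) by (intro; apply lt_0_INR; lia).
  assert (Hk : forall n, 0 < k n).
  { intro n. apply Rdiv_lt_0_compat; auto. apply Rmult_lt_0_compat; auto. apply pow_lt, HN. }
  assert (Hkg : forall n x, exp (- (k n * x)) = gauss (PI * x / INR q) (INR (S n))).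
  { intros n x. unfold gauss, k. do 2 f_equal. field. lra. }
  set (f := fun n x => (RtoC (theta_term q chi (S n) x) * RCpower x (w - 1))%C).
  assert (Hfc : forall n, Ccont0 (f n)).
  { intro n. apply Ccont0_mult; [|apply Ccont0_RCpower]. apply Ccont0_RtoC, cont0_derivable.
    intros x _. unfold theta_term, gauss. auto_derive; auto. }
  set (D := fun n x => INR (S n) ^ d * (exp (- (k n * x)) * Rpower x (sg - 1))).
  assert (HfD : forall n x, 0 < x -> Cmod (f n x) <= D n x).
  { intros n x Hx. unfold f, D. rewrite Cmod_mult, Cmod_R, Cmod_RCpower, Re_minus_1. fold sg.
    rewrite <- Rmult_assoc, Hkg. apply Rmult_le_compat_r; [left; apply exp_pos|].
    now apply theta_term_bound. }
  assert (HDc : forall n, cont0 (D n)).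
  { intro n. apply cont0_derivable. intros x Hx. unfold D, Rpower. auto_derive. auto. }
  assert (HG : forall n, is_int (fun x => exp (- (k n * x)) * Rpower x (sg - 1))
                 (Rpower (k n) (- sg) * Re (Gamma (RtoC sg)))).
  { intro n. pose proof (proj1 (is_Cint_Gamma_scale (RtoC sg) (k n) Hsg0 (Hk n))) as G.
    replace (Rpower (k n) (- sg) * Re (Gamma (RtoC sg)))
      with (Re (RCpower (k n) (- RtoC sg) * Gamma (RtoC sg))%C).
    - eapply is_int_ext; [|exact G]. intros x Hx. cbv beta.
      rewrite <- RtoC_minus, RCpower_RtoC. unfold Re, Cmult, RtoC; simpl. ring.
    - rewrite <- RtoC_opp, RCpower_RtoC. unfold Re, Cmult, RtoC; simpl. ring. }
  (* In the variable N = n + 1 this is a constant times N^(d - 2 sg) = N^(-Re s), which is summable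
     exactly in the half-plane considered. *)
  set (I := fun n => INR (S n) ^ d * (Rpower (k n) (- sg) * Re (Gamma (RtoC sg)))).
  assert (HDI : forall n, is_int (D n) (I n)) by (intro n; now apply is_int_scal).
  assert (HI : ex_series I).
  { apply (ex_series_ext (fun n => Rpower (PI / INR q) (- sg) * Re (Gamma (RtoC sg)) * Rpower (INR (S n)) (- Re s))).
    - intro n. unfold I, k. req.
      replace (PI * INR (S n) ^ 2 / INR q) with (PI / INR q * (INR (S n) * INR (S n))) by (field; lra).
      rewrite <- (Rpower_mult_distr (PI / INR q)) by (try apply Rmult_lt_0_compat; auto; now apply Rinv_0_lt_compat).
      rewrite <- (Rpower_mult_distr (INR (S n)) (INR (S n))) by auto.
      rewrite <- (Rpower_pow d) by auto.
      replace (- Re s) with (INR d + - sg + - sg) by (rewrite Hsg; field).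
      rewrite !Rpower_plus. ring.
    - apply ex_series_Rscal. now apply ex_series_Rpower. }
  assert (HM : Clocal_Mtest f).
  { intros a b Hab. destruct (nat_above (Rabs (sg - 1))) as [N HNN].
    set (kap := PI * a / INR q). assert (Hkap : 0 < kap) by (apply theta_kappa_pos; auto; lra).
    (* On [a, b] one has t + 1/t <= b + 1/a, so B bounds t^(sg - 1). *)
    set (B := (b + 1 / a) ^ N).
    exists (fun n => B * ((1 + 2 / kap) * exp (- (kap / 4)) ^ S n)). split.
    - apply ex_series_Rscal.
      apply (ex_series_incr_1 (fun n => (1 + 2 / kap) * exp (- (kap / 4)) ^ n)).
      apply ex_series_exp_neg. lra.
    - intros n t Ht. eapply Rle_trans; [apply HfD; lra|]. unfold D.
      assert (E1 : exp (- (k n * t)) <= gauss kap (INR (S n))).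
      { unfold kap. rewrite <- (Hkg n a). apply exp_le. specialize (Hk n). nra. }
      assert (E2 : Rpower t (sg - 1) <= B).
      { eapply Rle_trans; [apply (Rpower_le_pow t (sg - 1) N); auto; lra|]. unfold B. apply pow_incr.
        destruct (add_inv_bounds t ltac:(lra)) as [B1 _]. split; [lra|].
        apply Rplus_le_compat; [lra|]. unfold Rdiv. rewrite !Rmult_1_l. apply Rinv_le_contravar; lra. }
      pose proof (pow_delta_gauss_le d kap (S n) Hd Hkap) as E3.
      assert (0 <= INR (S n) ^ d) by (apply pow_le, pos_INR).
      assert (0 < exp (- (k n * t))) by apply exp_pos. assert (0 < Rpower t (sg - 1)) by apply exp_pos.
      apply Rle_trans with (Rpower t (sg - 1) * (INR (S n) ^ d * gauss kap (INR (S n)))).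
      + replace (INR (S n) ^ d * (exp (- (k n * t)) * Rpower t (sg - 1)))
          with (Rpower t (sg - 1) * (INR (S n) ^ d * exp (- (k n * t)))) by ring.
        apply Rmult_le_compat_l; [lra|]. apply Rmult_le_compat_l; auto.
      + apply Rmult_le_compat; auto; [lra|]. apply Rmult_le_pos; auto. left; apply gauss_pos. }
  set (v := fun n => (RtoC (INR (S n) ^ delta chi * chi (Z.of_nat (S n))) * (RCpower (k n) (- w) * Gamma w))%C).
  assert (Hv : forall n, is_Cint (f n) (v n)).
  { intro n. eapply is_Cint_ext; [|exact (is_Cint_scal _ (RtoC (INR (S n) ^ delta chi * chi (Z.of_nat (S n)))) _
      (is_Cint_Gamma_scale w (k n) Hsg0 (Hk n)))].
    intros x Hx. cbv beta. unfold f, theta_term. rewrite Hkg, !RtoC_mult. ring. }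
  destruct (is_Cint_Series f I D v Hfc HM HDc HfD HDI HI Hv) as [Hser Hint].
  assert (Hv2 : CSeries v = (RCpower (INR q) w * RCpower PI (- w) * Gamma w * CSeries (dirichlet_term chi s))%C).
  { pose proof (is_Cseries_scal _ (RCpower (INR q) w * RCpower PI (- w) * Gamma w)%C _ Hdir) as S1.
    rewrite <- (proj2 (is_Cseries_correct _ _ S1)). unfold CSeries.
    f_equal; apply Series_ext; intro n; f_equal; apply (mellin_term q chi s n Hq). }
  rewrite <- Hv2.
  pose proof (is_Cint_scal _ (RtoC (1 / 2)) _ (is_Cint_Lstar q chi s Hq H Hprim Hpos)) as I0.
  apply (is_Cint_unique (fun t => CSeries (fun n => f n t))); auto.
  replace (Lstar_fun q chi s) with (RtoC (1 / 2) * (RtoC 2 * Lstar_fun q chi s))%C.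
  2:{ rewrite Cmult_assoc, <- RtoC_mult. replace (1 / 2 * 2) with 1 by field. apply Cmult_1_l. }
  eapply is_Cint_ext; [|exact I0]. intros x Hx. cbv beta. unfold f, Lstar_integrand. fold w.
  rewrite CSeries_RtoC_mult, Cmult_assoc, <- RtoC_mult. do 2 f_equal.
  rewrite (theta_one_sided q chi x Hq H Hx).
  rewrite (Series_incr_1 (fun n => theta_term q chi n x)).
  - unfold theta_term at 1. change (Z.of_nat 0) with 0%Z. rewrite (chi_0 q chi Hq H). field.
  - apply ex_series_Rabs. now apply ex_series_Rabs_theta_term.
Qed.

(** * The double series *)

Lemma cont0_bounded (f : R -> R) (a b : R) :
  cont0 f -> 0 < a <= b -> exists B, 0 <= B /\ forall t, a <= t <= b -> Rabs (f t) <= B.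
Proof.
  intros Hf Hab. destruct (continuity_ab_maj (fun t => Rabs (f t)) a b) as [x [Hx _]]; [lra| |].
  - intros c Hc. apply continuity_pt_filterlim. apply cont0_Rabs; auto. lra.
  - exists (Rabs (f x)). split; [apply Rabs_pos|exact Hx].
Qed.

(** Expands one factor of a product while the other, [G], is kept. It is used twice: for the sum
    over n with [G] a single term in m, and for the sum over m with [G] the completed sum over n. *)
Lemma weighted_series (r : nat -> R -> R) (G : R -> R) (p : C) (K : R) (v : nat -> C) :
  (forall n, cont0 (r n)) -> cont0 G -> local_Mtest r ->
  (forall x n, 0 < x -> sum_n (fun k => Rabs (r k x)) n * Rabs (G x) * Rpower x (Re p) <= K * dom 1 x) ->
  (forall n, is_Cint (fun x => RtoC (r n x * G x) * RCpower x p)%C (v n)) ->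
  is_Cseries v (CSeries v) /\
  is_Cint (fun x => RtoC (Series (fun n => r n x) * G x) * RCpower x p)%C (CSeries v).
Proof.
  intros Hr HG HM HK Hv. destruct (is_int_dom 1 Rlt_0_1) as [I HI].
  assert (Hmod : forall n x, Cmod (RtoC (r n x * G x) * RCpower x p)%C = Rabs (r n x) * (Rabs (G x) * Rpower x (Re p))).
  { intros n x. rewrite Cmod_mult, Cmod_R, Cmod_RCpower, Rabs_mult. ring. }
  destruct (is_Cint_Series_dominated (fun n x => RtoC (r n x * G x) * RCpower x p)%C v
     (fun x => K * dom 1 x) (K * I)) as [H1 H2].
  - intro n. apply Ccont0_mult; [|apply Ccont0_RCpower]. apply Ccont0_RtoC.
    intros x Hx. apply (continuous_mult (K := R_AbsRing) (r n) G); [now apply Hr|now apply HG].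
  - intros a b Hab. destruct (HM a b Hab) as [M [HM1 HM2]].
    destruct (cont0_bounded (fun x => G x * Rpower x (Re p)) a b) as [B [HB0 HB]]; [|lra|].
    + intros x Hx. apply (continuous_mult (K := R_AbsRing) G (fun x => Rpower x (Re p))); [now apply HG|].
      apply (ex_derive_continuous (V := R_NormedModule)). unfold Rpower. auto_derive. auto.
    + exists (fun n => B * M n). split; [now apply ex_series_Rscal|].
      intros n t Ht. rewrite Hmod. specialize (HB t Ht). specialize (HM2 n t Ht).
      rewrite Rabs_mult, (Rabs_pos_eq (Rpower t _)) in HB by (left; apply exp_pos).
      rewrite (Rmult_comm B). apply Rmult_le_compat; auto; [apply Rabs_pos|].
      apply Rmult_le_pos; [apply Rabs_pos|left; apply exp_pos].
  - intros x Hx. apply (continuous_scal_r (V := R_NormedModule) K (dom 1)). now apply cont0_dom.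
  - now apply is_int_scal.
  - intros n t Ht. eapply Rle_trans; [|apply (HK t n Ht)]. right.
    induction n as [|n IH].
    + rewrite !sum_O, Hmod. ring.
    + rewrite !sum_Sn_R, IH, Hmod. ring.
  - exact Hv.
  - split; auto. eapply is_Cint_ext; [|exact H2]. intros x Hx. cbv beta.
    rewrite CSeries_RtoC_mult. f_equal. f_equal. apply Series_scal_r.
Qed.

Definition power_term (q : nat) (c : nat -> R) (alpha : R) (m : nat) (x : R) : R :=
  c m * exp (- (PI * (INR m + alpha) * x / INR q)).

Lemma cont0_power_term (q : nat) (c : nat -> R) (alpha : R) (m : nat) : cont0 (power_term q c alpha m).
Proof.
  apply cont0_derivable. intros x _. unfold power_term. auto_derive; auto.
Qed.

(** Values at the left end of an interval thus provide the majorants of [local_Mtest]. *)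
Lemma power_term_decreasing (q : nat) (c : nat -> R) (alpha : R) (m : nat) (a t : R) :
  (1 < q)%nat -> 0 < alpha -> a <= t ->
  Rabs (power_term q c alpha m t) <= Rabs (power_term q c alpha m a).
Proof.
  intros Hq Hal Hat. unfold power_term. rewrite !Rabs_mult.
  rewrite !(Rabs_pos_eq (exp _)) by (left; apply exp_pos).
  apply Rmult_le_compat_l; [apply Rabs_pos|]. apply exp_le.
  assert (HQ : 0 < / INR q) by (apply Rinv_0_lt_compat, lt_0_INR; lia).
  assert (Hpi : 0 < PI) by exact PI_RGT_0. pose proof (pos_INR m).
  unfold Rdiv. apply Ropp_le_contravar. apply Rmult_le_compat_r; [lra|].
  apply Rmult_le_compat_l; [|auto]. apply Rmult_le_pos; lra.
Qed.

(** The integrand of L* equals V(x) U(1/x) x^(e/2 - 1), where V and U are the expansions for alpha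
    and beta without their powers of 2. U(1/x) is expanded inside each term of V, in the order of
    the iterated series. *)
Lemma theta_double_series (q : nat) (chi : Z -> R) (alpha beta : R) (ca cb : nat -> R) (s : C) :
  (1 < q)%nat -> real_dirichlet_character q chi -> primitive_character q chi ->
  (forall x, 0 < x -> 0 < theta q chi x) ->
  0 < alpha -> 0 < beta -> alpha + beta = 1 ->
  theta_power_coeffs q chi alpha ca -> theta_power_coeffs q chi beta cb ->
  let e := (s - RtoC beta + RtoC (INR (delta chi) * (alpha - beta)))%C in
  let term (m n : nat) : C :=
    (RtoC (ca m * cb n) * RCpower ((INR n + beta) / (INR m + alpha)) (e / RtoC 4)
     * BesselK (e / RtoC 2) (2 * PI / INR q * sqrt ((INR m + alpha) * (INR n + beta))))%C in
  Cex_iterated_series term /\ Lstar_fun q chi s = (RtoC 2 * CSeries_iterated term)%C.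
Proof.
  intros Hq H Hprim Hpos Hal Hbe Hab Hca Hcb e term.
  assert (HQ : 0 < INR q) by (apply lt_0_INR; lia). assert (Hpi : 0 < PI) by exact PI_RGT_0.
  assert (HpQ : 0 < PI / INR q) by now apply Rdiv_lt_0_compat.
  destruct (theta_power_coeffs_bound q chi alpha ca Hq H Hpos ltac:(lra) Hca) as [Ka [HKa Ba]].
  destruct (theta_power_coeffs_bound q chi beta cb Hq H Hpos ltac:(lra) Hcb) as [Kb [HKb Bb]].
  set (va := power_term q ca alpha). set (ub := power_term q cb beta).
  set (mu := (e / RtoC 2)%C). set (p := (mu - 1)%C).
  set (U := fun y => Series (fun n => ub n y)). set (V := fun y => Series (fun m => va m y)).
  assert (Hinv : forall x, 0 < x -> 0 < 1 / x) by (intros x Hx; apply Rdiv_lt_0_compat; lra).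
  assert (Hinvc : cont0 (fun x => 1 / x)) by (apply cont0_derivable; intros x Hx; auto_derive; lra).
  assert (HMa : local_Mtest va).
  { intros a b Hab'. exists (fun n => Rabs (va n a)). split; [apply Ba; lra|].
    intros n t Ht. apply power_term_decreasing; auto. lra. }
  assert (HMb : local_Mtest ub).
  { intros a b Hab'. exists (fun n => Rabs (ub n a)). split; [apply Bb; lra|].
    intros n t Ht. apply power_term_decreasing; auto. lra. }
  (* On [a, b] the argument 1/x is at least 1/b, where the terms are largest. *)
  assert (HMb' : local_Mtest (fun n x => ub n (1 / x))).
  { intros a b Hab'. exists (fun n => Rabs (ub n (1 / b))). split; [apply Bb; apply Hinv; lra|].
    intros n t Ht. apply power_term_decreasing; auto. unfold Rdiv. rewrite !Rmult_1_l.
    apply Rinv_le_contravar; lra. }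
  assert (HUc : cont0 (fun x => U (1 / x))).
  { intros x Hx. apply (continuous_comp (fun x => 1 / x) U); [now apply Hinvc|].
    apply (cont0_Series ub); auto. intro n; apply cont0_power_term. }
  assert (Hubc : forall n, cont0 (fun x => ub n (1 / x))).
  { intros n x Hx. apply (continuous_comp (fun x => 1 / x) (ub n)); [now apply Hinvc|].
    apply cont0_power_term; auto. }
  assert (Hsa : forall x n, 0 < x -> sum_n (fun k => Rabs (va k x)) n <=
      Ka * (exp (- (PI * alpha / INR q * x)) * (1 + 1 / x) ^ 3)).
  { intros x n Hx. destruct (Ba x Hx) as [E1 E2]. eapply Rle_trans; [|exact E2].
    apply sum_n_le_Series; auto. intro; apply Rabs_pos. }
  assert (Hsb : forall x n, 0 < x -> sum_n (fun k => Rabs (ub k (1 / x))) n <=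
      Kb * (exp (- (PI * beta / INR q * (1 / x))) * (1 + x) ^ 3)).
  { intros x n Hx. destruct (Bb (1 / x) (Hinv x Hx)) as [E1 E2].
    replace (1 / (1 / x)) with x in E2 by (field; lra).
    eapply Rle_trans; [|exact E2]. apply (sum_n_le_Series (fun k => Rabs (ub k (1 / x)))); auto.
    intro; apply Rabs_pos. }
  assert (Hva1 : forall m x, 0 < x -> Rabs (va m x) <= Ka * (exp (- (PI * alpha / INR q * x)) * (1 + 1 / x) ^ 3)).
  { intros m x Hx. eapply Rle_trans; [|apply (Hsa x m Hx)]. destruct m as [|m]; [rewrite sum_O; lra|].
    rewrite sum_Sn_R. pose proof (sum_n_ge_0 (fun k => Rabs (va k x)) m (fun k => Rabs_pos _)). lra. }
  assert (HU1 : forall x, 0 < x -> Rabs (U (1 / x)) <= Kb * (exp (- (PI * beta / INR q * (1 / x))) * (1 + x) ^ 3)).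
  { intros x Hx. destruct (Bb (1 / x) (Hinv x Hx)) as [E1 E2].
    replace (1 / (1 / x)) with x in E2 by (field; lra).
    eapply Rle_trans; [|exact E2]. now apply Series_Rabs. }
  set (c := PI / INR q * Rmin alpha beta).
  assert (Hmin : 0 < Rmin alpha beta) by now apply Rmin_glb_lt.
  assert (Hc : 0 < c) by now apply Rmult_lt_0_compat.
  destruct (kernel_power_dom c (Re p) 6 Hc) as [K [HK HKb']].
  (* Each polynomial factor is at most (2u)^3, together 64 u^6. The two exponentials combine to at
     most exp(-c u) since alpha x + beta / x >= min(alpha, beta) u, so they defeat the growth at
     both ends. *)
  assert (Hprod : forall x A B, 0 < x -> 0 <= A -> 0 <= B ->
     A <= Ka * (exp (- (PI * alpha / INR q * x)) * (1 + 1 / x) ^ 3) ->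
     B <= Kb * (exp (- (PI * beta / INR q * (1 / x))) * (1 + x) ^ 3) ->
     A * B * Rpower x (Re p) <= Ka * Kb * 64 * K * dom 1 x).
  { intros x A B Hx HA HB HA' HB'. destruct (add_inv_bounds x Hx) as [B1 [B2 B3]].
    specialize (HKb' x Hx). set (u := x + 1 / x) in *. pose proof (Hinv x Hx) as Hix.
    assert (P1 : (1 + 1 / x) ^ 3 <= (2 * u) ^ 3) by (apply pow_incr; lra).
    assert (P2 : (1 + x) ^ 3 <= (2 * u) ^ 3) by (apply pow_incr; lra).
    assert (P0 : 0 <= (2 * u) ^ 3) by (apply pow_le; lra).
    set (ea := exp (- (PI * alpha / INR q * x))) in *. set (eb := exp (- (PI * beta / INR q * (1 / x)))) in *.
    assert (Hea : 0 < ea) by apply exp_pos. assert (Heb : 0 < eb) by apply exp_pos.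
    assert (Hee : ea * eb <= exp (- (c * u))).
    { unfold ea, eb. rewrite <- exp_plus. apply exp_le. unfold c, u.
      pose proof (Rmin_l alpha beta). pose proof (Rmin_r alpha beta).
      replace (PI * alpha / INR q * x) with (PI / INR q * (alpha * x)) by (field; lra).
      replace (PI * beta / INR q * (1 / x)) with (PI / INR q * (beta * (1 / x))) by (field; lra).
      assert (Rmin alpha beta * (x + 1 / x) <= alpha * x + beta * (1 / x)) by nra. nra. }
    assert (HA2 : A <= Ka * (ea * (2 * u) ^ 3)).
    { eapply Rle_trans; [exact HA'|]. apply Rmult_le_compat_l; [lra|]. apply Rmult_le_compat_l; lra. }
    assert (HB2 : B <= Kb * (eb * (2 * u) ^ 3)).
    { eapply Rle_trans; [exact HB'|]. apply Rmult_le_compat_l; [lra|]. apply Rmult_le_compat_l; lra. }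
    assert (HR : 0 < Rpower x (Re p)) by apply exp_pos.
    apply Rle_trans with (Ka * (ea * (2 * u) ^ 3) * (Kb * (eb * (2 * u) ^ 3)) * Rpower x (Re p)).
    - apply Rmult_le_compat_r; [lra|]. apply Rmult_le_compat; auto.
    - replace (Ka * (ea * (2 * u) ^ 3) * (Kb * (eb * (2 * u) ^ 3)) * Rpower x (Re p))
        with (Ka * Kb * 64 * ((ea * eb) * u ^ 6 * Rpower x (Re p))) by ring.
      rewrite (Rmult_assoc _ K). apply Rmult_le_compat_l.
      + assert (0 < Ka * Kb) by now apply Rmult_lt_0_compat. lra.
      + eapply Rle_trans; [|exact HKb']. apply Rmult_le_compat_r; [lra|].
        apply Rmult_le_compat_r; [apply pow_le; lra|auto]. }
  assert (Hterm : forall m n, is_Cint (fun x => RtoC (ub n (1 / x)%R * va m x) * RCpower x p)%C (RtoC 2 * term m n)%C).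
  (* In b/a the factor pi/q cancels, and in 2 sqrt(ab) it comes out of the root. *)
  { intros m n. set (a := PI / INR q * (INR m + alpha)). set (b := PI / INR q * (INR n + beta)).
    pose proof (pos_INR m). pose proof (pos_INR n).
    assert (Ha : 0 < a) by (apply Rmult_lt_0_compat; lra).
    assert (Hb : 0 < b) by (apply Rmult_lt_0_compat; lra).
    pose proof (is_Cint_scal _ (RtoC (ca m * cb n)) _ (is_Cint_two_sided_exp mu a b Ha Hb)) as J.
    replace (RtoC 2 * term m n)%C with
      (RtoC (ca m * cb n) * (RtoC 2 * (RCpower (b / a) (mu / RtoC 2) * BesselK mu (2 * sqrt (a * b)))))%C.
    - eapply is_Cint_ext; [|exact J]. intros x Hx. cbv beta. fold p.
      rewrite Cmult_assoc, <- RtoC_mult. f_equal. f_equal. unfold ub, va, power_term.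
      transitivity (ca m * cb n * (exp (- (PI * (INR n + beta) * (1 / x) / INR q)) * exp (- (PI * (INR m + alpha) * x / INR q)))).
      + rewrite <- exp_plus. do 2 f_equal. unfold a, b. field. lra.
      + ring.
    - unfold term. fold mu.
      replace (b / a) with ((INR n + beta) / (INR m + alpha)) by (unfold a, b; field; lra).
      replace (mu / RtoC 2)%C with (e / RtoC 4)%C.
      2:{ unfold mu. replace (RtoC 4) with (RtoC 2 * RtoC 2)%C by (rewrite <- RtoC_mult; f_equal; ring). field. }
      replace (2 * sqrt (a * b)) with (2 * PI / INR q * sqrt ((INR m + alpha) * (INR n + beta))); [ring|].
      replace (a * b) with ((PI / INR q) ^ 2 * ((INR m + alpha) * (INR n + beta))) by (unfold a, b; ring).
      rewrite (sqrt_mult ((PI / INR q) ^ 2)) by (try apply pow2_ge_0; apply Rmult_le_pos; lra).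
      rewrite sqrt_pow2 by lra. field. lra. }
  assert (Hinner : forall m, is_Cseries (fun n => RtoC 2 * term m n)%C (CSeries (fun n => RtoC 2 * term m n)%C) /\
     is_Cint (fun x => RtoC (va m x * U (1 / x)%R) * RCpower x p)%C (CSeries (fun n => RtoC 2 * term m n)%C)).
  { intro m. destruct (weighted_series (fun n x => ub n (1 / x)) (va m) p (Ka * Kb * 64 * K)
      (fun n => RtoC 2 * term m n)%C Hubc (cont0_power_term q ca alpha m) HMb') as [W1 W2].
    - intros x n Hx. rewrite (Rmult_comm (sum_n _ n)). apply Hprod; auto; try apply Rabs_pos.
      apply sum_n_ge_0. intro; apply Rabs_pos.
    - apply Hterm.
    - split; auto. eapply is_Cint_ext; [|exact W2]. intros x Hx. cbv beta.
      fold (U (1 / x)). now rewrite (Rmult_comm (U (1 / x))). }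
  destruct (weighted_series va (fun x => U (1 / x)) p (Ka * Kb * 64 * K)
      (fun m => CSeries (fun n => RtoC 2 * term m n)%C) (cont0_power_term q ca alpha) HUc HMa) as [O1 O2].
  { intros x n Hx. apply Hprod; auto; try apply Rabs_pos. apply sum_n_ge_0. intro; apply Rabs_pos. }
  { intro m. apply Hinner. }
  assert (Hhalf : forall z : C, (RtoC (1 / 2) * (RtoC 2 * z))%C = z).
  { intro z. rewrite Cmult_assoc, <- RtoC_mult. replace (1 / 2 * 2) with 1 by field. apply Cmult_1_l. }
  assert (Ht1 : forall m, is_Cseries (term m) (RtoC (1 / 2) * CSeries (fun n => RtoC 2 * term m n))%C).
  { intro m. eapply is_Cseries_ext; [|exact (is_Cseries_scal _ (RtoC (1 / 2)) _ (proj1 (Hinner m)))].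
    intro n. apply Hhalf. }
  assert (Ht2 : is_Cseries (fun m => CSeries (term m))
     (RtoC (1 / 2) * CSeries (fun m => CSeries (fun n => RtoC 2 * term m n)))%C).
  { eapply is_Cseries_ext; [|exact (is_Cseries_scal _ (RtoC (1 / 2)) _ O1)].
    intro m. cbv beta. symmetry. apply (is_Cseries_correct _ _ (Ht1 m)). }
  split.
  - split; [intro m; apply (is_Cseries_correct _ _ (Ht1 m))|apply (is_Cseries_correct _ _ Ht2)].
  - unfold CSeries_iterated. rewrite (proj2 (is_Cseries_correct _ _ Ht2)).
    set (S := CSeries (fun m => CSeries (fun n => RtoC 2 * term m n)%C)) in *.
    replace (RtoC 2 * (RtoC (1 / 2) * S))%C with S.
    2:{ rewrite Cmult_assoc, <- RtoC_mult. replace (2 * (1 / 2)) with 1 by field. now rewrite Cmult_1_l. }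
    pose proof (is_Cint_scal _ (RtoC (1 / 2)) _ (is_Cint_Lstar q chi s Hq H Hprim Hpos)) as I0.
    rewrite Hhalf in I0. refine (is_Cint_unique _ _ _ I0 _).
    eapply is_Cint_ext; [|exact O2]. intros x Hx. cbv beta.
    fold (V x). unfold Lstar_integrand. rewrite Cmult_assoc, <- RtoC_mult.
    set (d := delta chi) in *. set (t := theta q chi x).
    assert (Ht : 0 < t) by now apply Hpos.
    assert (Hsx : 0 < sqrt x) by now apply sqrt_lt_R0. assert (Hxd : 0 < x ^ d) by now apply pow_lt.
    assert (EV : Rpower t alpha = Rpower 2 alpha * V x) by apply (Hca x Hx).
    assert (EU : Rpower (theta q chi (1 / x)) beta = Rpower 2 beta * U (1 / x)) by apply (Hcb (1 / x) (Hinv x Hx)).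
    assert (Eth : theta q chi (1 / x) = t * (x ^ d * sqrt x)).
    { unfold t. rewrite (theta_functional_equation q chi Hq H Hprim Hpos x Hx). fold d. field. split; lra. }
    (* The powers of 2 multiply to 2 and those of theta(x) to theta(x), both because alpha + beta =
       1; the power of x is the beta-th power of the factor in the functional equation. *)
    assert (EVU : V x * U (1 / x) = 1 / 2 * t * Rpower x (beta * (INR d + / 2))).
    { assert (E2 : Rpower 2 alpha * Rpower 2 beta = 2) by (rewrite <- Rpower_plus, Hab; apply Rpower_1; lra).
      assert (E3 : Rpower t alpha * Rpower t beta = t) by (rewrite <- Rpower_plus, Hab; now apply Rpower_1).
      assert (E4 : Rpower (x ^ d * sqrt x) beta = Rpower x (beta * (INR d + / 2))).
      { rewrite <- (Rpower_pow d x Hx), <- (Rpower_sqrt x Hx), <- Rpower_plus, Rpower_mult. f_equal. ring. }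
      rewrite Eth, <- Rpower_mult_distr, E4 in EU by (auto; now apply Rmult_lt_0_compat).
      apply (Rmult_eq_reg_l 2); [|lra]. rewrite <- E2 at 1.
      transitivity (Rpower 2 alpha * V x * (Rpower 2 beta * U (1 / x))); [ring|].
      rewrite <- EV, <- EU, <- Rmult_assoc, E3. field. }
    rewrite EVU, RtoC_mult, <- RCpower_RtoC, <- Cmult_assoc, <- RCpower_plus. f_equal. f_equal.
    unfold p, mu, e, mellin_exponent. fold d.
    replace alpha with (1 - beta) by lra.
    replace (RtoC (beta * (INR d + / 2))) with (RtoC beta * (RtoC (INR d) + / RtoC 2))%C
      by (rewrite <- RtoC_inv, <- RtoC_plus, <- RtoC_mult by lra; reflexivity).
    rewrite RtoC_mult, !RtoC_minus. field.
Qed.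

Theorem theorem2 :
  forall (q : nat) (chi : Z -> R),
    (1 < q)%nat ->
    real_dirichlet_character q chi ->
    primitive_character q chi ->
    (forall x : R, 0 < x -> 0 < theta q chi x) ->
    exists Lstar : C -> C,
      is_completed_L q chi Lstar /\
      (forall alpha beta : R, 0 < alpha -> 0 < beta -> alpha + beta = 1 ->
       forall c_alpha c_beta : nat -> R,
         theta_power_coeffs q chi alpha c_alpha ->
         theta_power_coeffs q chi beta c_beta ->
       forall s : C,
         let e : C :=
           (s - RtoC beta + RtoC (INR (delta chi) * (alpha - beta)))%C in
         let term (m n : nat) : C :=
           (RtoC (c_alpha m * c_beta n)
            * RCpower ((INR n + beta) / (INR m + alpha)) (e / RtoC 4)
            * BesselK (e / RtoC 2)
                (2 * PI / INR q * sqrt ((INR m + alpha) * (INR n + beta))))%C in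
         Cex_iterated_series term /\
         Lstar s = (RtoC 2 * CSeries_iterated term)%C) /\
      (forall c : nat -> R,
         theta_power_coeffs q chi (1 / 2) c ->
       forall s : C,
         let term (m n : nat) : C :=
           (RtoC (c m * c n)
            * RCpower ((2 * INR n + 1) / (2 * INR m + 1))
                (s / RtoC 4 - RtoC (1 / 8))
            * BesselK (s / RtoC 2 - RtoC (1 / 4))
                (PI / INR q * sqrt ((2 * INR m + 1) * (2 * INR n + 1))))%C in
         Cex_iterated_series term /\
         Lstar s = (RtoC 2 * CSeries_iterated term)%C).
Proof.
  intros q chi Hq H Hprim Hpos. exists (Lstar_fun q chi). split; [split|split].
  - now apply Lstar_entire.
  - intros s Hs. now apply Lstar_dirichlet.
  - intros alpha beta Hal Hbe Hab ca cb Hca Hcb s. now apply theta_double_series.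
  - intros c Hc s term.
    assert (HQ : 0 < INR q) by (apply lt_0_INR; lia).
    pose proof (theta_double_series q chi (1 / 2) (1 / 2) c c s Hq H Hprim Hpos
      ltac:(lra) ltac:(lra) ltac:(lra) Hc Hc) as T. cbv zeta in T.
    match type of T with Cex_iterated_series ?t /\ _ => set (term' := t) in T end.
    assert (E : forall m n, term' m n = term m n).
    { intros m n. unfold term', term. pose proof (pos_INR m). pose proof (pos_INR n).
      replace (1 / 2 - 1 / 2) with 0 by ring. rewrite Rmult_0_r.
      replace ((INR n + 1 / 2) / (INR m + 1 / 2)) with ((2 * INR n + 1) / (2 * INR m + 1)) by (field; lra).
      replace ((s - RtoC (1 / 2) + RtoC 0) / RtoC 4)%C with (s / RtoC 4 - RtoC (1 / 8))%C.
      2:{ replace (RtoC (1 / 8)) with (RtoC (1 / 2) / RtoC 4)%C by (rewrite <- RtoC_div by lra; f_equal; field).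
          unfold Cdiv. ring. }
      replace ((s - RtoC (1 / 2) + RtoC 0) / RtoC 2)%C with (s / RtoC 2 - RtoC (1 / 4))%C.
      2:{ replace (RtoC (1 / 4)) with (RtoC (1 / 2) / RtoC 2)%C by (rewrite <- RtoC_div by lra; f_equal; field).
          unfold Cdiv. ring. }
      replace (2 * PI / INR q * sqrt ((INR m + 1 / 2) * (INR n + 1 / 2)))
        with (PI / INR q * sqrt ((2 * INR m + 1) * (2 * INR n + 1))); auto.
      (* Clearing the halves puts 2^2 under the root, which accounts for pi/q in place of 2 pi/q. *)
      replace ((2 * INR m + 1) * (2 * INR n + 1)) with (2 ^ 2 * ((INR m + 1 / 2) * (INR n + 1 / 2))) by field.
      rewrite (sqrt_mult (2 ^ 2)) by (try apply pow2_ge_0; apply Rmult_le_pos; lra).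
      rewrite sqrt_pow2 by lra. field. lra. }
    assert (Ef : term' = term).
    { apply FunctionalExtensionality.functional_extensionality. intro m.
      apply FunctionalExtensionality.functional_extensionality. intro n. apply E. }
    rewrite <- Ef. exact T.
Qed.
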